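(* Let $n\ge3$, let $1<s<\infty$, let $\Omega^s\subset\mathbb{R}^n$ be the outward cuspidal domain $$\Omega^s:=\{(t,x)\in\mathbb{R}\times\mathbb{R}^{n-1}: 0<t\le 1,\ |x|<t^s\}\cup B((2,0),\sqrt2),$$ and let $\mathcal{R}_1$ be the reflection over $\partial\Omega^s$ described in the context. Then: (a) Both $\Omega^s$ and $\mathbb{R}^n\setminus\overline{\Omega^s}$ are $(\infty,\infty)$-extension domains. (b) The reflection $\mathcal{R}_1$ induces a bounded linear extension operator from $W^{1,\infty}(\Omega^s)$ to $W^{1,\infty}(\mathbb{R}^n)$. (c) No reflection over $\partial\Omega^s$ induces a bounded linear extension operator from $W^{1,\infty}(\mathbb{R}^n\setminus\overline{\Omega^s})$ to $W^{1,\infty}(\mathbb{R}^n)$.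
   Context: Points of $\mathbb{R}^n=\mathbb{R}\times\mathbb{R}^{n-1}$ are written $z=(t,x)$; $B(z,r)$ is the open ball; $\widehat{\mathbb{R}^n}=\mathbb{R}^n\cup\{\infty\}$ is the one-point compactification; $B(\Omega,r)=\{z: d(z,\Omega)<r\}$. $W^{1,p}(\Omega)$, $p\in[1,\infty]$, is the Sobolev space of $u\in L^p(\Omega)$ with distributional gradient $Du$ in $L^p$, with norm $\|u\|_{L^p(\Omega)}+\||Du|\|_{L^p(\Omega)}$. Extension domain: for $1\le q\le p\le\infty$, a domain $\Omega\subset\mathbb{R}^n$ is a $(p,q)$-extension domain if there is a constant $C$ such that every $u\in W^{1,p}(\Omega)$ admits $Eu\in W^{1,q}_{\rm loc}(\mathbb{R}^n)$ with $Eu|_\Omega= u$ and $\|Eu\|_{W^{1,q}(\mathbb{R}^n\setminus\overline\Omega)}\le C\|u\|_{W^{1,p}(\Omega)}$. Reflection: for a domain $\Omega\subset\mathbb{R}^n$, a self-homeomorphism $\mathcal{R}:\widehat{\mathbb{R}^n}\to\widehat{\mathbb{R}^n}$ is a reflection over $\partial\Omega$ if $\mathcal{R}(\widehat{\mathbb{R}^n}\setminus\overline\Omega)=\Omega$, $\mathcal{R}(\Omega)=\widehat{\mathbb{R}^n}\setminus\overline\Omega$, and $\mathcal{R}(z)=z$ for every $z\in\partial\Omega$. Induced extension: let $\Omega$ be a bounded domain with $|\partial\Omega|=0$ and $\mathcal{R}$ a reflection over $\partial\Omega$. $\mathcal{R}$ induces a bounded linear extension operator from $W^{1,p}(\Omega)$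 to $W^{1,q}(\mathbb{R}^n)$ if there are an open set $U\supset\partial\Omega$ and $C>0$ such that for every $u\in W^{1,p}(\Omega)$ the function $v$ with $v=u$ on $\Omega\cap U$ and $v=u\circ\mathcal{R}$ on $U\setminus\overline\Omega$ has a representative that belongs to $W^{1,q}(U)$ with $\|v\|_{W^{1,q}(U)}\le C\|u\|_{W^{1,p}(U\cap\Omega)}$. Similarly, $\mathcal{R}$ induces a bounded linear extension operator from $W^{1,p}(\mathbb{R}^n\setminus\overline\Omega)$ to $W^{1,q}(\mathbb{R}^n)$ if there are an open set $U\supset\partial\Omega$ and $C>0$ such that for every $u\in W^{1,p}(\mathbb{R}^n\setminus\overline\Omega)$ the function $\tilde v$ with $\tilde v=u$ on $U\setminus\overline\Omega$ and $\tilde v=u\circ\mathcal{R}$ on $U\cap\Omega$ has a representative that belongs to $W^{1,q}(U)$ with $\|\tilde v\|_{W^{1,q}(U)}\le C\|u\|_{W^{1,p}(U\setminus\overline\Omega)}$. The reflection $\mathcal{R}_1$: put $\Delta:=\{(t,x): -\frac12<t<\frac12,\ |x|<\frac12\}\cup\Omega^s$ and $A:=\{-\frac12<t\le0,\ |x|\le|t|\}$, $B:=\{-\frac12<t<\frac12,\ |t|\le|x|<\frac12\}$, $C:=\{0\le t<\frac12,\ t^s\le|x|\le t\}$, which cover $\Delta\setminus\overline{\Omega^s}$. On $\Delta\setminus\overline{\Omega^s}$, $$\mathcal{R}_1(t,x)=\begin{cases}\left(-t,\ \frac16|t|^{s-1}x\right), & (t,x)\in A,\\[2pt] \left(|x|,\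 \frac t6|x|^{s-2}x+\frac13|x|^{s-1}x\right), & (t,x)\in B,\\[2pt] \left(t,\ \frac{t^{s-1}}{2(t^{s-1}-1)}x+\Big(t^s-\frac{t^{2s-1}}{2(t^{s-1}-1)}\Big)\frac{x}{|x|}\right), & (t,x)\in C,\end{cases}$$ which maps $\Delta\setminus\overline{\Omega^s}$ into $\Omega^s_1:=\{(t,x)\in\Omega^s:0<t<\frac12,\ |x|<t^s\}$. $\mathcal{R}_1$ is a fixed reflection $\widehat{\mathbb{R}^n}\to\widehat{\mathbb{R}^n}$ over $\partial\Omega^s$ (such a reflection can be constructed) which is given by this formula on $\Delta\setminus\overline{\Omega^s}$, is the identity on $\partial\Omega^s$, is bi-Lipschitz on $B(\Omega^s,1)\setminus\Delta$, and whose restriction to $\Omega^s$ is the inverse of its restriction to $\widehat{\mathbb{R}^n}\setminus\overline{\Omega^s}$ (i.e. $\mathcal{R}_1\circ\mathcal{R}_1=\mathrm{id}$). *)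

(* Defs.v *)
From HB Require Import structures.
From mathcomp Require Import all_boot all_order all_algebra.
From mathcomp Require Import all_classical all_reals all_analysis.

Set Implicit Arguments.
Unset Strict Implicit.
Unset Printing Implicit Defensive.
Import Order.TTheory GRing.Theory Num.Theory.
Import numFieldNormedType.Exports.
Local Open Scope classical_set_scope.
Local Open Scope ring_scope.

(* The product of the Borel sigma-algebras of the factors, which is the Borel
   sigma-algebra of 'rV[R]_n because R is second countable. *)
Section measurable_rV.
Context {R : realType}.
Variable n : nat.

Definition coord_rV (i : 'I_n) (v : 'rV[R]_n) : R := v ord0 i.

Let rV_set0 : g_sigma_preimage coord_rV set0.
Proof. exact: sigma_algebra0. Qed.

Let rV_setC A : g_sigma_preimage coord_rV A -> g_sigma_preimage coord_rV (~` A).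
Proof. exact: sigma_algebraC. Qed.

Let rV_bigcup (F : _^nat) : (forall i, g_sigma_preimage coord_rV (F i)) ->
  g_sigma_preimage coord_rV (\bigcup_i (F i)).
Proof. exact: sigma_algebra_bigcup. Qed.

HB.instance Definition _ :=
  @isMeasurable.Build (measure_tuple_display default_measure_display)
  'rV[R]_n (g_sigma_preimage coord_rV) rV_set0 rV_setC rV_bigcup.

End measurable_rV.

Section measurable_coord.
Context {R : realType}.

Lemma measurable_coord_rV n (i : 'I_n) :
  measurable_fun [set: 'rV[R]_n] (coord_rV i).
Proof.
move=> _ Y mY; rewrite setTI; apply: sub_sigma_algebra => /=.
rewrite -bigcup_seq/=; exists i => /=; first by rewrite mem_index_enum.
by exists Y => //; rewrite setTI.
Qed.

Lemma measurable_fun_rV d (T : measurableType d) n (f : T -> 'rV[R]_n) :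
  (forall i, measurable_fun [set: T] (coord_rV i \o f)) ->
  measurable_fun [set: T] f.
Proof.
move=> mf; suff prefS : g_sigma_preimage (fun i => coord_rV i \o f) `<=`
    (@measurable d T).
  move=> _ A mA; apply: prefS.
  by rewrite g_sigma_preimage_comp; exists A.
apply: smallest_sub; first exact: sigma_algebra_measurable.
case: n => [|n] in f mf *; first by rewrite big_ord0.
rewrite -bigcup_mkord_ord; apply: bigcup_sub => i Ii.
by move=> A [B mB <-]; exact: mf.
Qed.

End measurable_coord.

Section points.
Context {R : realType} {n : nat}.

Definition pt (t : R) (x : 'rV[R]_n) : 'rV[R]_n.+1 :=
  \row_i oapp (x ord0) t (unlift ord0 i).
Definition tcoord (z : 'rV[R]_n.+1) : R := z ord0 ord0.
Definition xcoord (z : 'rV[R]_n.+1) : 'rV[R]_n :=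
  \row_j z ord0 (lift ord0 j).

Lemma tcoord_pt t x : tcoord (pt t x) = t.
Proof. by rewrite /tcoord mxE unlift_none. Qed.

Lemma xcoord_pt t x : xcoord (pt t x) = x.
Proof. by apply/rowP => j; rewrite !mxE liftK. Qed.

Lemma pt_tx z : pt (tcoord z) (xcoord z) = z.
Proof. by apply/rowP => i; rewrite mxE; case: unliftP => [j|] -> //=; rewrite mxE. Qed.

Definition cons_pt (y : measurableTypeR R * 'rV[R]_n) : 'rV[R]_n.+1 := pt y.1 y.2.
Definition uncons_pt (z : 'rV[R]_n.+1) : measurableTypeR R * 'rV[R]_n :=
  (tcoord z, xcoord z).

Lemma measurable_cons_pt : measurable_fun setT cons_pt.
Proof.
apply: measurable_fun_rV => i; case: (unliftP ord0 i) => [j|] ->.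
  rewrite (_ : _ \o _ = coord_rV j \o snd); last first.
    by apply/funext => y; rewrite /= /coord_rV mxE liftK.
  by apply: measurableT_comp => //; exact: measurable_coord_rV.
rewrite (_ : _ \o _ = fst) //.
by apply/funext => y; rewrite /= /coord_rV mxE unlift_none.
Qed.

Lemma measurable_uncons_pt : measurable_fun setT uncons_pt.
Proof.
apply/measurable_fun_pairP; split; first exact: measurable_coord_rV.
apply: measurable_fun_rV => j.
rewrite (_ : _ \o _ = coord_rV (lift ord0 j)); first exact: measurable_coord_rV.
by apply/funext => z; rewrite /= /coord_rV mxE.
Qed.

End points.

Section lebesgue_step.
Context {R : realType} {n : nat}.
Variable mu : {sigma_finite_measure set 'rV[R]_n -> \bar R}.

Definition leb_step : set 'rV[R]_n.+1 -> \bar R :=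
  pushforward (@lebesgue_measure R \x mu)%E cons_pt.

Let leb_step0 : leb_step set0 = 0%E.
Proof. by rewrite /leb_step /pushforward preimage_set0 measure0. Qed.

Let leb_step_ge0 A : (0 <= leb_step A)%E.
Proof. exact: (measure_ge0 (@lebesgue_measure R \x mu)%E). Qed.

Let leb_step_sigma_additive : semi_sigma_additive leb_step.
Proof.
move=> F mF tF mUF; rewrite /leb_step /pushforward preimage_bigcup.
have mpre A : measurable A -> measurable (cons_pt @^-1` A).
  by move=> mA; rewrite -[X in measurable X]setTI; exact: measurable_cons_pt.
apply: measure_semi_sigma_additive.
- by move=> k; exact: mpre.
- apply/trivIsetP => /= i j _ _ ij; rewrite -preimage_setI.
  by move/trivIsetP : tF => /(_ _ _ _ _ ij) ->//; rewrite preimage_set0.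
- by rewrite -preimage_bigcup; exact: mpre.
Qed.

HB.instance Definition _ := isMeasure.Build _ _ _ leb_step
  leb_step0 leb_step_ge0 leb_step_sigma_additive.

Let leb_step_sigma_finite : sigma_finite setT leb_step.
Proof.
have /sigma_finiteP[F [TF ndF Foo]] := sigma_finiteT (@lebesgue_measure R).
have /sigma_finiteP[G [TG ndG Goo]] := sigma_finiteT mu.
exists (fun k => uncons_pt @^-1` (F k `*` G k)).
  rewrite -preimage_bigcup (_ : \bigcup_k (F k `*` G k) = setT) //.
  rewrite -setXTT TF TG; apply/seteqP; split=> -[t x] /=.
    by move=> [k _ [Ft Gx]]; split; exists k.
  move=> [[k _ Fkt] [l _ Glx]]; exists (maxn k l) => //; split.
  - by move: t Fkt; exact/subsetPset/ndF/leq_maxl.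
  - by move: x Glx; exact/subsetPset/ndG/leq_maxr.
move=> k; have [mF Fk] := Foo k; have [mG Gk] := Goo k; split.
  rewrite -[X in measurable X]setTI; apply: measurable_uncons_pt => //.
  exact: measurableX.
rewrite /leb_step /pushforward -comp_preimage (_ : _ \o _ = id) //.
  by rewrite preimage_id product_measure1E// lte_mul_pinfty// ge0_fin_numE.
by apply/funext => -[t x]; rewrite /uncons_pt /cons_pt /= tcoord_pt xcoord_pt.
Qed.

HB.instance Definition _ := Measure_isSigmaFinite.Build _ _ _ leb_step
  leb_step_sigma_finite.

End lebesgue_step.

(* Lebesgue measure; [leb_box] gives the volume of boxes. *)
Fixpoint leb {R : realType} (n : nat) :
    {sigma_finite_measure set 'rV[R]_n -> \bar R} :=
  match n with
  | 0 => [the {sigma_finite_measure set _ -> \bar _} of \d_(0 : 'rV[R]_0)]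
  | m.+1 => [the {sigma_finite_measure set _ -> \bar _} of leb_step (leb m)]
  end.
Arguments leb {R n}.

Lemma leb_box {R : realType} n (A : 'I_n -> set R) :
  (forall i, measurable (A i)) ->
  leb [set v : 'rV[R]_n | forall i, A i (v ord0 i)] =
    (\prod_(i < n) lebesgue_measure (A i))%E.
Proof.
elim: n A => [|n IH] A mA.
  by rewrite big_ord0 /= diracE mem_set // => -[].
rewrite big_ord_recl -IH; last by move=> i; exact: mA.
have mB : measurable [set v : 'rV[R]_n | forall i, A (lift ord0 i) (v ord0 i)].
  rewrite [X in measurable X](_ : _ = \bigcap_(i in [set: 'I_n])
      (coord_rV i @^-1` A (lift ord0 i))); last first.
    by apply/seteqP; split => x /= Ax i; [move=> _|]; apply: Ax.
  apply: fin_bigcap_measurable => // i _.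
  by rewrite -[X in measurable X]setTI; apply: measurable_coord_rV.
rewrite -(@product_measure1E _ _ _ _ _ (@lebesgue_measure R) (@leb R n)) //;
  last exact: (mA ord0).
rewrite [LHS]/= /leb_step /pushforward; congr product_measure1.
apply/seteqP; split => -[t x] /=.
- by move=> H; split => [|i]; [have := H ord0|have := H (lift ord0 i)];
    rewrite mxE ?unlift_none ?liftK.
- by move=> [At Ax] i; rewrite mxE; case: unliftP => [j|] ->.
Qed.

Section euclidean.
Context {R : realType} {n : nat}.
Implicit Types (z : 'rV[R]_n) (A : set 'rV[R]_n).

(* The library norm on 'rV[R]_n is the sup norm. *)
Definition enorm z : R := Num.sqrt (\sum_(i < n) z ord0 i ^+ 2).

Definition eball z (r : R) : set 'rV[R]_n := [set w | enorm (w - z) < r].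

Definition edist z A : R := inf [set enorm (z - w) | w in A].

Definition boundary A : set 'rV[R]_n := closure A `\` A^°.

Definition is_domain A := [/\ open A, connected A & A !=set0].

End euclidean.

Section sobolev.
Context {R : realType} {n : nat}.
Implicit Types (O : set 'rV[R]_n) (u : 'rV[R]_n -> R) (g : 'rV[R]_n -> 'rV[R]_n).

Definition partial (i : 'I_n) u : 'rV[R]_n -> R := 'D_(delta_mx ord0 i) u.

Definition iter_partial (l : seq 'I_n) u : 'rV[R]_n -> R := foldr partial u l.

Definition smooth u := forall l : seq 'I_n,
  continuous (iter_partial l u) /\
  forall i z, derivable (iter_partial l u) z (delta_mx ord0 i).

Definition test_function O u :=
  let supp := closure [set z | u z != 0] in
  [/\ smooth u, compact supp & supp `<=` O].

Definition loc_integrable O u :=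
  measurable_fun O u /\
  forall K, compact K -> K `<=` O -> leb.-integrable K (EFin \o u).

Definition is_weak_gradient O u g :=
  [/\ loc_integrable O u,
      forall i, loc_integrable O (fun z => g z ord0 i) &
      forall (i : 'I_n) phi, test_function O phi ->
        (\int[leb]_(z in O) (u z * partial i phi z)%:E =
         - \int[leb]_(z in O) (g z ord0 i * phi z)%:E)%E].

(* The distributional gradient, which is unique up to a null set; its value is
   irrelevant when [u] has none. *)
Definition weak_gradient O u : 'rV[R]_n -> 'rV[R]_n :=
  xget (fun=> 0) [set g | is_weak_gradient O u g].

(* Functions are total, but only their values on [O] matter: [u \_ O] is [u] on [O]
   and [0] elsewhere. *)
Definition Lp_norm (p : \bar R) O u : \bar R := 'N[leb]_p [EFin \o (u \_ O)]%E.

(* The elements are Borel representatives; every Lebesgue measurable function is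
   a.e. equal to a Borel one. *)
Definition W1p (p : \bar R) O u :=
  [/\ u \_ O \in Lfun leb p,
      exists g, is_weak_gradient O u g &
      (enorm \o weak_gradient O u) \_ O \in Lfun leb p].

Definition W1p_norm (p : \bar R) O u : \bar R :=
  (Lp_norm p O u + Lp_norm p O (enorm \o weak_gradient O u))%E.

Definition W1p_loc (p : \bar R) O u := forall V : set 'rV[R]_n,
  open V -> compact (closure V) -> closure V `<=` O -> W1p p V u.

Definition ae_eq_on O u v := {ae leb, forall z, O z -> u z = v z}.

Definition extension_domain (p q : \bar R) O := is_domain O /\
  exists C : R, forall u, W1p p O u -> exists v,
    [/\ W1p_loc q setT v, ae_eq_on O v u,
        W1p q (~` closure O) v &
        (W1p_norm q (~` closure O) v <= C%:E * W1p_norm p O u)%E].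

End sobolev.

Section reflections.
Context {R : realType} {n : nat}.
Local Notation E := 'rV[R]_n.
Local Notation Ehat := (one_point_compactification E).
Implicit Types (O : set E) (r : Ehat -> Ehat) (u : E -> R).

Definition self_homeo r := exists r' : Ehat -> Ehat,
  [/\ cancel r r', cancel r' r, continuous r & continuous r'].

Definition is_reflection O r :=
  let O' : set Ehat := Some @` O in
  let ext : set Ehat := ~` (Some @` closure O) in
  [/\ self_homeo r, r @` ext = O', r @` O' = ext &
      forall z : E, boundary O z -> r (Some z) = Some z].

(* The restriction of a self-map of the sphere to R^n, with a dummy value at the points
   that are sent to infinity (for a bijection there is at most one). *)
Definition finpart r (z : E) : E := odflt 0 (r (Some z)).

(* [v] is unconstrained on the boundary of [O], which is meant to be a null set.  As [u]
   runs over all representatives, the class of [u \o finpart r] has to depend on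
   the class of [u] only. *)
Definition induces_ext_from_inside (p q : \bar R) O r :=
  exists U : set E, [/\ open U, boundary O `<=` U &
  exists2 C : R, 0 < C & forall u, W1p p O u -> exists v,
    [/\ ae_eq_on (O `&` U) v u,
        ae_eq_on (U `\` closure O) v (u \o finpart r),
        W1p q U v &
        (W1p_norm q U v <= C%:E * W1p_norm p (U `&` O) u)%E]].

Definition induces_ext_from_outside (p q : \bar R) O r :=
  exists U : set E, [/\ open U, boundary O `<=` U &
  exists2 C : R, 0 < C & forall u, W1p p (~` closure O) u -> exists v,
    [/\ ae_eq_on (U `\` closure O) v u,
        ae_eq_on (U `&` O) v (u \o finpart r),
        W1p q U v &
        (W1p_norm q U v <= C%:E * W1p_norm p (U `\` closure O) u)%E]].

End reflections.

Section cusp.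
Context {R : realType} {n : nat}.
Local Notation E := 'rV[R]_n.+1.
Local Notation Ehat := (one_point_compactification E).
Variable s : R.

Definition cusp_domain : set E :=
  [set z | [/\ 0 < tcoord z, tcoord z <= 1 & enorm (xcoord z) < tcoord z `^ s]]
  `|` eball (pt 2 0) (Num.sqrt 2).

Definition cusp_box : set E :=
  [set z | [/\ - 2^-1 < tcoord z, tcoord z < 2^-1 & enorm (xcoord z) < 2^-1]]
  `|` cusp_domain.

Definition zoneA : set E :=
  [set z | [/\ - 2^-1 < tcoord z, tcoord z <= 0 &
               enorm (xcoord z) <= `|tcoord z| ]].
Definition zoneB : set E :=
  [set z | [/\ - 2^-1 < tcoord z, tcoord z < 2^-1,
               `|tcoord z| <= enorm (xcoord z) & enorm (xcoord z) < 2^-1]].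
Definition zoneC : set E :=
  [set z | [/\ 0 <= tcoord z, tcoord z < 2^-1,
               tcoord z `^ s <= enorm (xcoord z) & enorm (xcoord z) <= tcoord z]].

Definition formulaA (t : R) (x : 'rV[R]_n) : E :=
  pt (- t) ((6^-1 * `|t| `^ (s - 1)) *: x).
Definition formulaB (t : R) (x : 'rV[R]_n) : E :=
  let a := enorm x in
  pt a ((t / 6 * a `^ (s - 2)) *: x + (3^-1 * a `^ (s - 1)) *: x).
Definition formulaC (t : R) (x : 'rV[R]_n) : E :=
  pt t ((t `^ (s - 1) / (2 * (t `^ (s - 1) - 1))) *: x
        + (t `^ s - t `^ (2 * s - 1) / (2 * (t `^ (s - 1) - 1)))
            *: ((enorm x)^-1 *: x)).

Definition bilipschitz_on (A : set E) (f : E -> E) := exists2 L : R, 0 < L &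
  forall z w, A z -> A w ->
    L^-1 * enorm (z - w) <= enorm (f z - f w) /\
    enorm (f z - f w) <= L * enorm (z - w).

(* The three formulas agree where the zones overlap. *)
Definition is_cusp_reflection (r : Ehat -> Ehat) :=
  let D := cusp_box `\` closure cusp_domain in
  [/\ is_reflection cusp_domain r,
      forall z, D z ->
        [/\ zoneA z -> r (Some z) = Some (formulaA (tcoord z) (xcoord z)),
            zoneB z -> r (Some z) = Some (formulaB (tcoord z) (xcoord z)) &
            zoneC z -> r (Some z) = Some (formulaC (tcoord z) (xcoord z))],
      bilipschitz_on ([set z | edist z cusp_domain < 1] `\` cusp_box) (finpart r) &
      involutive r].

End cusp.
Arguments cusp_domain {R} n s.

(* Main.v *)
(** A bounded function whose weak gradient is bounded is almost everywhere equal to a locally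
    Lipschitz function: testing it against products of one-dimensional bumps bounds the
    oscillation of its averages over boxes. If nearby points of an open set O are joined in O by
    polygonal paths of comparable length, the representative is Lipschitz on O, and McShane's
    extension of it belongs to W^{1,oo} of every open set, because a Lipschitz function has a
    bounded weak gradient. Both the cusp and its exterior are such sets; in the exterior one walks
    around the cusp in a direction orthogonal to the axis, which is where n >= 3 is used.

    The reflection R_1 is Lipschitz on each of finitely many pieces that cover a neighbourhood of
    the cusp, hence along short segments, and on each piece it is inverse Lipschitz away from the
    tip, so that it pulls null sets back to null sets; composing with it extends functions.

    Conversely, if a reflection r extends the coordinate functions from the exterior, it moves the
    points of the cusp at a small height t by O(t^s), which is less than t. A path in the exterior
    that avoids the ball of radius t around (t,0) and goes from below the tip to above the apex
    is mapped by the inverse of r to a path in the cusp that crosses height t, while r maps the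
    crossing point into that ball. *)

From HB Require Import structures.
Require Import Defs.
From mathcomp Require Import all_boot all_order all_algebra.
From mathcomp Require Import all_classical all_reals all_analysis.
From mathcomp Require Import measurable_realfun ess_sup_inf ring lra.

Set Implicit Arguments.
Unset Strict Implicit.
Unset Printing Implicit Defensive.
Import Order.TTheory GRing.Theory Num.Theory.
Import numFieldNormedType.Exports.
Local Open Scope classical_set_scope.
Local Open Scope ring_scope.

(** * Lebesgue measure on boxes *)

Section rV_boxes.
Context {R : realType} {n : nat}.
Implicit Types (a b z w : 'rV[R]_n) (A B : set 'rV[R]_n).

(** The obstacle in the reflection is the factor [t ^ (s - 1)], which for [s < 2] is not Lipschitz
    at the tip. It only multiplies vectors of length at most [t], and [t * t ^ (s - 1) = t ^ s] is
    Lipschitz on [0, 1], so upper bounds survive. Lower bounds lose that factor, hence null sets are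
    pulled back on countably many sets that avoid the tip. These null sets matter because [u] is
    known only up to a null set while its composition with the reflection has to be a well defined
    class. In the exterior the useful quantity is the squared distance to the axis: along a segment
    of length at most [T] it falls below its linear interpolation by at most [T ^ 2 / 4], while an
    orthogonal detour of length [T] raises it by at least [T ^ 2], and the squared profile
    [t ^ (2 * s)] is convex. When an endpoint lies above height 1, where the profile stops,
    convexity says nothing; there the ball alone bounds the exterior at scales below [junction_gap].
    In the negative part the extension has a Lipschitz representative, and continuity turns almost
    everywhere equality into equality at each point near the tip, so that the reflection itself is
    controlled pointwise. *)

Definition box a b : set 'rV[R]_n :=
  [set z | forall i, a ord0 i < z ord0 i <= b ord0 i].

Definition vol a b : R := \prod_i (b ord0 i - a ord0 i).

Definition boxes : set (set 'rV[R]_n) := [set box p.1 p.2 | p in setT].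

Lemma measurable_coordset (i : 'I_n) (A : set R) : measurable A ->
  measurable [set z : 'rV[R]_n | A (z ord0 i)].
Proof.
by move=> mA; rewrite -[X in measurable X]setTI; apply: measurable_coord_rV.
Qed.

Lemma measurable_forall_rV (P : 'I_n -> set 'rV[R]_n) :
  (forall i, measurable (P i)) -> measurable [set z | forall i, P i z].
Proof.
move=> mP; rewrite [X in measurable X](_ : _ = \bigcap_(i in [set: 'I_n]) P i).
  by apply: fin_bigcap_measurable => //.
by apply/seteqP; split => x /= Px i; [move=> _|]; exact: Px.
Qed.

Lemma measurable_box a b : measurable (box a b).
Proof.
suff h i : measurable [set z : 'rV[R]_n | a ord0 i < z ord0 i <= b ord0 i].
  exact: (measurable_forall_rV h).
rewrite [X in measurable X](_ : _ =
    [set z : 'rV[R]_n | [set` `]a ord0 i, b ord0 i]] (z ord0 i)]); last first.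
  by apply/seteqP; split=> z /=; rewrite in_itv.
exact: measurable_coordset.
Qed.

Lemma box_emptyVle a b : (forall i, a ord0 i <= b ord0 i) \/ box a b = set0.
Proof.
have [|/existsNP[i /negP]] := pselect (forall i, a ord0 i <= b ord0 i).
  by left.
rewrite -ltNge => ba; right; apply/seteqP; split => // z /(_ i) /andP[h1 h2].
by have := lt_le_trans h1 h2; rewrite ltNge (ltW ba).
Qed.

Lemma leb_boxE a b : (forall i, a ord0 i <= b ord0 i) ->
  leb (box a b) = (vol a b)%:E.
Proof.
have -> : box a b =
    [set v : 'rV[R]_n | forall i, (fun i => [set` `]a ord0 i, b ord0 i]]) i (v ord0 i)].
  by apply/seteqP; split=> z /= h i; have := h i; rewrite /= in_itv.
move=> ab; rewrite (leb_box (A := fun i => [set` `]a ord0 i, b ord0 i]]))//.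
rewrite /vol -prodEFin; apply: eq_bigr => i _.
rewrite lebesgue_measure_itv/= lte_fin; case: ltP => //.
by move=> ba; rewrite (_ : a ord0 i = b ord0 i) ?subrr//; apply/eqP; rewrite eq_le ab ba.
Qed.

Lemma boxI a b c d : box a b `&` box c d =
  box (\row_i Num.max (a ord0 i) (c ord0 i)) (\row_i Num.min (b ord0 i) (d ord0 i)).
Proof.
apply/seteqP; split => z /=.
  move=> [h1 h2] i; rewrite !mxE gt_max le_min.
  by move: (h1 i) (h2 i) => /andP[-> ->] /andP[-> ->].
move=> h; split=> i; have := h i; rewrite !mxE gt_max le_min;
  by move=> /andP[/andP[h1 h2] /andP[h3 h4]]; apply/andP.
Qed.

Lemma boxes_setI : setI_closed boxes.
Proof.
by move=> _ _ [[a b] _ <-] [[c d] _ <-]; rewrite boxI; eexists (_, _).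
Qed.

Lemma bigcup_box : \bigcup_k box (const_mx (- k%:R)) (const_mx k%:R) = setT.
Proof.
apply/seteqP; split => // z _.
pose M := \sum_i `|z ord0 i|.
exists (Num.bound M) => // i; rewrite !mxE.
have h : `|z ord0 i| < (Num.bound M)%:R.
  apply: le_lt_trans (archi_boundP (x := M) _); last exact: sumr_ge0.
  by rewrite /M (bigD1 i)//= lerDl sumr_ge0.
by move: h; rewrite ltr_norml => /andP[-> /ltW ->].
Qed.

(** The sets of reals whose strip in coordinate [i] is generated by boxes form a sigma-algebra, and
    the strip over an interval is the union of the boxes whose other sides are ]-k, k]. *)
Lemma measurable_rVE : @measurable _ 'rV[R]_n = <<s boxes >>.
Proof.
apply/seteqP; split; last first.
  apply: smallest_sub; first exact: sigma_algebra_measurable.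
  by move=> _ [[a b] _ <-]; exact: measurable_box.
apply: smallest_sub; first exact: smallest_sigma_algebra.
rewrite -bigcup_seq => A [i _ [Y mY <-]]; rewrite setTI.
pose G := [set Y : set R | <<s boxes >> [set z : 'rV[R]_n | Y (z ord0 i)]].
suff : <<s (@ocitv R) >> `<=` G by apply.
have [s0 sC sU] := smallest_sigma_algebra setT boxes.
apply: smallest_sub.
  split => //.
  - by move=> B GB; have := sC _ GB; rewrite !setTD.
  - by move=> F GF; exact: sU.
move=> _ [[x y] _ <-] /=; rewrite /G/=.
pose a (k : nat) : 'rV[R]_n := \row_j if j == i then x else - k%:R.
pose b (k : nat) : 'rV[R]_n := \row_j if j == i then y else k%:R.
have -> : [set z : 'rV[R]_n | z ord0 i \in `]x, y]] = \bigcup_k box (a k) (b k).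
  apply/seteqP; split => z /=.
    rewrite in_itv/= => zi.
    have : setT z by []; rewrite -bigcup_box => -[k _ hk].
    exists k => // j; rewrite !mxE; case: eqP => [->//|_].
    by have := hk j; rewrite !mxE.
  by move=> [k _ /(_ i)]; rewrite !mxE eqxx in_itv.
by apply: sU => k; apply: sub_sigma_algebra; exists (a k, b k).
Qed.

Lemma leb_box_fin a b : (leb (box a b) < +oo)%E.
Proof.
apply: (@le_lt_trans _ _ (leb (box (\row_i Num.min (a ord0 i) (b ord0 i)) b))).
  apply: le_measure; rewrite ?inE; [exact: measurable_box|exact: measurable_box|].
  by move=> z h i; have := h i; rewrite mxE gt_min => /andP[-> ->].
by rewrite leb_boxE ?ltry// => i; rewrite mxE ge_min lexx orbT.
Qed.

Lemma measure_box_unique (m1 m2 : {measure set 'rV[R]_n -> \bar R}) :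
  (forall a b, m1 (box a b) = m2 (box a b)) ->
  (forall a b, m1 (box a b) < +oo)%E ->
  forall A, measurable A -> m1 A = m2 A.
Proof.
move=> h1 h2 A mA.
apply: (@measure_unique _ _ _ boxes
  (fun k : nat => box (const_mx (- k%:R)) (const_mx k%:R))) => //.
- exact: measurable_rVE.
- exact: boxes_setI.
- by move=> k; eexists (_, _).
- exact: bigcup_box.
- by move=> _ [[a b] _ <-].
Qed.

End rV_boxes.

(** * Translation invariance and slicing of Lebesgue measure *)

Section leb_invariance.
Context {R : realType}.

Lemma continuous_shift_rV n (h : 'rV[R]_n) :
  measurable_fun setT (fun z : 'rV[R]_n => z + h).
Proof.
apply: measurable_fun_rV => i.
rewrite (_ : _ \o _ = fun z => coord_rV i z + h ord0 i); last first.
  by apply/funext => z; rewrite /= /coord_rV mxE.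
by apply: measurable_funD => //; exact: measurable_coord_rV.
Qed.

Lemma leb_translate n (h : 'rV[R]_n) A : measurable A ->
  leb [set z | A (z + h)] = leb A.
Proof.
pose mu := measure_function_pushforward__canonical__measure_function_Measure
  (@leb R n) (@continuous_shift_rV n h).
move=> mA; have -> : leb [set z | A (z + h)] = mu A by [].
have preE a b : mu (box a b) = leb (box (a - h) (b - h)).
  rewrite /mu/= /pushforward; congr (leb _).
  by apply/seteqP; split=> z /= hz i; have := hz i; rewrite !mxE ltrBlDr lerBrDr.
apply: measure_box_unique => //.
- move=> a b; rewrite preE; have [ab|ab0] := box_emptyVle a b.
    transitivity (vol a b)%:E; last by rewrite -leb_boxE.
    rewrite leb_boxE; last by move=> i; rewrite !mxE lerD2r.
    by congr EFin; apply: eq_bigr => i _; rewrite !mxE; ring.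
  rewrite ab0 (_ : box _ _ = set0) //.
  apply/seteqP; split => // z hz; suff : box a b (z + h) by rewrite ab0.
  by move=> i; have := hz i; rewrite !mxE ltrBlDr lerBrDr.
- by move=> a b; rewrite preE leb_box_fin.
Qed.

Lemma leb_slice n (A : set 'rV[R]_n.+1) : measurable A ->
  leb A = (\int[@lebesgue_measure R]_t leb [set x | A (pt t x)])%E.
Proof.
move=> mA; rewrite [LHS]/= /leb_step /pushforward /product_measure1.
apply: eq_integral => t _ /=; congr (leb _).
by apply/seteqP; split => x; rewrite /xsection /= inE.
Qed.

Lemma measurable_cons_preimage n (A : set 'rV[R]_n.+1) : measurable A ->
  measurable (cons_pt @^-1` A).
Proof. by move=> mA; rewrite -[X in measurable X]setTI; exact: measurable_cons_pt. Qed.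

(** By definition the outer integral of [leb] is over [t]; uniqueness of the product measure allows
    it to be over [x] instead. *)
Lemma leb_slice' n (A : set 'rV[R]_n.+1) : measurable A ->
  leb A = (\int[@leb R n]_x lebesgue_measure [set t | A (pt t x)])%E.
Proof.
move=> mA; rewrite [LHS]/= /leb_step /pushforward.
have mB := measurable_cons_preimage mA.
transitivity ((lebesgue_measure \x^ leb)%E (cons_pt @^-1` A)).
  by apply: product_measure_unique => // B C mB' mC/=; rewrite product_measure2E.
rewrite /product_measure2.
apply: eq_integral => x _ /=; congr (lebesgue_measure _).
by apply/seteqP; split => t; rewrite /ysection /= inE.
Qed.

Lemma pt_addl n t h (x : 'rV[R]_n) : pt t x + h *: delta_mx ord0 ord0 = pt (t + h) x.
Proof.
apply/rowP => j; rewrite !mxE; case: unliftP => [k|] -> /=.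
  by rewrite mulr0 addr0.
by rewrite mulr1.
Qed.

Lemma pt_addr n t h i (x : 'rV[R]_n) :
  pt t x + h *: delta_mx ord0 (lift ord0 i) = pt t (x + h *: delta_mx ord0 i).
Proof.
apply/rowP => j; rewrite !mxE; case: unliftP => [k|] -> /=.
  by rewrite !mxE (inj_eq (@lift_inj _ _)).
by rewrite mulr0 addr0.
Qed.

Lemma measurable_slice n (A : set 'rV[R]_n.+1) t : measurable A ->
  measurable [set x | A (pt t x)].
Proof.
move=> mA; have := measurable_xsection t (measurable_cons_preimage mA).
by congr (measurable _); apply/seteqP; split => x; rewrite /xsection /= inE.
Qed.

(** Fubini, by recursion on the dimension: the direction is either the first coordinate or lies in
    the remaining ones. This carries one-dimensional almost everywhere statements, such as the
    differentiability of Lipschitz functions, over to [R^n]. *)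
Lemma leb_line_null n (i : 'I_n) (A : set 'rV[R]_n) : measurable A ->
  (forall z, lebesgue_measure [set t | A (z + t *: delta_mx ord0 i)] = 0%E) ->
  leb A = 0%E.
Proof.
elim: n i A => [[]//|n IH i A mA h].
case: (unliftP ord0 i) h => [j|] -> h.
  rewrite leb_slice// integral0_eq// => t _; apply: (IH j).
    exact: measurable_slice.
  move=> x; rewrite -(h (pt t x)); congr (lebesgue_measure _).
  by apply/seteqP; split => r /=; rewrite pt_addr.
rewrite leb_slice'// integral0_eq// => x _.
rewrite -(h (pt 0 x)); congr (lebesgue_measure _).
by apply/seteqP; split => t /=; rewrite pt_addl add0r.
Qed.

End leb_invariance.

(** * Boxes, open sets and functions with vanishing box integrals *)

Section rV_topology.
Context {R : realType} {n : nat}.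
Implicit Types (a b z w : 'rV[R]_n) (A O : set 'rV[R]_n).

Definition cbox a b : set 'rV[R]_n :=
  [set z | forall i, a ord0 i <= z ord0 i <= b ord0 i].

Lemma box_cbox a b : box a b `<=` cbox a b.
Proof. by move=> z h i; have /andP[/ltW -> ->] := h i. Qed.

Lemma nbhs_rVP z A : nbhs z A <->
  exists2 e : R, 0 < e & forall w, (forall i, `|z ord0 i - w ord0 i| < e) -> A w.
Proof.
split.
  move/nbhs_ballP => [e /= e0 he]; exists e => // w hw; apply: he; split=> // i j.
  by rewrite (ord1 i); exact: hw.
move=> [e e0 he]; apply/nbhs_ballP; exists e => // w [_ hw]; apply: he => i.
exact: hw.
Qed.

(** Boxes with rational corners. The closed boxes are required to lie in [O] so that integrability
    on compact subsets of [O] applies to each of them. *)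
Lemma open_boxes O : open O ->
  exists (F : nat -> 'rV[R]_n * 'rV[R]_n) (D : set nat),
    (forall k, D k -> cbox (F k).1 (F k).2 `<=` O) /\
    O `<=` \bigcup_(k in D) box (F k).1 (F k).2.
Proof.
move=> oO.
(* The default for numbers that code no pair is harmless: the set of indices keeps only the closed
   boxes contained in [O]. *)
pose F (k : nat) : 'rV[R]_n * 'rV[R]_n :=
  if @unpickle ('rV[rat]_n * 'rV[rat]_n)%type k is Some (p, q)
  then (map_mx ratr p, map_mx ratr q) else (0, 0).
exists F, [set k | cbox (F k).1 (F k).2 `<=` O]; split => // z Oz.
have /nbhs_rVP[e e0 he] : nbhs z O by exact: open_nbhs_nbhs.
have hp i : exists p : rat, ratr p \in `](z ord0 i - e), (z ord0 i)[.
  by apply: rat_in_itvoo; rewrite ltrBlDr ltrDl.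
have hq i : exists q : rat, ratr q \in `](z ord0 i), (z ord0 i + e)[.
  by apply: rat_in_itvoo; rewrite ltrDl.
have [p hp'] := choice hp; have [q hq'] := choice hq.
exists (pickle (\row_i p i, \row_i q i : 'rV[rat]_n)).
  rewrite /F /= pickleK /= => w hw; apply: he => i; have := hw i.
  have := hp' i; have := hq' i; rewrite !in_itv/= !mxE => /andP[h1 h2] /andP[h3 h4] /andP[h5 h6].
  by rewrite ltr_norml; apply/andP; split; lra.
rewrite /F /= pickleK /= => i; rewrite !mxE.
have := hp' i; have := hq' i; rewrite !in_itv/= => /andP[h1 h2] /andP[h3 h4].
by rewrite h4 (ltW h1).
Qed.

Lemma open_measurable_rV O : open O -> measurable O.
Proof.
move=> oO; have [F [D [h1 h2]]] := open_boxes oO.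
rewrite (_ : O = \bigcup_(k in D) box (F k).1 (F k).2).
  by apply: bigcup_measurable => k _; exact: measurable_box.
apply/seteqP; split => // z [k Dk hz]; apply: (h1 k) => //; exact: box_cbox.
Qed.

Lemma closed_measurable_rV A : closed A -> measurable A.
Proof.
move=> cA; rewrite -(setCK A); apply: measurableC; apply: open_measurable_rV.
exact: closed_openC.
Qed.

Lemma compact_measurable_rV A : compact A -> measurable A.
Proof.
move=> cA; apply: closed_measurable_rV; exact: compact_closed.
Qed.

Lemma continuous_measurable_rV O (f : 'rV[R]_n -> R) : open O ->
  (forall z, O z -> {for z, continuous f}) -> measurable_fun O f.
Proof.
move=> oO cf; apply: (measurability (@RGenOpens.G R)).
  exact: RGenOpens.measurableE.
move=> _ [_ [a [b ->] <-]].
apply: open_measurable_rV; rewrite openE => z [Oz fz].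
have : nbhs z (O `&` f @^-1` `]a, b[).
  apply: filterI; first exact: open_nbhs_nbhs.
  apply: cf => //; apply: open_nbhs_nbhs; split => //; exact: interval_open.
by [].
Qed.

Lemma cbox_compact a b : compact (cbox a b).
Proof.
have -> : cbox a b = [set v : 'rV[R]_n |
    forall i, (fun i => [set` `[a ord0 i, b ord0 i]]) i (v ord0 i)].
  by apply/seteqP; split => z /= h i; have := h i; rewrite /= in_itv.
apply: (rV_compact (A := fun i => [set` `[a ord0 i, b ord0 i]])) => i.
exact: segment_compact.
Qed.

Lemma compact_sub_box A : compact A ->
  exists2 r : R, 0 < r & A `<=` box (const_mx (- r)) (const_mx r).
Proof.
move=> /compact_bounded[M [Mr hM]].
exists (`|M| + 1); first by rewrite ltr_wpDl.
move=> z Az i; rewrite !mxE.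
have h : `|z| <= `|M| + 2^-1.
  by apply: hM => //; rewrite (le_lt_trans (ler_norm M))// ltrDl invr_gt0.
have {}h : `|z ord0 i| <= `|M| + 2^-1.
  apply: le_trans h; rewrite /Num.norm/= mx_normrE.
  exact: (le_bigmax _ (fun ij : 'I_1 * 'I_n => `|z ij.1 ij.2|) (ord0, i)).
by move: h; rewrite ler_norml => /andP[h1 h2]; apply/andP; split; lra.
Qed.

Lemma leb_compact_fin A : compact A -> (leb A < +oo)%E.
Proof.
move=> cA; have [r r0 hr] := compact_sub_box cA.
apply: (@le_lt_trans _ _ (leb (box (const_mx (- r)) (const_mx r)))).
  apply: le_measure; rewrite ?inE//; last exact: measurable_box.
  exact: compact_measurable_rV.
exact: leb_box_fin.
Qed.

(** The measurable sets on which the integral vanishes form a Dynkin class containing the boxes,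
    which are stable under intersection; hence all integrals vanish. *)
Lemma box_integral0_ae (f : 'rV[R]_n -> R) a0 b0 :
  leb.-integrable (box a0 b0) (EFin \o f) ->
  (forall a b, box a b `<=` box a0 b0 ->
    (\int[leb]_(z in box a b) (f z)%:E = 0)%E) ->
  {ae leb, forall z, box a0 b0 z -> f z = 0}.
Proof.
move=> fi h; set D := box a0 b0 in fi h *.
have mD : measurable D by exact: measurable_box.
have fiS A : measurable A -> leb.-integrable (D `&` A) (EFin \o f).
  move=> mA; apply: integrableS fi => //; exact: measurableI.
have key A : measurable A -> (\int[leb]_(z in D `&` A) (f z)%:E = 0)%E.
  rewrite measurable_rVE.
  apply: (@dynkin_induction _ _ boxes
    (fun A => (\int[leb]_(z in D `&` A) (f z)%:E = 0)%E)).
  - exact: measurable_rVE.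
  - exact: boxes_setI.
  - by rewrite /= setIT h.
  - move=> _ [[a b] _ <-]; rewrite /= boxI; apply: h.
    by rewrite -boxI => z [].
  - move=> S mS /= IS.
    have := h a0 b0 (@subset_refl _ _).
    rewrite -/D {1}(_ : D = (D `&` S) `|` (D `&` ~` S)); last first.
      by rewrite -setIUr setUv setIT.
    rewrite integral_setU//.
    + by rewrite IS add0e.
    + exact: measurableI.
    + by apply: measurableI => //; exact: measurableC.
    + rewrite -setIUr setUv setIT; exact: (measurable_int leb fi).
    + rewrite disj_set2E; apply/eqP/seteqP; split => // z [[_ ?] [_]]; exact.
  - move=> F mF tF IF /=; rewrite setI_bigcupr integral_bigcup.
    + by rewrite eseries0// => k _ _; exact: IF.
    + exact: trivIset_setIl.
    + by move=> k; apply: measurableI.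
    + rewrite -setI_bigcupr; apply: fiS; exact: bigcupT_measurable.
have : ae_eq leb D (EFin \o f) (cst 0%E).
  apply: integral_ae_eq => //.
  move=> E ED mE; rewrite integral0 -(key E mE); congr integral.
  by apply/esym/setIidr.
apply: filterS => z hz Dz; by have [] := hz Dz.
Qed.

End rV_topology.

(** * Lipschitz functions have bounded weak gradients *)

Section rademacher1.
Context {R : realType}.
Local Notation mu := (@lebesgue_measure R).

Lemma lipschitz_continuousR (K : R) (f : R -> R) :
  (forall x y, `|f x - f y| <= K * `|x - y|) -> continuous f.
Proof.
move=> fK x; apply/cvgrPdist_lt => e e0.
have K1 : 0 < `|K| + 1 by rewrite ltr_wpDl.
near=> y; apply: le_lt_trans (fK x y) _.
apply: (@le_lt_trans _ _ ((`|K| + 1) * `|x - y|)).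
  by rewrite ler_wpM2r// (le_trans (ler_norm K))// lerDl.
rewrite mulrC -ltr_pdivlMr//.
near: y; apply: (@cvgr_dist_lt _ _ _ _ _ id) => //; exact: divr_gt0.
Unshelve. all: by end_near. Qed.

Lemma lsm_ocitv (F : cumulative R R) a b : a <= b ->
  lebesgue_stieltjes_measure F [set` `]a, b]] = (F b - F a)%:E.
Proof.
move=> ab; rewrite /lebesgue_stieltjes_measure /measure_extension/=.
by rewrite measurable_mu_extE/= ?wlength_itv_bnd//; exact: is_ocitv.
Qed.

(** With constant 1/2 both [x / 2 + f x] and [x / 2 - f x] are nondecreasing, and their Stieltjes
    measures add up to Lebesgue measure. So the first one is absolutely continuous, by Radon-Nikodym
    its function is an indefinite integral, and that is differentiable almost everywhere. *)
Lemma ae_derivable_contraction (f : R -> R) :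
  (forall x y, `|f x - f y| <= 2^-1 * `|x - y|) ->
  {ae mu, forall x, derivable f x 1}.
Proof.
move=> fK; have cf := lipschitz_continuousR fK.
have fle x y : x <= y -> `|f y - f x| <= 2^-1 * (y - x).
  by move=> xy; have := fK y x; rewrite (ger0_norm (_ : 0 <= y - x))// subr_ge0.
pose F x := x / 2 + f x; pose G x := x / 2 - f x.
have cF : continuous F.
  by move=> x; apply: cvgD; [apply: cvgM => //; exact: cvg_cst|exact: cf].
have cG : continuous G.
  by move=> x; apply: cvgB; [apply: cvgM => //; exact: cvg_cst|exact: cf].
have ndF : {homo F : x y / x <= y}.
  by move=> x y xy; have := fle _ _ xy; rewrite ler_norml /F => /andP[? ?]; lra.
have ndG : {homo G : x y / x <= y}.
  by move=> x y xy; have := fle _ _ xy; rewrite ler_norml /G => /andP[? ?]; lra.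
pose mF := isCumulative.Build R _ R F ndF (right_continuousW cF).
pose mG := isCumulative.Build R _ R G ndG (right_continuousW cG).
pose cumF : cumulative R R := HB.pack_for (cumulative R R) F mF.
pose cumG : cumulative R R := HB.pack_for (cumulative R R) G mG.
pose muF : {measure set (measurableTypeR R) -> \bar R} := lebesgue_stieltjes_measure cumF.
pose muG : {measure set (measurableTypeR R) -> \bar R} := lebesgue_stieltjes_measure cumG.
have muFE a b : a <= b -> muF [set` `]a, b]] = (F b - F a)%:E by exact: (lsm_ocitv cumF).
have addE A : measurable A -> (muF A + muG A = mu A)%E.
  move=> mA; rewrite -measure_addE.
  apply/esym/lebesgue_measure_unique => // _ [[a b] _ <-] /=.
  transitivity (muF [set` `]a, b]] + muG [set` `]a, b]])%E; last by rewrite -measure_addE.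
  have [ab|ba] := leP a b.
    rewrite [LHS]lebesgue_measure_itv/= lte_fin.
    rewrite /muF /muG !lsm_ocitv//= /F /G -[RHS]EFinD.
    case: ltgtP ab => // [ab _|-> _]; last by congr EFin; lra.
    by rewrite -[LHS]EFinB; congr EFin; lra.
  by rewrite set_itv_ge ?measure0 ?adde0// -leNgt /= bnd_simp ltW.
(* Bounded intervals make the Stieltjes measure finite, as the Radon-Nikodym derivative of a charge
   requires. *)
suff aeN (N : nat) : {ae mu, forall x, `]- N%:R, N%:R[%classic x -> derivable f x 1}.
  have := ae_foralln aeN; apply: filterS => x hx.
  apply: (hx (Num.bound `|x|)); rewrite /= in_itv/= -ltr_norml.
  exact: archi_boundP.
pose D := [set` `](- N%:R)%R, (N%:R)%R]] : set (measurableTypeR R).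
have mD : measurable D by exact: measurable_itv.
have muFD : (muF D < +oo)%E.
  have -> : muF D = (F N%:R - F (- N%:R))%:E.
    by apply: muFE; rewrite (@le_trans _ _ 0)// oppr_le0.
  exact: ltry.
pose nu := charge_of_finite_measure (mfrestr mD muFD).
have nuE A : nu A = muF (A `&` D) by [].
have nu_mu : nu `<< mu.
  apply/null_content_dominatesP => A mA A0; rewrite nuE.
  have mAD : measurable (A `&` D) by exact: measurableI.
  have AD0 : mu (A `&` D) = 0%E.
    by apply: (subset_measure0 (B := A)) => //; exact: subIsetl.
  apply/eqP; rewrite eq_le measure_ge0 andbT -AD0 -addE//.
  by rewrite leeDl// measure_ge0.
pose g := Radon_Nikodym nu mu.
have gi : mu.-integrable setT g by exact: Radon_Nikodym_integrable.
pose h x := fine (g x).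
have hE : EFin \o h = g.
  by apply/funext => x /=; rewrite /h fineK// Radon_Nikodym_fin_num.
have hi A : measurable A -> mu.-integrable A (EFin \o h).
  by move=> mA; rewrite hE; apply: integrableS gi.
have hloc : locally_integrable [set: R] h.
  by apply: open_integrable_locally; [exact: openT|exact: hi].
have := FTC1Ny (fun y => hi _ (measurable_itv `]-oo, y])) hloc.
apply: filterS; first exact: (ae_filter_ringOfSetsType mu).
move=> x [dx _]; rewrite /= in_itv/= => /andP[Nx xN].
pose H y := (\int[mu]_(t in [set` `]-oo, y]]) (h t))%R.
have HE y : `]- N%:R, N%:R[%classic y -> H y = F y - F (- N%:R).
  rewrite /= in_itv/= => /andP[Ny yN]; rewrite /H /Rintegral.
  transitivity (fine (nu [set` `]-oo, y]])).
    by rewrite (_ : (fun t => (h t)%:E) = g)// -Radon_Nikodym_integral.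
  rewrite nuE (_ : _ `&` _ = [set` `](- N%:R), y]]).
    by rewrite muFE//; exact: ltW.
  apply/seteqP; split => t/=; rewrite /D/= !in_itv/=.
    by move=> [-> /andP[->]].
  by move=> /andP[h1 h2]; rewrite h1 h2 (le_trans h2)// ltW.
have nx : \forall y \near x, `]- N%:R, N%:R[%classic y.
  by apply: open_nbhs_nbhs; split; [exact: interval_open|rewrite /= in_itv/= Nx].
have dH : derivable H x 1 by exact: dx.
have : derivable (H \+ (fun y => F (- N%:R) - y / 2)) x 1.
  apply: derivableD; first exact: dH.
  apply: derivableB; first exact: derivable_cst.
  by apply: derivableM; [exact: derivable_id|exact: derivable_cst].
apply: near_eq_derivable; apply: filterS nx => y hy /=.
by rewrite HE// /F; lra.
Qed.

Lemma ae_derivable_lipschitz (K : R) (f : R -> R) :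
  (forall x y, `|f x - f y| <= K * `|x - y|) ->
  {ae mu, forall x, derivable f x 1}.
Proof.
move=> fK; pose L := `|K| + 1; have L0 : 0 < L by rewrite /L ltr_wpDl.
pose f' x := (2 * L)^-1 * f x.
have : {ae mu, forall x, derivable f' x 1}.
  apply: ae_derivable_contraction => x y.
  rewrite /f' -mulrBr normrM ger0_norm ?invr_ge0; last by lra.
  rewrite invfM -mulrA ler_pM2l// ler_pdivrMl//.
  by apply: le_trans (fK x y) _; rewrite ler_wpM2r// /L (le_trans (ler_norm K))// lerDl.
apply: filterS; first exact: (ae_filter_ringOfSetsType mu).
move=> x dx.
have -> : f = (fun x => (2 * L) *: f' x).
  by apply/funext => y; rewrite /f' /GRing.scale/= mulVKf//; lra.
exact: derivableZ.
Qed.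

End rademacher1.

(** * The Euclidean norm and its Lipschitz functions *)

Section enorm_theory.
Context {R : realType} {n : nat}.
Implicit Types (x y z w : 'rV[R]_n).

Definition dotp x y : R := \sum_i x ord0 i * y ord0 i.

Lemma dotpC x y : dotp x y = dotp y x.
Proof. by apply: eq_bigr => i _; rewrite mulrC. Qed.

Lemma dotpDl x y z : dotp (x + y) z = dotp x z + dotp y z.
Proof. by rewrite -big_split; apply: eq_bigr => i _; rewrite mxE mulrDl. Qed.

Lemma dotpZl a x y : dotp (a *: x) y = a * dotp x y.
Proof. by rewrite mulr_sumr; apply: eq_bigr => i _; rewrite mxE mulrA. Qed.

Lemma dotpDr x y z : dotp x (y + z) = dotp x y + dotp x z.
Proof. by rewrite dotpC dotpDl !(dotpC x). Qed.

Lemma dotpZr a x y : dotp x (a *: y) = a * dotp x y.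
Proof. by rewrite dotpC dotpZl dotpC. Qed.

Lemma dotpNl x y : dotp (- x) y = - dotp x y.
Proof. by rewrite -scaleN1r dotpZl mulN1r. Qed.

Lemma dotpNr x y : dotp x (- y) = - dotp x y.
Proof. by rewrite dotpC dotpNl dotpC. Qed.

Lemma dotp_ge0 x : 0 <= dotp x x.
Proof. by apply: sumr_ge0 => i _; rewrite -expr2 sqr_ge0. Qed.

Lemma sqr_enorm x : enorm x ^+ 2 = dotp x x.
Proof.
have -> : dotp x x = \sum_i x ord0 i ^+ 2 by apply: eq_bigr.
by rewrite sqr_sqrtr// sumr_ge0// => i _; rewrite sqr_ge0.
Qed.

Lemma enorm_ge0 x : 0 <= enorm x.
Proof. exact: sqrtr_ge0. Qed.

Lemma enorm_leP x (r : R) : 0 <= r -> (enorm x <= r) = (dotp x x <= r ^+ 2).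
Proof. by move=> r0; rewrite -sqr_enorm ler_sqr ?nnegrE// enorm_ge0. Qed.

Lemma enorm_ltP x (r : R) : 0 <= r -> (enorm x < r) = (dotp x x < r ^+ 2).
Proof. by move=> r0; rewrite -sqr_enorm ltr_sqr ?nnegrE// enorm_ge0. Qed.

Lemma enorm0 : enorm (0 : 'rV[R]_n) = 0.
Proof. by rewrite /enorm big1 ?sqrtr0// => i _; rewrite mxE expr0n. Qed.

Lemma ler_coord_enorm x i : `|x ord0 i| <= enorm x.
Proof.
rewrite -(@ler_sqr _ `|x ord0 i|) ?nnegrE ?enorm_ge0// sqr_enorm.
rewrite /dotp (bigD1 i)//= real_normK ?num_real// expr2 lerDl.
by apply: sumr_ge0 => j _; rewrite -expr2 sqr_ge0.
Qed.

Lemma enorm_eq0 x : (enorm x == 0) = (x == 0).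
Proof.
apply/eqP/eqP => [x0|->]; last exact: enorm0.
apply/rowP => i; rewrite mxE; apply/eqP; rewrite -normr_le0 -x0.
exact: ler_coord_enorm.
Qed.

Lemma enormZ a x : enorm (a *: x) = `|a| * enorm x.
Proof.
apply/eqP; rewrite -(@eqrXn2 _ 2) ?mulr_ge0 ?enorm_ge0//; apply/eqP.
by rewrite exprMn !sqr_enorm dotpZl dotpZr mulrA real_normK ?num_real// expr2.
Qed.

Lemma enormN x : enorm (- x) = enorm x.
Proof. by rewrite -scaleN1r enormZ normrN normr1 mul1r. Qed.

Lemma enormB x y : enorm (x - y) = enorm (y - x).
Proof. by rewrite -enormN opprB. Qed.

Lemma dotp_le x y : dotp x y <= enorm x * enorm y.
Proof.
have [x0|x0] := eqVneq (enorm x) 0.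
  have /eqP -> : x == 0 by rewrite -enorm_eq0 x0.
  by rewrite enorm0 mul0r -(scale0r 0) dotpZl mul0r.
have [y0|y0] := eqVneq (enorm y) 0.
  have /eqP -> : y == 0 by rewrite -enorm_eq0 y0.
  by rewrite enorm0 mulr0 dotpC -(scale0r 0) dotpZl mul0r.
have xp : 0 < enorm x by rewrite lt_def x0 enorm_ge0.
have yp : 0 < enorm y by rewrite lt_def y0 enorm_ge0.
have := dotp_ge0 (enorm y *: x - enorm x *: y).
rewrite !(dotpDl, dotpDr, dotpNl, dotpNr, dotpZl, dotpZr) -!sqr_enorm (dotpC y x).
set a := enorm x in xp *; set b := enorm y in yp *; set d := dotp x y => h.
have ab : 0 < a * b by rewrite mulr_gt0.
rewrite -(ler_pM2l ab); nra.
Qed.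

Lemma enormD x y : enorm (x + y) <= enorm x + enorm y.
Proof.
rewrite enorm_leP ?addr_ge0 ?enorm_ge0// dotpDl !dotpDr (dotpC y x).
rewrite -!sqr_enorm; have := dotp_le x y; lra.
Qed.

Lemma enorm_subr x y : `|enorm x - enorm y| <= enorm (x - y).
Proof.
have h1 := enormD (x - y) y; have h2 := enormD (y - x) x.
rewrite ler_norml; move: h1 h2; rewrite !subrK (enormB y x) => h1 h2.
by apply/andP; split; lra.
Qed.

Lemma enorm_triangle x y z : enorm (x - z) <= enorm (x - y) + enorm (y - z).
Proof. by apply: le_trans (enormD _ _); rewrite addrA subrK. Qed.

Lemma enorm_le_sum x : enorm x <= \sum_i `|x ord0 i|.
Proof.
have s0 : 0 <= \sum_i `|x ord0 i| by apply: sumr_ge0.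
rewrite enorm_leP// expr2 mulr_suml; apply: ler_sum => i _.
rewrite -expr2 -real_normK ?num_real// expr2 ler_wpM2l//.
by rewrite (bigD1 i)//= lerDl sumr_ge0.
Qed.

Lemma enorm_delta (i : 'I_n) (t : R) : enorm (t *: delta_mx ord0 i : 'rV[R]_n) = `|t|.
Proof.
rewrite enormZ (_ : enorm _ = 1) ?mulr1//; apply/eqP.
rewrite -(@eqrXn2 _ 2) ?enorm_ge0//= sqr_enorm /dotp (bigD1 i)//= big1.
  by rewrite !mxE !eqxx mulr1 addr0 expr1n.
by move=> j ji; rewrite !mxE eqxx (negbTE ji) mulr0.
Qed.

Lemma nbhs_eballP z (A : set 'rV[R]_n) : nbhs z A <->
  exists2 e : R, 0 < e & eball z e `<=` A.
Proof.
split=> [/nbhs_rVP[e e0 he]|[e e0 he]].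
  exists e => // w zw; apply: he => i.
  have := ler_coord_enorm (w - z) i; rewrite !mxE distrC => /le_lt_trans; apply.
  exact: zw.
apply/nbhs_rVP; exists (e / n.+1%:R); first exact: divr_gt0.
move=> w hw; apply: he; rewrite /eball /=.
apply: le_lt_trans (enorm_le_sum _) _.
apply: (@le_lt_trans _ _ (\sum_(i < n) e / n.+1%:R)).
  by apply: ler_sum => i _; rewrite !mxE distrC ltW.
rewrite sumr_const card_ord -[X in X < _]mulr_natr -mulrA gtr_pMr// mulrC ltr_pdivrMr//.
by rewrite mul1r ltr_nat.
Qed.

Lemma eball_nbhs z (e : R) : 0 < e -> nbhs z (eball z e).
Proof. by move=> e0; apply/nbhs_eballP; exists e. Qed.

Lemma open_eball z (e : R) : open (eball z e).
Proof.
rewrite openE => w /= zw; apply/nbhs_eballP; exists (e - enorm (w - z)).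
  by rewrite subr_gt0.
move=> v /= vw; rewrite /eball /=.
apply: le_lt_trans (enorm_triangle v w z) _; rewrite /eball /= in vw; lra.
Qed.

Definition elip (K : R) (v : 'rV[R]_n -> R) :=
  forall z w, `|v z - v w| <= K * enorm (z - w).

Lemma enorm_continuous_gen (f : 'rV[R]_n -> R) (K : R) z (d : R) : 0 < d ->
  (forall w, enorm (z - w) < d -> `|f z - f w| <= K * enorm (z - w)) ->
  {for z, continuous f}.
Proof.
move=> d0 h; apply: (iffRL (@cvgrPdist_lt _ _ _ (nbhs z) (nbhs_filter z) f (f z))) => e e0.
have K1 : 0 < `|K| + 1 by rewrite ltr_wpDl.
apply/nbhs_eballP; exists (Num.min d (e / (`|K| + 1))).
  by rewrite lt_min d0 divr_gt0.
move=> w; rewrite /eball /= lt_min enormB => /andP[wd we].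
apply: le_lt_trans (h w wd) _.
apply: (@le_lt_trans _ _ ((`|K| + 1) * enorm (z - w))).
  by rewrite ler_wpM2r ?enorm_ge0// (le_trans (ler_norm K))// lerDl.
by rewrite mulrC -ltr_pdivlMr.
Qed.

Lemma elip_continuous K v : elip K v -> continuous v.
Proof. by move=> h z; apply: (@enorm_continuous_gen v K z 1) => // w _; exact: h. Qed.

Lemma elip_enorm : elip 1 (@enorm R n).
Proof. by move=> z w; rewrite mul1r enorm_subr. Qed.

Lemma elip_coord i : elip 1 (fun z : 'rV[R]_n => z ord0 i).
Proof.
by move=> z w; rewrite mul1r; have := ler_coord_enorm (z - w) i; rewrite !mxE.
Qed.

End enorm_theory.

(** * Integrals of bounded functions with bounded support *)

Section bounded_functions.
Context {R : realType} {n : nat}.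
Local Notation E := 'rV[R]_n.
Implicit Types (f g : E -> R) (z : E).

Definition cube (r : R) : set E := box (const_mx (- r)) (const_mx r).

Lemma cubeP r z : cube r z <-> forall i, - r < z ord0 i <= r.
Proof. by split=> h i; have := h i; rewrite !mxE. Qed.

Lemma sub_cube r s : r <= s -> cube r `<=` cube s.
Proof.
by move=> rs z /cubeP h; apply/cubeP => i; have /andP[h1 h2] := h i; apply/andP; split; lra.
Qed.

Definition bdd (M : R) f := measurable_fun setT f /\ forall z, `|f z| <= M.

(** These functions are integrable and stable under the operations needed, so that integrals against
    test functions can be handled as real numbers. *)
Definition bfun (M r : R) f := bdd M f /\ forall z, ~ cube r z -> f z = 0.

Definition integ f : R := (\int[leb]_z f z)%R.

Lemma bfun_integrable M r f : bfun M r f -> leb.-integrable setT (EFin \o f).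
Proof.
move=> [[mf fM] f0].
have -> : EFin \o f = (EFin \o f) \_ (cube r).
  apply/funext => z; rewrite patchE; case: ifPn => // /negP h.
  by rewrite /= f0// => cz; apply: h; rewrite inE.
apply/integrable_restrict => //; first exact: measurable_box.
rewrite setTI; apply: measurable_bounded_integrable.
- exact: measurable_box.
- exact: leb_box_fin.
- exact: measurable_funTS.
- by exists M; split; [exact: num_real|move=> x Mx z _; exact: le_trans (fM z) (ltW Mx)].
Qed.

Lemma bfunD M r M' r' f g : bfun M r f -> bfun M' r' g ->
  bfun (M + M') (Num.max r r') (fun z => f z + g z).
Proof.
move=> [[mf fM] f0] [[mg gM] g0]; split; first split.
- exact: measurable_funD.
- by move=> z; apply: le_trans (ler_normD _ _) _; exact: lerD.
- move=> z hz; rewrite f0 ?g0 ?addr0// => cz; apply: hz; apply: sub_cube cz;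
  by rewrite le_max lexx ?orbT.
Qed.

Lemma bfunM M M' r f g : bdd M f -> bfun M' r g ->
  bfun (M * M') r (fun z => f z * g z).
Proof.
move=> [mf fM] [[mg gM] g0]; split; first split.
- exact: measurable_funM.
- move=> z; rewrite normrM ler_pM//.
- by move=> z hz; rewrite g0// mulr0.
Qed.

Lemma bdd_cst c : bdd `|c| (fun=> c).
Proof. by split => //; exact: measurable_cst. Qed.

Lemma bfunZ c M r f : bfun M r f -> bfun (`|c| * M) r (fun z => c * f z).
Proof. by apply: bfunM; exact: bdd_cst. Qed.

Lemma bfunN M r f : bfun M r f -> bfun M r (fun z => - f z).
Proof.
move=> [[mf fM] f0]; split; first split.
- exact: measurableT_comp.
- by move=> z; rewrite normrN.
- by move=> z hz; rewrite f0// oppr0.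
Qed.

Lemma bfunB M r M' r' f g : bfun M r f -> bfun M' r' g ->
  bfun (M + M') (Num.max r r') (fun z => f z - g z).
Proof. by move=> hf hg; exact: (bfunD hf (bfunN hg)). Qed.

Lemma integD M r M' r' f g : bfun M r f -> bfun M' r' g ->
  integ (fun z => f z + g z) = integ f + integ g.
Proof. by move=> hf hg; apply: RintegralD => //; apply: bfun_integrable; eassumption. Qed.

Lemma integB M r M' r' f g : bfun M r f -> bfun M' r' g ->
  integ (fun z => f z - g z) = integ f - integ g.
Proof. by move=> hf hg; apply: RintegralB => //; apply: bfun_integrable; eassumption. Qed.

Lemma integZ c M r f : bfun M r f -> integ (fun z => c * f z) = c * integ f.
Proof. by move=> hf; apply: RintegralZl => //; apply: bfun_integrable; eassumption. Qed.

Lemma le_integ M r M' r' f g : bfun M r f -> bfun M' r' g ->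
  (forall z, f z <= g z) -> integ f <= integ g.
Proof.
by move=> hf hg fg; apply: le_Rintegral => //; apply: bfun_integrable; eassumption.
Qed.

Lemma normr_integ M r f : bfun M r f -> `|integ f| <= integ (fun z => `|f z|).
Proof. by move=> hf; apply: le_normr_Rintegral => //; apply: bfun_integrable; eassumption. Qed.

Lemma bfun_norm M r f : bfun M r f -> bfun M r (fun z => `|f z|).
Proof.
move=> [[mf fM] f0]; split; first split.
- exact: measurableT_comp.
- by move=> z; rewrite normr_id.
- by move=> z hz; rewrite f0// normr0.
Qed.

Lemma integral_support (O : set E) f : measurable O -> (forall z, ~ O z -> f z = 0) ->
  (\int[leb]_(z in O) (f z)%:E)%E = (\int[leb]_z (f z)%:E)%E.
Proof.
move=> mO f0; rewrite integral_mkcond; congr integral; apply/funext => z.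
rewrite patchE; case: ifPn => // /negP h.
by rewrite f0// => cz; apply: h; rewrite inE.
Qed.

Lemma bfun_EFin M r f : bfun M r f -> (\int[leb]_z (f z)%:E)%E = (integ f)%:E.
Proof.
move=> hf; rewrite /integ /Rintegral fineK//.
exact/integrable_fin_num/(bfun_integrable hf).
Qed.

Lemma dominated_integ M r (f_ : nat -> E -> R) f :
  (forall k, bfun M r (f_ k)) -> measurable_fun setT f ->
  {ae leb, forall z, f_ k z @[k --> \oo] --> f z} ->
  integ (f_ k) @[k --> \oo] --> integ f.
Proof.
move=> hf mf cf.
have ig : leb.-integrable setT (EFin \o (fun z => M * \1_(cube r) z)).
  apply: (@bfun_integrable `|M| r); split; first split.
  - apply: measurable_funM => //; apply: measurable_indic; exact: measurable_box.
  - move=> z; rewrite normrM ler_piMr// ger0_norm ?indicE//; by case: (_ \in _).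
  - by move=> z hz; rewrite indicE memNset// mulr0.
have H1 k : measurable_fun setT (EFin \o f_ k).
  by apply: measurableT_comp => //; have [[]] := hf k.
have H2 : measurable_fun setT (EFin \o f) by exact: measurableT_comp.
have H3 : {ae leb, forall z, setT z ->
    (fun k => EFin \o f_ k) k z @[k --> \oo] --> (EFin \o f) z}.
  apply: filterS cf => z h _; apply/cvg_EFin; last exact: h.
  by apply: nearW.
have H4 : {ae leb, forall z, forall k, setT z ->
    (`|(EFin \o f_ k) z| <= (EFin \o (fun z => M * \1_(cube r) z)%R) z)%E}.
  apply: aeW => z k _ /=; rewrite lee_fin indicE.
  have [[_ fM] f0] := hf k.
  have [cz|cz] := pselect (cube r z); first by rewrite mem_set// mulr1.
  by rewrite f0// normr0 memNset// mulr0.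
have [fi0 _ h] := @dominated_convergence _ _ _ leb setT measurableT
  (fun k => EFin \o f_ k) (EFin \o f) _ H1 H2 H3 ig H4.
have fi : (\int[leb]_z (f z)%:E)%E \is a fin_num.
  exact: integrable_fin_num.
by apply: fine_cvg; rewrite fineK.
Qed.

Lemma integ_translate M r f (h : E) : bfun M r f -> integ (fun z => f (z + h)) = integ f.
Proof.
move=> hf; rewrite /integ /Rintegral; congr fine; apply/esym.
have mh := @continuous_shift_rV R n h.
pose mu := measure_function_pushforward__canonical__measure_function_Measure
  (@leb R n) mh.
have muE A : measurable A -> leb A = mu A.
  by move=> mA; apply/esym; exact: leb_translate.
transitivity (\int[mu]_z (f z)%:E)%E; first by apply: eq_measure_integral => A mA _; exact: muE.
rewrite (integral_pushforward mh (f := EFin \o f) (D := setT)) //.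
- by have [[mf _] _] := hf; exact: measurableT_comp.
- rewrite preimage_setT; apply: (@bfun_integrable M (r + \sum_i `|h ord0 i|)).
  have [[mf fM] f0] := hf; split; first split.
  + exact: (measurableT_comp mf).
  + by move=> z; exact: fM.
  + move=> z hz /=; apply: f0 => /cubeP cz; apply: hz; apply/cubeP => i.
    have /andP[] := cz i; rewrite mxE.
    have : `|h ord0 i| <= \sum_i `|h ord0 i| by rewrite (bigD1 i)//= lerDl sumr_ge0.
    by rewrite ler_norml => /andP[h1 h2] h3 h4; apply/andP; split; lra.
Qed.

End bounded_functions.

(** * Test functions and their difference quotients *)

Section test_functions.
Context {R : realType} {n : nat}.
Local Notation E := 'rV[R]_n.
Local Notation "''e_' i" := (delta_mx ord0 i : E) (at level 8, i at level 2).
Implicit Types (O : set E) (phi : E -> R) (z : E).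

Lemma continuous_measurableT_rV (f : E -> R) : continuous f -> measurable_fun setT f.
Proof.
move=> cf; apply: (@continuous_measurable_rV _ _ setT); first exact: openT.
by move=> z _; exact: cf.
Qed.

Lemma test_continuous O phi : test_function O phi -> continuous phi.
Proof. by move=> [sm _ _]; have [] := sm [::]. Qed.

Lemma test_continuous_partial O phi i : test_function O phi -> continuous (partial i phi).
Proof. by move=> [sm _ _]; have [] := sm [:: i]. Qed.

Lemma test_derivable O phi i z : test_function O phi -> derivable phi z 'e_i.
Proof. by move=> [sm _ _]; have [_] := sm [::]; apply. Qed.

Lemma partial_eq0 phi i z : (\forall w \near z, phi w = 0) -> partial i phi z = 0.
Proof.
move=> h; rewrite /partial.
have -> : 'D_'e_i phi z = 'D_'e_i (cst 0 : E -> R) z.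
  by apply: near_eq_derive; apply: filterS h => w ->.
exact: derive_cst.
Qed.

Lemma test_support O phi : test_function O phi ->
  exists K, [/\ compact K, K `<=` O, forall z, ~ K z -> phi z = 0 &
    forall i z, ~ K z -> partial i phi z = 0].
Proof.
move=> [sm cK KO]; exists (closure [set z | phi z != 0]).
have h z : ~ closure [set z | phi z != 0] z -> phi z = 0.
  move=> nz; apply/eqP/negPn/negP => nz'; apply: nz; exact: subset_closure.
split => // i z nz; apply: partial_eq0.
have : nbhs z (~` closure [set z | phi z != 0]).
  by apply: open_nbhs_nbhs; split => //; apply: closed_openC; exact: closed_closure.
by apply: filterS => w; exact: h.
Qed.

Lemma continuous_bounded_cube (f : E -> R) r : continuous f ->
  (forall z, ~ cube r z -> f z = 0) -> exists M, bfun M r f.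
Proof.
move=> cf f0.
have [M hM] : exists M, forall z, cbox (const_mx (- r)) (const_mx r) z -> `|f z| <= M.
  have cK : compact (f @` cbox (const_mx (- r)) (const_mx r)).
    apply: continuous_compact; last exact: cbox_compact.
    exact: continuous_subspaceT.
  have [M [Mr hM]] := compact_bounded cK.
  exists (M + 1) => z hz; apply: (hM (M + 1)); first by rewrite ltrDl.
  by exists z.
exists `|M|; split; first split.
- exact: continuous_measurableT_rV.
- move=> z; have [cz|cz] := pselect (cube r z).
    by apply: le_trans (ler_norm M); apply: hM; exact: box_cbox.
  by rewrite f0// normr0.
- by [].
Qed.

Lemma test_bfun O phi : test_function O phi ->
  exists M r, [/\ bfun M r phi, (forall i, bfun M r (partial i phi)) &
    forall z, ~ O z -> phi z = 0 /\ forall i, partial i phi z = 0].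
Proof.
move=> tphi; have [K [cK KO p0 dp0]] := test_support tphi.
have [r r0 Kr] := compact_sub_box cK.
have [M0 h0] : exists M, bfun M r phi.
  apply: continuous_bounded_cube; first exact: test_continuous tphi.
  by move=> z hz; apply: p0 => /Kr.
have hi i : exists M, bfun M r (partial i phi).
  apply: continuous_bounded_cube; first exact: test_continuous_partial tphi.
  by move=> z hz; apply: dp0 => /Kr.
have [M hM] := choice hi.
have bfun_le M1 M2 f : M1 <= M2 -> bfun M1 r f -> bfun M2 r f.
  by move=> le12 [[mf fM] f0]; split => //; split => // z; exact: le_trans (fM z) le12.
have M_ge0 i : 0 <= M i.
  by have [[_ /(_ 0) h] _] := hM i; exact: le_trans h.
have M0_ge0 : 0 <= M0 by have [[_ /(_ 0) h] _] := h0; exact: le_trans h.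
exists (M0 + \sum_i M i), r; split.
- by apply: bfun_le h0; rewrite lerDl sumr_ge0.
- move=> i; apply: bfun_le (hM i); rewrite (bigD1 i)//= addrCA lerDl.
  by rewrite addr_ge0// sumr_ge0.
- by move=> z Oz; split=> [|i]; [apply: p0|apply: dp0] => /KO.
Qed.

Lemma line_quotient (f : E -> R) z (e : E) t :
  (fun h : R => h^-1 *: ((((fun t => f (z + t *: e)) : R -> R) \o shift t) (h *: 1) - f (z + t *: e))) =
  (fun h : R => h^-1 *: ((f \o shift (z + t *: e)) (h *: e) - f (z + t *: e))).
Proof.
apply/funext => h /=; congr (_ *: (f _ - _)).
by rewrite [h *: 1]mulr1 scalerDl addrCA addrA.
Qed.

Lemma line_derivable (f : E -> R) z (e : E) t :
  derivable f (z + t *: e) e <-> derivable ((fun t => f (z + t *: e)) : R -> R) t (1 : R).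
Proof. by rewrite /derivable -line_quotient. Qed.

Lemma line_derive (f : E -> R) z (e : E) t :
  derivable f (z + t *: e) e ->
  is_derive t (1 : R) ((fun t => f (z + t *: e)) : R -> R) ('D_e f (z + t *: e)).
Proof.
move=> df; apply: DeriveDef; first exact/line_derivable.
by rewrite /derive -line_quotient.
Qed.

Lemma test_lip O phi i (M : R) : test_function O phi ->
  (forall z, `|partial i phi z| <= M) ->
  forall z h, `|phi (z + h *: 'e_i) - phi z| <= M * `|h|.
Proof.
move=> tphi hM.
suff key z h : 0 <= h -> `|phi (z + h *: 'e_i) - phi z| <= M * h.
  move=> z h; have [h0|h0] := leP 0 h; first by rewrite (ger0_norm h0) key.
  have := key (z + h *: 'e_i) (- h); rewrite scaleNr addrK distrC oppr_ge0 => /(_ (ltW h0)).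
  by rewrite (ltr0_norm h0).
rewrite le_eqVlt => /orP[/eqP <-|h0]; first by rewrite scale0r addr0 subrr normr0 mulr0.
have [||c _] := @MVT _ (fun t => phi (z + t *: 'e_i)) (fun t => partial i phi (z + t *: 'e_i)) 0 h h0.
- by move=> t _; apply: line_derive; exact: test_derivable tphi.
- apply: derivable_within_continuous => t _.
  by apply/line_derivable; exact: test_derivable tphi.
by rewrite scale0r addr0 subr0 => ->; rewrite normrM (gtr0_norm h0) ler_pM2r.
Qed.

(** The sign [eps] covers the forward quotients taken of test functions as well as the backward ones
    taken of Lipschitz functions. *)
Lemma cvg_quotient_seq (f : R -> R) (t : R) (eps : R) : `|eps| = 1 ->
  derivable f t 1 ->
  (eps * k.+1%:R) * (f (t + eps / k.+1%:R) - f t) @[k --> \oo] --> 'D_1 f t.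
Proof.
move=> e1 df.
have e0 : eps != 0 by rewrite -normr_eq0 e1 oner_eq0.
have ee : eps * eps = 1.
  by rewrite -expr2 -real_normK ?num_real// e1 expr1n.
pose u k : R := eps * harmonic k.
have u0 : u k @[k --> \oo] --> (0 : R).
  by rewrite -[X in _ --> X](mulr0 eps); apply: cvgM; [exact: cvg_cst|exact: cvg_harmonic].
have un0 k : u k != 0 by rewrite mulf_neq0//= invr_eq0 pnatr_eq0.
have := (iffLR (cvgr_dnbhsP (fun h => h^-1 *: ((f \o shift t) (h *: 1) - f t)) 0 ('D_1 f t))).
move=> /(_ df u (conj un0 u0)); apply: cvg_trans; apply: near_eq_cvg; apply: nearW => k /=.
rewrite /u /GRing.scale/= mulr1 invfM invrK (_ : eps^-1 = eps).
  by rewrite (addrC t).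
by apply: (mulfI e0); rewrite ee mulfV.
Qed.

End test_functions.

Section lipschitz_weak_gradient.
Context {R : realType} {n : nat}.
Local Notation E := 'rV[R]_n.
Local Notation "''e_' i" := (delta_mx ord0 i : E) (at level 8, i at level 2).
Implicit Types (O : set E) (v : E -> R) (z : E).

(** Backward quotients, because a translation of the integral turns the forward quotient of the test
    function into minus the backward quotient of the other factor. *)
Definition dquot v (i : 'I_n) (k : nat) z : R :=
  k.+1%:R * (v z - v (z - k.+1%:R^-1 *: 'e_i)).

Definition clip (K x : R) : R := Num.max (- K) (Num.min K x).

Lemma clip_le K x : 0 <= K -> `|clip K x| <= K.
Proof.
move=> K0; rewrite /clip ler_norml le_max lexx/= ge_max ge_min lexx/= andbT.
by rewrite (le_trans _ K0)// oppr_le0.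
Qed.

Lemma clip_id K x : `|x| <= K -> clip K x = x.
Proof.
rewrite ler_norml => /andP[h1 h2]; rewrite /clip min_r// max_r//.
Qed.

Lemma measurable_clip d (T : measurableType d) (D : set T) K (f : T -> R) :
  measurable_fun D f -> measurable_fun D (fun x => clip K (f x)).
Proof.
move=> mf; apply: measurable_maxr => //.
by apply: measurable_minr.
Qed.

(** The upper limit gives a candidate derivative that is measurable and defined everywhere; the
    clipping makes its bound immediate. *)
Definition lgrad K v i z : R := clip K (limn_sup (fun k => dquot v i k z)).

Lemma dquot_le K v i k z : elip K v -> `|dquot v i k z| <= K.
Proof.
move=> vK; rewrite /dquot normrM normr_nat.
have k0 : 0 < k.+1%:R^-1 :> R by rewrite invr_gt0.
have := vK z (z - k.+1%:R^-1 *: 'e_i).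
rewrite opprB addrCA subrr addr0 enorm_delta (gtr0_norm k0).
by rewrite ler_pdivlMr// mulrC.
Qed.

Lemma measurable_dquot K v i k : elip K v -> measurable_fun setT (dquot v i k).
Proof.
move=> vK; have mv := continuous_measurableT_rV (elip_continuous vK).
apply: measurable_funM => //; apply: measurable_funB => //.
exact: (measurableT_comp mv (continuous_shift_rV _)).
Qed.

Lemma measurable_lgrad K v i : elip K v -> measurable_fun setT (lgrad K v i).
Proof.
move=> vK; apply: measurable_clip; apply: measurable_fun_limn_sup.
- move=> z _; exists K => _ [k _ <-]; apply: le_trans (ler_norm _) _; exact: dquot_le.
- move=> z _; exists (- K) => _ [k _ <-].
  by have := dquot_le i k z vK; rewrite ler_norml => /andP[].
- by move=> k; exact: measurable_dquot vK.
Qed.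

Lemma elip_ge0 K v (i : 'I_n) : elip K v -> 0 <= K.
Proof.
move=> vK; have := vK (1 *: 'e_i) 0; rewrite subr0 enorm_delta normr1 mulr1.
exact: le_trans.
Qed.

Lemma measurable_line z (e : E) : measurable_fun setT (fun t : R => z + t *: e).
Proof.
apply: measurable_fun_rV => i.
rewrite (_ : _ \o _ = fun t => z ord0 i + t * e ord0 i); last first.
  by apply/funext => t; rewrite /= /coord_rV !mxE.
by apply: measurable_funD => //; apply: measurable_funM.
Qed.

Lemma cvg_le_cst (u : nat -> R) (l K : R) : u k @[k --> \oo] --> l ->
  (forall k, u k <= K) -> l <= K.
Proof.
move=> ul h; rewrite -(cvg_lim (@Rhausdorff R) ul); apply: limr_le.
  by apply/cvg_ex; exists l.
exact: nearW.
Qed.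

Lemma cvgR_unique (u : nat -> R) (a b : R) : u k @[k --> \oo] --> a ->
  u k @[k --> \oo] --> b -> a = b.
Proof. by move=> ua ub; exact: (cvg_unique (@Rhausdorff R) ua ub). Qed.

(** The set where convergence fails is measurable, being the set where the upper limit [h] of the
    errors is nonzero. On each line in direction [i] it is null by the one-dimensional theorem, so
    [leb_line_null] applies. *)
Lemma ae_cvg_dquot K v i : elip K v ->
  {ae leb, forall z, dquot v i k z @[k --> \oo] --> lgrad K v i z}.
Proof.
move=> vK.
pose h z : \bar R := limn_esup (fun k => (`|dquot v i k z - lgrad K v i z|)%:E).
have mh : measurable_fun setT h.
  apply: measurable_fun_limn_esup => k; apply/measurable_EFinP.
  apply: measurableT_comp => //; apply: measurable_funB.
    exact: measurable_dquot vK.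
  exact: measurable_lgrad.
pose B := [set z | h z != 0%E].
have mB : measurable B.
  rewrite (_ : B = ~` (h @^-1` [set 0%E])).
    by apply: measurableC; rewrite -[X in measurable X]setTI; exact: mh.
  by apply/seteqP; split => z; rewrite /B /=; [move=> /eqP|move=> /eqP].
have : leb B = 0%E.
  apply: (leb_line_null (i := i)) => // z.
  pose f t := v (z + t *: 'e_i).
  have fK x y : `|f x - f y| <= K * `|x - y|.
    apply: le_trans (vK _ _) _; rewrite opprD addrACA subrr add0r -scalerBl.
    by rewrite enorm_delta.
  have mBz : measurable [set t : R | B (z + t *: 'e_i)].
    by rewrite -[X in measurable X]setTI; apply: measurable_line.
  apply: measure_negligible => //.
  have := ae_derivable_lipschitz fK; rewrite /almost_everywhere.
  apply: negligibleS => t /= Bt dt; move: Bt; apply/negP; rewrite negbK; apply/eqP.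
  have c : dquot v i k (z + t *: 'e_i) @[k --> \oo] --> 'D_1 f t.
    have := @cvg_quotient_seq R f t (-1); rewrite normrN normr1 => /(_ erefl dt).
    apply: cvg_trans; apply: near_eq_cvg; apply: nearW => k.
    rewrite /dquot /f mulN1r mulNr -mulrN opprB -scaleNr mulN1r -addrA -scalerDl.
    by [].
  have gl : lgrad K v i (z + t *: 'e_i) = 'D_1 f t.
    rewrite /lgrad (cvg_limn_inf_sup c).2 clip_id//.
    by apply: (cvg_le_cst (cvg_norm c)) => k; exact: dquot_le.
  suff c0 : (`|dquot v i k (z + t *: 'e_i) - lgrad K v i (z + t *: 'e_i)|)%:E
      @[k --> \oo] --> 0%E by exact: (cvg_limn_einf_sup c0).2.
  apply/cvg_EFin; first exact: nearW.
  rewrite gl -(normr0 R); apply: cvg_norm; rewrite -(subrr ('D_1 f t)).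
  by apply: cvgB => //; exact: cvg_cst.
move=> /(negligibleP leb mB); rewrite /almost_everywhere.
apply: negligibleS => z; rewrite /B /= => hz; apply/negP => hz0; apply: hz.
have {}hz0 : h z = 0%E by apply/eqP.
have : (`|dquot v i k z - lgrad K v i z|)%:E @[k --> \oo] --> 0%E.
  apply: limn_esup_le_cvg; first by rewrite -/(h z) hz0.
  by move=> k; rewrite lee_fin.
move=> /fine_cvgP[_]; rewrite /comp/= => c0.
by apply/subr_cvg0/norm_cvg0P.
Qed.

Definition lgradv K v z : E := \row_i lgrad K v i z.

Lemma bdd_loc_integrable O M (f : E -> R) : open O -> bdd M f -> loc_integrable O f.
Proof.
move=> oO [mf fM]; split; first exact: measurable_funTS.
move=> K cK _; have mK := compact_measurable_rV cK.
apply: measurable_bounded_integrable => //.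
- exact: leb_compact_fin.
- exact: measurable_funTS.
- by exists M; split; [exact: num_real|move=> x Mx z _; exact: le_trans (fM z) (ltW Mx)].
Qed.

Lemma cube_shift r z (d : R) i : 0 <= d -> d <= 1 ->
  cube r (z + d *: 'e_i) -> cube (r + 1) z.
Proof.
move=> d0 d1 /cubeP cz; apply/cubeP => j; have := cz j; rewrite !mxE.
by case: (_ && (j == i)) => /=; rewrite ?mulr1 ?mulr0 => /andP[h1 h2];
  apply/andP; split; lra.
Qed.

(** Summation by parts for the difference quotients, followed by dominated convergence on both
    sides: the quotients of [v] are bounded by [K], those of [phi] by the bound of its
    derivative. *)
Lemma lip_by_parts O K M v i phi : open O -> elip K v -> bdd M v ->
  test_function O phi ->
  integ (fun z => v z * partial i phi z) = - integ (fun z => lgrad K v i z * phi z).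
Proof.
move=> oO vK vM tphi.
have [P [r [bphi bdphi _]]] := test_bfun tphi.
have plip := test_lip tphi (bdphi i).1.2.
pose q k z := k.+1%:R * (phi (z + k.+1%:R^-1 *: 'e_i) - phi z).
have qP k z : `|q k z| <= P.
  rewrite /q normrM normr_nat; have := plip z k.+1%:R^-1.
  have k0 : 0 < k.+1%:R^-1 :> R by rewrite invr_gt0.
  by rewrite (gtr0_norm k0) ler_pdivlMr// mulrC.
have mphi : measurable_fun setT phi by have [[]] := bphi.
have bq k : bfun P (r + 1) (q k).
  split; first split => //.
    apply: measurable_funM => //; apply: measurable_funB => //.
    exact: (measurableT_comp mphi (continuous_shift_rV _)).
  move=> z hz; rewrite /q bphi.2 ?bphi.2 ?subrr ?mulr0//.
    by move=> cz; apply: hz; apply: sub_cube cz; rewrite lerDl.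
  by move=> cz; apply: hz; apply: cube_shift cz; rewrite ?invr_ge0// invf_le1// ler1n.
have cq z : q k z @[k --> \oo] --> partial i phi z.
  have := @cvg_quotient_seq R (fun t => phi (z + t *: 'e_i)) 0 1; rewrite normr1 => /(_ erefl).
  have dphi : derivable phi (z + 0 *: 'e_i) 'e_i by exact: test_derivable tphi.
  move=> /(_ (iffLR (line_derivable _ _ _ _) dphi)).
  have [_ ->] := line_derive dphi; rewrite scale0r addr0.
  apply: cvg_trans; apply: near_eq_cvg; apply: nearW => k.
  by rewrite /q !mul1r add0r.
have step k : integ (fun z => v z * q k z) = - integ (fun z => dquot v i k z * phi z).
  have bv : bdd (2 * M) (fun z => v z - v (z - k.+1%:R^-1 *: 'e_i)).
    split; first apply: measurable_funB; first exact: vM.1.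
      exact: (measurableT_comp vM.1 (continuous_shift_rV _)).
    move=> z; apply: le_trans (ler_normB _ _) _.
    by have := vM.2 z; have := vM.2 (z - k.+1%:R^-1 *: 'e_i); lra.
  pose h := k.+1%:R^-1 *: 'e_i : E.
  have bphis : bfun P (r + 1) (fun z => phi (z + h)).
    split; first split.
    - exact: (measurableT_comp mphi (continuous_shift_rV _)).
    - by move=> z; exact: bphi.1.2.
    - move=> z hz; apply: bphi.2 => cz; apply: hz.
      by apply: cube_shift cz; rewrite ?invr_ge0// invf_le1// ler1n.
  have b1 := bfunM vM bphis; have b2 := bfunM vM bphi.
  have vMs : bdd M (fun z => v (z - h)).
    by split; [exact: (measurableT_comp vM.1 (continuous_shift_rV _))|move=> z; exact: vM.2].
  have b3 := bfunM vMs bphi.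
  have -> : (fun z => v z * q k z) =
      (fun z => k.+1%:R * (v z * phi (z + h) - v z * phi z)).
    by apply/funext => z; rewrite /q -/h mulrCA mulrBr.
  have -> : (fun z => dquot v i k z * phi z) =
      (fun z => k.+1%:R * (v z * phi z - v (z - h) * phi z)).
    by apply/funext => z; rewrite /dquot -/h -mulrA mulrBl.
  rewrite (integZ _ (bfunB b1 b2)) (integZ _ (bfunB b2 b3)) (integB b1 b2) (integB b2 b3).
  rewrite -mulrN opprB; congr (_ * (_ - _)).
  rewrite -[RHS](integ_translate h b3); congr integ; apply/funext => z.
  by rewrite addrK.
have l1 : integ (fun z => v z * q k z) @[k --> \oo] --> integ (fun z => v z * partial i phi z).
  apply: (@dominated_integ _ _ (M * P) (r + 1)).
  - by move=> k; exact: bfunM.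
  - by apply: measurable_funM; [exact: vM.1|exact: (bdphi i).1.1].
  - by apply: aeW => z; apply: cvgM; [exact: cvg_cst|exact: cq].
have l2 : integ (fun z => dquot v i k z * phi z) @[k --> \oo] --> integ (fun z => lgrad K v i z * phi z).
  apply: (@dominated_integ _ _ (K * P) r).
  - move=> k; apply: bfunM bphi; split; first exact: measurable_dquot vK.
    by move=> z; exact: dquot_le.
  - by apply: measurable_funM => //; exact: measurable_lgrad.
  - apply: filterS (ae_cvg_dquot i vK) => z hz.
    by apply: cvgM => //; exact: cvg_cst.
have E1 : (fun k => integ (fun z => v z * q k z)) =
    (fun k => - integ (fun z => dquot v i k z * phi z)) by apply/funext.
rewrite E1 in l1.
by apply: (cvgR_unique l1); apply: cvgN.
Qed.

Lemma lip_weak_gradient O K M v : open O -> elip K v -> bdd M v ->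
  is_weak_gradient O v (lgradv K v).
Proof.
move=> oO vK vM; split.
- exact: bdd_loc_integrable vM.
- move=> i; apply: (@bdd_loc_integrable _ K) => //; split.
    by under eq_fun do rewrite mxE; exact: measurable_lgrad.
  by move=> z; rewrite mxE clip_le//; exact: elip_ge0 vK.
- move=> i phi tphi; have [P [r [bphi bdphi p0]]] := test_bfun tphi.
  have mO := open_measurable_rV oO.
  have bl : bdd K (lgrad K v i).
    by split; [exact: measurable_lgrad|move=> z; apply: clip_le; exact: elip_ge0 vK].
  rewrite (integral_support mO); last by move=> z /p0[_ ->]; rewrite mulr0.
  rewrite (integral_support mO); last by move=> z /p0[-> _]; rewrite mulr0.
  rewrite (bfun_EFin (bfunM vM (bdphi i))) (lip_by_parts i oO vK vM tphi).
  have := bfun_EFin (bfunM bl bphi).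
  rewrite EFinN => <-; congr (- integral _ _ _)%E.
  by apply/funext => z; rewrite mxE.
Qed.

End lipschitz_weak_gradient.

(** * Product test functions and uniqueness of weak gradients *)

Section smooth1.
Context {R : realType}.
Implicit Types (f g : R -> R).

Definition derivatives (F : nat -> R -> R) :=
  forall k x, is_derive x (1 : R) (F k) (F k.+1 x).

Definition smooth1 f := exists2 F, F 0%N = f & derivatives F.

(** Choosing derivatives inside the class and iterating gives the whole sequence. Products are thus
    treated through finite sums of products of derivatives, without the Leibniz formula, and so are
    the functions [hpoly p]. *)
Lemma smooth1_class (S : set (R -> R)) :
  (forall f, S f -> exists2 g, S g & forall x, is_derive x (1 : R) f (g x)) ->
  forall f, S f -> smooth1 f.
Proof.
move=> hS f Sf.
have h (g : R -> R) : exists g', S g -> S g' /\ forall x, is_derive x (1 : R) g (g' x).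
  have [Sg|nSg] := pselect (S g); last by exists g.
  by have [g' h1 h2] := hS g Sg; exists g'.
have [D hD] := choice h.
have SD k : S (iter k D f) by elim: k => //= k IH; exact: (hD _ IH).1.
by exists (fun k => iter k D f) => // k x; exact: (hD _ (SD k)).2.
Qed.

Lemma smooth1D f g : smooth1 f -> smooth1 g -> smooth1 (f \+ g).
Proof.
move=> [F <- hF] [G <- hG]; exists (fun k => F k \+ G k) => // k x.
exact: is_deriveD.
Qed.

Lemma smooth1Z (c : R) f : smooth1 f -> smooth1 (fun x => c * f x).
Proof.
move=> [F <- hF]; exists (fun k x => c * F k x) => // k x.
exact: is_deriveZ.
Qed.

Lemma smooth1B f g : smooth1 f -> smooth1 g -> smooth1 (fun x => f x - g x).
Proof.
move=> hf hg; have := smooth1D hf (smooth1Z (-1) hg).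
by congr smooth1; apply/funext => x /=; rewrite mulN1r.
Qed.

Lemma smooth1M f g : smooth1 f -> smooth1 g -> smooth1 (fun x => f x * g x).
Proof.
move=> [F F0 hF] [G G0 hG].
pose H (l : seq (nat * nat)) : R -> R := fun x => \sum_(p <- l) F p.1 x * G p.2 x.
apply: (@smooth1_class [set h | exists l, h = H l]); last first.
  exists [:: (0%N, 0%N)]; apply/funext => x; rewrite /H big_seq1 /=.
  by rewrite F0 G0.
move=> _ [l ->].
pose l' := flatten [seq [:: (p.1.+1, p.2); (p.1, p.2.+1)] | p <- l].
exists (H l'); first by exists l'.
move=> x; rewrite {}/l'; elim: l => [|p l IH].
  rewrite (_ : H [::] = cst 0); last by apply/funext => y; rewrite /H big_nil.
  exact: is_derive_cst.
rewrite (_ : H (p :: l) = (F p.1 * G p.2) + H l); last first.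
  by apply/funext => y; rewrite /H big_cons.
rewrite (_ : H _ x = (F p.1 x *: G p.2.+1 x + G p.2 x *: F p.1.+1 x) +
    H (flatten [seq [:: (p.1.+1, p.2); (p.1, p.2.+1)] | p <- l]) x); last first.
  by rewrite /H /= !big_cons /= /GRing.scale/=; ring.
by apply: is_deriveD; apply: is_deriveM.
Qed.

Lemma smooth1_affine (c d : R) f : smooth1 f -> smooth1 (fun x => f (c * x + d)).
Proof.
move=> [F F0 hF]; exists (fun k x => c ^+ k * F k (c * x + d)).
  by apply/funext => x; rewrite expr0 mul1r F0.
move=> k x.
rewrite (_ : c ^+ k.+1 * _ = c ^+ k *: (c * F k.+1 (c * x + d))); last first.
  by rewrite exprSr -mulrA.
apply: (@is_deriveZ _ _ _ (fun x => F k (c * x + d))).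
have h : is_derive x (1 : R) (fun x : R => c * x + d) c.
  rewrite -[X in is_derive _ _ _ X]addr0.
  apply: is_deriveD; rewrite -[X in is_derive _ _ _ X]mulr1.
  exact: (@is_deriveZ _ _ _ id).
by rewrite mulrC; exact: (@is_derive1_comp _ (F k) (fun x : R => c * x + d)).
Qed.

Lemma smooth1_primitive f g : smooth1 f ->
  (forall x, is_derive x (1 : R) g (f x)) -> smooth1 g.
Proof.
move=> [F F0 hF] hg; exists (fun k => if k is k'.+1 then F k' else g) => //.
by case=> [|k] x //=; rewrite F0.
Qed.

Lemma smooth1_continuous f : smooth1 f -> continuous f.
Proof.
move=> [F <- hF] x; apply: differentiable_continuous.
by apply/derivable1_diffP; have [] := hF 0%N x.
Qed.

(* The derivative of [x |-> p(1/x) exp(-1/x)] has the same shape, with [p]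
   replaced by ['X^2 * (p - p^`())]. *)
Definition hpoly (p : {poly R}) (x : R) : R :=
  if 0 < x then p.[x^-1] * expR (- x^-1) else 0.

(** For monomials this is [y ^ m / m! <= exp y], from the exponential series. *)
Lemma poly_expR_bounded (p : {poly R}) :
  exists C : R, forall y : R, 0 <= y -> `|p.[y] * expR (- y)| <= C.
Proof.
suff mono (c : R) (m : nat) :
    exists C : R, forall y : R, 0 <= y -> `|c * y ^+ m * expR (- y)| <= C.
  have [K hK] := choice (fun i : nat => mono p`_i i).
  exists (\sum_(i < size p) K i) => y y0.
  rewrite horner_coef !mulr_suml; apply: le_trans (ler_norm_sum _ _ _) _.
  by apply: ler_sum => i _; exact: hK.
exists (`|c| * m`!%:R) => y y0; rewrite -mulrA normrM ler_wpM2l// ger0_norm; last first.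
  by rewrite mulr_ge0 ?exprn_ge0 ?expR_ge0.
rewrite expRN ler_pdivrMr ?expR_gt0//.
case: m => [|m]; first by rewrite expr0 mul1r; apply: le_trans (expR_ge1Dx y); rewrite lerDl.
have := expR_ge1Dxn m y0 => h.
rewrite -ler_pdivrMl ?ltr0n ?fact_gt0// mulrC; apply: le_trans h.
by rewrite lerDr.
Qed.

Lemma is_derive_sq_bound f (C : R) : (forall x, `|f x| <= C * x ^+ 2) ->
  is_derive (0 : R) (1 : R) f 0.
Proof.
move=> fC.
have f0 : f 0 = 0 by apply/eqP; rewrite -normr_le0 (le_trans (fC 0))// expr0n mulr0.
have c : (fun h : R => h^-1 *: ((f \o shift 0) (h *: 1) - f 0)) @ 0^' --> (0 : R).
  have C1 : 0 < `|C| + 1 by rewrite ltr_wpDl.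
  apply/cvgrPdist_lt => e e0; near=> h.
  rewrite /= addr0 f0 subr0 sub0r normrN /GRing.scale/= mulr1.
  have h0 : 0 < `|h| by rewrite normr_gt0; near: h; exact: nbhs_dnbhs_neq.
  have he : `|h| < e / (`|C| + 1).
    by near: h; apply: dnbhs0_lt; apply: divr_gt0.
  rewrite normrM normfV ltr_pdivrMl//.
  apply: le_lt_trans (fC h) _.
  rewrite -(@real_normK _ h) ?num_real//.
  move: he; rewrite ltr_pdivlMr// => he; have := ler_norm C; nra.
by apply: DeriveDef; [apply/cvg_ex; exists 0|exact: (cvg_lim (@Rhausdorff R) c)].
Unshelve. all: by end_near. Qed.

Lemma hpoly_derive (p : {poly R}) (x : R) :
  is_derive x (1 : R) (hpoly p) (hpoly ('X^2 * (p^`() - p) * (-1)%:P) x).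
Proof.
have [x0|x0|->] := ltgtP x 0.
- rewrite {2}/hpoly ltNge (ltW x0)/=.
  apply: (@near_eq_is_derive _ _ _ (cst 0 : R -> R)) => //.
    have nx : nbhs x [set y : R | y < 0].
      by apply: open_nbhs_nbhs; split; [exact: open_lt|exact: x0].
    by apply: filterS nx => y y0; rewrite /hpoly ltNge (ltW y0).
- rewrite {2}/hpoly x0.
  apply: (@near_eq_is_derive _ _ _ ((fun y : R => p.[y^-1] * expR (- y^-1)) : R -> R)).
    have nx : nbhs x [set y : R | 0 < y].
      by apply: open_nbhs_nbhs; split; [exact: open_gt|exact: x0].
    by apply: filterS nx => y y0; rewrite /hpoly y0.
  have dV : is_derive x (1 : R) (fun y : R => y^-1) (- (x ^- 2) *: 1).
    by apply: is_deriveV; rewrite gt_eqF.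
  have dE : is_derive x^-1 (1 : R) (fun y : R => expR (- y)) (expR (- x^-1) * - 1).
    exact: (@is_derive1_comp _ expR (fun y : R => - y)).
  have dg := is_deriveM (is_derive_poly p x^-1) dE.
  have := @is_derive1_comp _ _ (fun y : R => y^-1) x _ _ dg dV.
  congr is_derive; rewrite !hornerE /GRing.scale/= exprVn; ring.
- rewrite {2}/hpoly ltxx.
  (* Boundedness of [p(y) y^2 exp(-y)] at [y = 1/x] is a quadratic bound for [hpoly p] at the
     origin, whose derivative there is therefore 0. *)
  have [C hC] := poly_expR_bounded (p * 'X^2).
  apply: (@is_derive_sq_bound _ `|C|) => y; rewrite /hpoly; case: ifPn => [y0|_].
    have := hC y^-1; rewrite invr_ge0 (ltW y0) => /(_ isT).
    rewrite hornerM hornerXn mulrAC normrM (_ : `|y^-1 ^+ 2| = (y ^+ 2)^-1).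
      rewrite ler_pdivrMr ?exprn_gt0// => h; apply: le_trans h _.
      by rewrite ler_wpM2r ?sqr_ge0// ler_norm.
    by rewrite exprVn ger0_norm// invr_ge0 sqr_ge0.
  by rewrite normr0 mulr_ge0// sqr_ge0.
Qed.

Lemma smooth1_hpoly p : smooth1 (hpoly p).
Proof.
apply: (@smooth1_class [set f | exists p, f = hpoly p]); last by exists p.
move=> _ [q ->]; exists (hpoly ('X^2 * (q^`() - q) * (-1)%:P)); first by eexists.
by move=> x; exact: hpoly_derive.
Qed.

(** On ]a, b[ this is the product of [exp(-1/((k+1)(x-a)))] and [exp(-1/((k+1)(b-x)))]. As [k] grows
    the exponents tend to 0, so the bumps tend to the indicator function while their support stays
    in [a, b]. *)
Definition sbump (a b : R) (k : nat) (x : R) : R :=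
  hpoly 1 (k.+1%:R * x + - (k.+1%:R * a)) * hpoly 1 (- k.+1%:R * x + k.+1%:R * b).

Lemma hpoly1_ge0 x : 0 <= hpoly 1 x.
Proof. by rewrite /hpoly; case: ifP => // _; rewrite hornerC mul1r expR_ge0. Qed.

Lemma hpoly1_le1 x : hpoly 1 x <= 1.
Proof.
rewrite /hpoly; case: ifPn => // x0; rewrite hornerC mul1r -expR0 ler_expR.
by rewrite oppr_le0 invr_ge0 ltW.
Qed.

Lemma hpoly1_eq0 x : x <= 0 -> hpoly 1 x = 0.
Proof. by move=> x0; rewrite /hpoly ltNge x0. Qed.

Lemma smooth1_bump a b k : smooth1 (sbump a b k).
Proof. by apply: smooth1M; apply: smooth1_affine; exact: smooth1_hpoly. Qed.

Lemma bump_ge0 a b k x : 0 <= sbump a b k x.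
Proof. by rewrite mulr_ge0 ?hpoly1_ge0. Qed.

Lemma bump_le1 a b k x : sbump a b k x <= 1.
Proof. by rewrite mulr_ile1 ?hpoly1_ge0 ?hpoly1_le1. Qed.

Lemma bump_eq0 a b k x : ~~ (a < x < b) -> sbump a b k x = 0.
Proof.
rewrite negb_and -!leNgt /sbump => /orP[xa|bx].
  by rewrite (hpoly1_eq0 (x := k.+1%:R * x + _)) ?mul0r// -mulrBr mulr_ge0_le0// subr_le0.
rewrite (hpoly1_eq0 (x := - k.+1%:R * x + _)) ?mulr0//.
by rewrite mulNr addrC -mulrBr mulr_ge0_le0// subr_le0.
Qed.

Lemma hpoly1_cvg (y : R) : 0 < y -> hpoly 1 (k.+1%:R * y) @[k --> \oo] --> (1 : R).
Proof.
move=> y0.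
have -> : (fun k => hpoly 1 (k.+1%:R * y)) = (fun k => expR (- (harmonic k * y^-1))).
  apply/funext => k; rewrite /hpoly mulr_gt0// hornerC mul1r invfM.
  by rewrite /harmonic /= mulrC.
rewrite -expR0; apply: continuous_cvg; first exact: continuous_expR.
rewrite -oppr0; apply: cvgN; rewrite -(mul0r y^-1).
by apply: cvgM; [exact: cvg_harmonic|exact: cvg_cst].
Qed.

Lemma bump_cvg a b x : a < x < b -> sbump a b k x @[k --> \oo] --> (1 : R).
Proof.
move=> /andP[ax xb]; rewrite -[X in _ --> X](mulr1 1); apply: cvgM.
  have := @hpoly1_cvg (x - a); rewrite subr_gt0 => /(_ ax).
  by under eq_fun do rewrite mulrBr.
have := @hpoly1_cvg (b - x); rewrite subr_gt0 => /(_ xb).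
by under eq_fun do rewrite mulrBr addrC -mulNr.
Qed.

(** The exception is genuine: at [b] the bumps vanish whereas the indicator of the half-open
    interval is 1. *)
Lemma bump_cvg_itv a b x : x != b ->
  sbump a b k x @[k --> \oo] --> (\1_(`]a, b]%classic) x : R).
Proof.
move=> xb; rewrite indicE; have [h|h] := boolP (a < x < b).
  rewrite mem_set; first exact: bump_cvg.
  by move: h => /andP[h1 /ltW h2]; rewrite /= in_itv/= h1.
rewrite memNset; last first.
  by rewrite /= in_itv/= => /andP[h1]; rewrite le_eqVlt (negbTE xb)/= => h2; move: h; rewrite h1 h2.
under eq_fun do rewrite bump_eq0//.
exact: cvg_cst.
Qed.

End smooth1.

Lemma lebesgue_itv_fin {R : realType} (a b : R) :
  (@lebesgue_measure R `]a, b]%classic < +oo)%E.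
Proof. by rewrite lebesgue_measure_itv/=; case: ifP => _; exact: ltry. Qed.

Section bump_primitive.
Context {R : realType}.
Local Notation mu := (@lebesgue_measure R).
Variables (a b : R) (k : nat).
Hypothesis ab : a < b.

Definition bumpI (x : R) : R := (\int[mu]_(t in [set` `]-oo, x]]) sbump a b k t)%R.

Definition bump_mass : R := (\int[mu]_t sbump a b k t)%R.

Lemma measurable_bump D : measurable_fun D (sbump a b k).
Proof.
apply: measurable_funTS; apply: continuous_measurable_fun.
exact/smooth1_continuous/smooth1_bump.
Qed.

Lemma bump_patch : EFin \o sbump a b k = (EFin \o sbump a b k) \_ (`]a, b]%classic).
Proof.
apply/funext => x; rewrite patchE; case: ifPn => // h.
rewrite /= bump_eq0//; apply: contra h => /andP[h1 /ltW h2].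
by rewrite inE /= in_itv/= h1 h2.
Qed.

Lemma bump_integrable D : measurable D -> mu.-integrable D (EFin \o sbump a b k).
Proof.
move=> mD; apply: (integrableS measurableT) => //.
rewrite bump_patch; apply/integrable_restrict => //.
rewrite setTI; apply: measurable_bounded_integrable => //.
- exact: lebesgue_itv_fin.
- exact: measurable_bump.
- exists 1; split => // x x1 y _ /=; rewrite ger0_norm ?bump_ge0//.
  by rewrite (le_trans (bump_le1 _ _ _ _))// ltW.
Qed.

Lemma bumpI_derive x : is_derive x (1 : R) bumpI (sbump a b k x).
Proof.
have x1 : x < x + 1 by rewrite ltrDl.
have [d e] := @continuous_FTC1 R (sbump a b k) -oo%O x (x + 1) x1
  (bump_integrable (measurable_itv _)) (ltNyr _)
  (@smooth1_continuous _ _ (smooth1_bump a b k) x).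
by apply: (DeriveDef d); rewrite -e derive1E.
Qed.

Lemma smooth1_bumpI : smooth1 bumpI.
Proof. by apply: smooth1_primitive (smooth1_bump a b k) _ => x; exact: bumpI_derive. Qed.

Lemma bumpI_le x y : x <= y -> bumpI x <= bumpI y.
Proof.
move=> xy; rewrite /bumpI /Rintegral; apply: fine_le.
- apply: integrable_fin_num => //; exact: bump_integrable.
- apply: integrable_fin_num => //; exact: bump_integrable.
- apply: ge0_subset_integral => //.
  + by apply/measurable_EFinP; exact: measurable_bump.
  + by move=> t _; rewrite lee_fin bump_ge0.
  + by move=> t; rewrite /= !in_itv/= => /le_trans; exact.
Qed.

Lemma bumpI_eq0 x : x <= a -> bumpI x = 0.
Proof.
move=> xa; rewrite /bumpI /Rintegral integral0_eq// => t; rewrite /= in_itv/= => tx.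
by rewrite bump_eq0// negb_and -leNgt (le_trans tx xa).
Qed.

Lemma bumpI_mass x : b <= x -> bumpI x = bump_mass.
Proof.
move=> bx; rewrite /bumpI /bump_mass /Rintegral; congr fine.
rewrite integral_mkcond; congr integral; apply/funext => t.
rewrite patchE; case: ifPn => // h; rewrite bump_eq0//.
apply: contra h => /andP[_ tb]; rewrite inE /= in_itv/=.
by rewrite (le_trans (ltW tb)).
Qed.

Lemma bumpI_ge0 x : 0 <= bumpI x.
Proof.
by have [xa|/ltW xa] := leP x a; [rewrite bumpI_eq0|rewrite -(bumpI_eq0 (lexx a)) bumpI_le].
Qed.

Lemma bumpI_le_mass x : bumpI x <= bump_mass.
Proof.
rewrite -(bumpI_mass (x := Num.max x b)) ?le_max ?lexx ?orbT//.
by apply: bumpI_le; rewrite le_max lexx.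
Qed.

Lemma bump_mass_le : bump_mass <= b - a.
Proof.
have [||c _] := @MVT _ bumpI (sbump a b k) a b ab.
- by move=> t _; exact: bumpI_derive.
- by apply: continuous_subspaceT; exact/smooth1_continuous/smooth1_bumpI.
rewrite bumpI_mass// (bumpI_eq0 (lexx a)) subr0 => ->.
by rewrite ler_piMl ?bump_le1// subr_ge0 ltW.
Qed.

End bump_primitive.

Lemma bump_mass_cvg {R : realType} (a b : R) : a < b ->
  bump_mass a b k @[k --> \oo] --> b - a.
Proof.
move=> ab.
have H1 k : measurable_fun setT (EFin \o sbump a b k).
  by apply/measurable_EFinP; exact: measurable_bump.
have H2 : measurable_fun setT (EFin \o (\1_(`]a, b]%classic) : R -> R)).
  by apply/measurable_EFinP.
have H3 : {ae (@lebesgue_measure R), forall x, setT x ->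
   (fun k => EFin \o sbump a b k) k x @[k --> \oo] --> (EFin \o (\1_(`]a, b]%classic) : R -> R)) x}.
  exists [set b]; split => //; first exact: lebesgue_measure_set1.
  move=> x /= hx; apply: contrapT => xb; apply: hx => _.
  apply/cvg_EFin; first exact: nearW.
  by apply: bump_cvg_itv; apply/eqP.
have H4 : {ae (@lebesgue_measure R), forall x, forall k, setT x ->
    (`|(EFin \o sbump a b k) x| <= (EFin \o (\1_(`]a, b]%classic) : R -> R)) x)%E}.
  apply: aeW => x k _ /=; rewrite lee_fin ger0_norm ?bump_ge0// indicE.
  have [h|h] := boolP (a < x < b).
    by rewrite mem_set ?bump_le1//= in_itv/=; move: h => /andP[-> /ltW ->].
  by rewrite bump_eq0.
have ig : (@lebesgue_measure R).-integrable setT (EFin \o (\1_(`]a, b]%classic) : R -> R)).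
  exact: integrable_indic_itv.
have [_ _ h] := @dominated_convergence _ _ _ (@lebesgue_measure R) setT measurableT
  (fun k => EFin \o sbump a b k) _ _ H1 H2 H3 ig H4.
have : (\int[@lebesgue_measure R]_x (sbump a b k x)%:E)%E @[k --> \oo] --> (b - a)%:E.
  have E2 : lebesgue_measure `]a, b]%classic = (b - a)%:E.
    by rewrite lebesgue_measure_itv/= lte_fin ab.
  by move: h; rewrite integral_indic// setIT -E2.
exact: fine_cvg.
Qed.

Section product_test_functions.
Context {R : realType} {n : nat}.
Local Notation E := 'rV[R]_n.
Local Notation "''e_' i" := (delta_mx ord0 i : E) (at level 8, i at level 2).
Implicit Types (z : E).

Definition prodf (f : 'I_n -> R -> R) z : R := \prod_j f j (z ord0 j).

Definition repl (f : 'I_n -> R -> R) i (g : R -> R) : 'I_n -> R -> R :=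
  fun j => if j == i then g else f j.

Lemma prodf_repl f i g z : prodf (repl f i g) z =
  g (z ord0 i) * \prod_(j | j != i) f j (z ord0 j).
Proof.
rewrite /prodf (bigD1 i)//= /repl eqxx; congr (_ * _).
by apply: eq_bigr => j /negbTE ->.
Qed.

Lemma prodf_split f i z : prodf f z =
  f i (z ord0 i) * \prod_(j | j != i) f j (z ord0 j).
Proof. by rewrite /prodf (bigD1 i). Qed.

Lemma prodf_derive f i g : (forall x, is_derive x (1 : R) (f i) (g x)) ->
  forall z, derivable (prodf f) z 'e_i /\ partial i (prodf f) z = prodf (repl f i g) z.
Proof.
move=> hg z.
pose c := \prod_(j | j != i) f j (z ord0 j).
have E1 : (fun t : R => prodf f (z + t *: 'e_i)) = (fun t => c *: f i (t + z ord0 i)).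
  apply/funext => t; rewrite (prodf_split f i) mulrC; congr (_ * _).
    by apply: eq_bigr => j ji; rewrite !mxE (negbTE ji) andbF mulr0 addr0.
  by rewrite !mxE !eqxx mulr1 addrC.
have d : is_derive (0 : R) (1 : R) ((fun t : R => prodf f (z + t *: 'e_i)) : R -> R)
    (c *: (g (z ord0 i))).
  rewrite E1; apply: is_deriveZ.
  have h : is_derive (0 : R) (1 : R) (fun t : R => t + z ord0 i) 1.
    rewrite -[X in is_derive _ _ _ X]addr0; exact: is_deriveD.
  have := hg (0 + z ord0 i); rewrite add0r -{1}[z ord0 i]add0r => h'.
  have := @is_derive1_comp _ (f i) (fun t : R => t + z ord0 i) 0 _ _ h' h.
  by rewrite mulr1.
have dz : derivable (prodf f) (z + 0 *: 'e_i) 'e_i.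
  by apply/line_derivable; have [] := d.
have := line_derive dz => -[_ e].
move: dz e; rewrite scale0r addr0 => dz e; split => //.
rewrite /partial -e; have [_ ->] := d.
by rewrite prodf_repl mulrC.
Qed.

Lemma continuous_coord i : continuous (fun z => z ord0 i).
Proof. exact: elip_continuous (elip_coord i). Qed.

Lemma continuousM_rV (f g : E -> R) : continuous f -> continuous g ->
  continuous (fun z => f z * g z).
Proof.
by move=> cf cg z; apply: (@cvgM _ _ (nbhs z) (nbhs_filter z)); [exact: cf|exact: cg].
Qed.

Lemma prodf_continuous (f : 'I_n -> R -> R) : (forall j, continuous (f j)) -> continuous (prodf f).
Proof.
move=> cf; suff : forall s : seq 'I_n,
  continuous (fun z : E => \prod_(j <- s) f j (z ord0 j)) by exact.
elim=> [|j s IH].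
  rewrite (_ : (fun z : E => _) = cst (1 : R)); first exact: cst_continuous.
  by apply/funext => z; rewrite big_nil.
rewrite (_ : (fun z : E => _) =
    (fun z => f j (z ord0 j) * \prod_(j <- s) f j (z ord0 j))); last first.
  by apply/funext => z; rewrite big_cons.
apply: continuousM_rV => // z.
by apply: (@continuous_comp _ _ _ (fun z : E => z ord0 j) (f j));
  [exact: continuous_coord|exact: cf].
Qed.

Lemma prodf_test (O : set E) (f : 'I_n -> R -> R) (a b : E) :
  (forall j, smooth1 (f j)) ->
  (forall j x, ~~ (a ord0 j <= x <= b ord0 j) -> f j x = 0) ->
  cbox a b `<=` O -> test_function O (prodf f).
Proof.
move=> sf f0 abO.
have sub : closure [set z | prodf f z != 0] `<=` cbox a b.
  have cl : closed (cbox a b) by apply: compact_closed; [exact: norm_hausdorff|exact: cbox_compact].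
  rewrite [X in _ `<=` X](iffLR (closure_id _) cl).
  apply: closure_subset => z /= nz j; apply: contraT => h; move: nz.
  by rewrite (prodf_split f j) f0// mul0r eqxx.
split; last exact: subset_trans abO; last first.
  apply: (subclosed_compact _ (@cbox_compact _ _ a b)) => //.
  exact: closed_closure.
have h j : exists Fj : nat -> R -> R, Fj 0%N = f j /\ derivatives Fj.
  by have [Fj h1 h2] := sf j; exists Fj.
have [F hF] := choice h.
(* Every iterated partial derivative is again a product, with the factor [j] differentiated as often
   as [j] occurs in [l]. *)
have E1 l : iter_partial l (prodf f) = prodf (fun j => F j (count_mem j l)).
  elim: l => [|i l IH] /=.
    by congr prodf; apply/funext => j; rewrite (hF j).1.
  rewrite IH; apply/funext => z.
  have [_ ->] := @prodf_derive (fun j => F j (count_mem j l)) i _ ((hF i).2 (count_mem i l)) z.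
  congr (prodf _ z); apply/funext => j; rewrite /repl.
  by rewrite (eq_sym i j); case: eqP => [->|].
move=> l; rewrite E1; split.
  apply: prodf_continuous => j x; apply: differentiable_continuous.
  by apply/derivable1_diffP; have [] := (hF j).2 (count_mem j l) x.
move=> i z.
by have [] := @prodf_derive (fun j => F j (count_mem j l)) i _ ((hF i).2 (count_mem i l)) z.
Qed.

End product_test_functions.

(** * The space W^{1,oo} and the uniqueness of weak gradients *)

Section sobolev_infty.
Context {R : realType} {n : nat}.
Local Notation E := 'rV[R]_n.
Implicit Types (O : set E) (u v : E -> R) (z a b : E).

(** The norm with exponent [+oo] is defined as an essential supremum when the whole space has
    positive measure. *)
Lemma leb_setT_gt0 : (0 < leb [set: E])%E.
Proof.
apply: (@lt_le_trans _ _ (leb (box (0 : E) (const_mx 1)))).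
  rewrite leb_boxE; last by move=> i; rewrite !mxE.
  by rewrite lte_fin; apply: prodr_gt0 => i _; rewrite !mxE subr0.
apply: le_measure; rewrite ?inE//; exact: measurable_box.
Qed.

Lemma Lnorm_oo_ae (f : E -> R) :
  {ae leb, forall z, (`|f z|%:E <= 'N[leb]_+oo[EFin \o f])%E}.
Proof. by rewrite Lnorm.unlock leb_setT_gt0; exact: ess_sup_ge. Qed.

Lemma Lnorm_oo_le (f : E -> R) M : {ae leb, forall z, `|f z| <= M} ->
  ('N[leb]_+oo[EFin \o f] <= M%:E)%E.
Proof. by move=> h; rewrite Lnorm.unlock leb_setT_gt0; apply/ess_supP. Qed.

Lemma mem_Lfun_oo (f : E -> R) M : measurable_fun setT f ->
  {ae leb, forall z, `|f z| <= M} -> f \in Lfun leb +oo%E.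
Proof.
move=> mf fM; rewrite inE; apply/andP; split; first by rewrite inE.
by rewrite inE /= /finite_norm (le_lt_trans (Lnorm_oo_le fM))// ltry.
Qed.

Lemma Lfun_oo_inv (f : E -> R) : f \in Lfun leb +oo%E ->
  exists M : R, [/\ measurable_fun setT f, 0 <= M,
    'N[leb]_+oo[EFin \o f]%E = M%:E & {ae leb, forall z, `|f z| <= M}].
Proof.
rewrite inE => /andP[mf]; rewrite inE /= /finite_norm => ff.
have f0 := Lnorm_ge0 leb +oo%E (EFin \o f).
exists (fine 'N[leb]_+oo[EFin \o f]%E).
have fE : ('N[leb]_+oo[EFin \o f] \is a fin_num)%E by rewrite ge0_fin_numE.
split => //; first by move: mf; rewrite inE.
- exact: fine_ge0.
- by rewrite fineK.
- have := Lnorm_oo_ae f; apply: filterS => z.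
  by rewrite -{1}(fineK fE) lee_fin.
Qed.

Lemma patchR_in O u z : O z -> (u \_ O) z = u z.
Proof. by move=> Oz; rewrite patchE mem_set. Qed.

Lemma patchR_notin O u z : ~ O z -> (u \_ O) z = 0.
Proof. by move=> Oz; rewrite patchE memNset. Qed.

Lemma weak_gradientP O u : (exists g, is_weak_gradient O u g) ->
  is_weak_gradient O u (weak_gradient O u).
Proof. by move=> [g hg]; apply: (xgetPex _ (P := [set g | is_weak_gradient O u g])); exists g. Qed.

Lemma W1p_oo_data O u : W1p +oo%E O u -> exists M L : R,
  [/\ (W1p_norm +oo%E O u = (M + L)%:E)%E, 0 <= M, 0 <= L,
      {ae leb, forall z, O z -> `|u z| <= M} &
      exists2 g, is_weak_gradient O u g &
        {ae leb, forall z, O z -> forall i, `|g z ord0 i| <= L}].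
Proof.
move=> [uL ug gL].
have [M [mu M0 NM uM]] := Lfun_oo_inv uL.
have [L [mg L0 NL gL']] := Lfun_oo_inv gL.
exists M, L; split => //.
- by rewrite EFinD -NM -NL.
- by apply: filterS uM => z; case: (pselect (O z)) => Oz h // Oz'; rewrite -(patchR_in u Oz).
- exists (weak_gradient O u); first exact: weak_gradientP.
  apply: filterS gL' => z h Oz i; move: h; rewrite patchR_in//= ger0_norm ?enorm_ge0//.
  by apply: le_trans; exact: ler_coord_enorm.
Qed.

Lemma ae_neq_coord b : {ae leb, forall z : E, forall i, z ord0 i != b ord0 i}.
Proof.
have h i : {ae leb, forall z : E, z ord0 i != b ord0 i}.
  exists [set z : E | z ord0 i = b ord0 i]; split.
  - exact: (@measurable_coordset R n i [set b ord0 i]).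
  - apply: (leb_line_null (i := i)); first exact: (@measurable_coordset R n i [set b ord0 i]).
    move=> z; rewrite (_ : [set t : R | _] = [set b ord0 i - z ord0 i]).
      exact: lebesgue_measure_set1.
    apply/seteqP; split=> t /=; rewrite !mxE !eqxx mulr1; first by move=> <-; ring.
    by move=> ->; ring.
  - by move=> z /= /negP; rewrite negbK => /eqP.
by exact: filter_forall.
Qed.

Definition bumps a b k : E -> R := prodf (fun j => sbump (a ord0 j) (b ord0 j) k).

Lemma bumps_ge0 a b k z : 0 <= bumps a b k z.
Proof. by apply: prodr_ge0 => j _; exact: bump_ge0. Qed.

Lemma bumps_le1 a b k z : bumps a b k z <= 1.
Proof. by apply: prodr_ile1 => j _; rewrite bump_ge0 bump_le1. Qed.

Lemma bumps_test O a b k : cbox a b `<=` O -> test_function O (bumps a b k).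
Proof.
apply: prodf_test => j; first exact: smooth1_bump.
move=> x h; apply: bump_eq0; apply: contra h => /andP[/ltW -> /ltW ->] //.
Qed.

Lemma bumps_eq0 a b k z : ~ cbox a b z -> bumps a b k z = 0.
Proof.
move=> /existsNP[i hi]; rewrite /bumps (prodf_split _ i) bump_eq0 ?mul0r//.
by apply/negP => /andP[/ltW h1 /ltW h2]; apply: hi; rewrite h1 h2.
Qed.

Lemma cvg_prod_seq (s : seq 'I_n) (f : nat -> 'I_n -> R) (l : 'I_n -> R) :
  (forall j, f k j @[k --> \oo] --> l j) ->
  \prod_(j <- s) f k j @[k --> \oo] --> \prod_(j <- s) l j.
Proof.
move=> h; elim: s => [|j s IH].
  by under eq_fun do rewrite big_nil; rewrite big_nil; exact: cvg_cst.
by under eq_fun do rewrite big_cons; rewrite big_cons; exact: cvgM.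
Qed.

Lemma indic_box a b z :
  \1_(box a b) z = \prod_j (\1_(`]a ord0 j, b ord0 j]%classic) (z ord0 j)) :> R.
Proof.
have [h|/existsNP[i hi]] := pselect (box a b z).
  rewrite indicE mem_set//= big1// => j _.
  by rewrite indicE mem_set//= in_itv/= h.
rewrite indicE memNset/=; last by move=> /(_ i).
by rewrite (bigD1 i)//= indicE memNset ?mul0r//.
Qed.

Lemma bumps_cvg a b :
  {ae leb, forall z, bumps a b k z @[k --> \oo] --> (\1_(box a b) z : R)}.
Proof.
apply: filterS (ae_neq_coord b) => z hz; rewrite indic_box.
by apply: cvg_prod_seq => j; apply: bump_cvg_itv.
Qed.

Lemma measurable_bumps a b k : measurable_fun setT (bumps a b k).
Proof.
apply: continuous_measurableT_rV; apply: prodf_continuous => j.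
exact/smooth1_continuous/smooth1_bump.
Qed.

Lemma integrable_bumps_cvg (f : E -> R) a b :
  leb.-integrable (cbox a b) (EFin \o f) ->
  (\int[leb]_(z in cbox a b) (f z * bumps a b k z)%:E)%E @[k --> \oo] -->
  (\int[leb]_(z in box a b) (f z)%:E)%E.
Proof.
move=> fi; set D := cbox a b.
have mD : measurable D by apply: compact_measurable_rV; exact: cbox_compact.
have mf : measurable_fun D f by apply/measurable_EFinP; exact: (measurable_int _ fi).
have H1 k : measurable_fun D (EFin \o (fun z => f z * bumps a b k z)).
  apply/measurable_EFinP/measurable_funM => //.
  by apply: measurable_funTS; exact: measurable_bumps.
have H2 : measurable_fun D (EFin \o (fun z => f z * \1_(box a b) z)).
  apply/measurable_EFinP/measurable_funM => //.
  by apply: measurable_funTS; apply: measurable_indic; exact: measurable_box.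
have H3 : {ae leb, forall z, D z ->
    (fun k => EFin \o (fun z => f z * bumps a b k z)) k z @[k --> \oo] -->
    (EFin \o (fun z => f z * \1_(box a b) z)) z}.
  apply: filterS (bumps_cvg a b) => z hz _; apply/cvg_EFin; first exact: nearW.
  by apply: cvgM => //; exact: cvg_cst.
have ig : leb.-integrable D (abse \o (EFin \o f)) by exact: integrable_abse.
have H4 : {ae leb, forall z, forall k, D z ->
    (`|(EFin \o (fun z => (f z * bumps a b k z)%R)) z| <= (abse \o (EFin \o f)) z)%E}.
  apply: aeW => z k _; rewrite /= lee_fin normrM ler_piMr//.
  by rewrite ger0_norm ?bumps_ge0 ?bumps_le1.
have [_ _ h] := @dominated_convergence _ _ _ leb D mD
  (fun k => EFin \o (fun z => f z * bumps a b k z)) _ _ H1 H2 H3 ig H4.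
suff <- : (\int[leb]_(z in D) (f z * \1_(box a b) z)%:E =
  \int[leb]_(z in box a b) (f z)%:E)%E by exact: h.
rewrite [LHS]integral_mkcond [RHS]integral_mkcond; congr integral.
apply/funext => z; rewrite !patchE indicE.
have [hb|hb] := pselect (box a b z).
  by rewrite (mem_set (box_cbox hb)) (mem_set hb) mulr1.
by rewrite (memNset hb) mulr0; case: ifP.
Qed.

Lemma sub_box_cbox a b a0 b0 : (forall i, a ord0 i < b ord0 i) ->
  box a b `<=` box a0 b0 -> cbox a b `<=` cbox a0 b0.
Proof.
move=> ab sub z hz i; have /andP[az zb] := hz i.
have hb : box a b b by move=> j; rewrite ab lexx.
have /andP[_ bb0] := sub _ hb i.
rewrite (le_trans zb bb0) andbT; apply: le_trans az.
rewrite leNgt; apply/negP => aa0.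
(* If [a0 i] exceeded [a i], this point of the inner box would have its coordinate [i] below
   [a0 i]. *)
pose w : E := \row_j if j == i then Num.min (b ord0 i) ((a ord0 i + a0 ord0 i) / 2)
  else b ord0 j.
have hw : box a b w.
  move=> j; rewrite !mxE; case: eqP => [->|_]; last by rewrite ab lexx.
  by rewrite lt_min ab ge_min lexx/= andbT; lra.
have := sub _ hw i; rewrite !mxE eqxx lt_min => /andP[/andP[_ h] _]; lra.
Qed.

(** The fundamental lemma of the calculus of variations: tested against [bumps], whose limit is the
    indicator of a box, the two functions have equal integrals over all boxes inside [O]. *)
Lemma ae_eq_of_tests O (f g : E -> R) : open O ->
  loc_integrable O f -> loc_integrable O g ->
  (forall phi, test_function O phi ->
    (\int[leb]_(z in O) (f z * phi z)%:E = \int[leb]_(z in O) (g z * phi z)%:E)%E) ->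
  {ae leb, forall z, O z -> f z = g z}.
Proof.
move=> oO [mf lf] [mg lg] fg.
have mO := open_measurable_rV oO.
have boxeq a b : cbox a b `<=` O ->
    (\int[leb]_(z in box a b) (f z)%:E = \int[leb]_(z in box a b) (g z)%:E)%E.
  move=> abO; have cK := @cbox_compact R n a b.
  have red (h : E -> R) k : (\int[leb]_(z in O) (h z * bumps a b k z)%:E =
      \int[leb]_(z in cbox a b) (h z * bumps a b k z)%:E)%E.
    rewrite [LHS]integral_mkcond [RHS]integral_mkcond; congr integral.
    apply/funext => z; rewrite !patchE.
    have [hc|hc] := pselect (cbox a b z).
      by rewrite (mem_set hc) (mem_set (abO _ hc)).
    by rewrite (memNset hc) bumps_eq0// mulr0; case: ifP.
  have h1 := integrable_bumps_cvg (lf _ cK abO).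
  have h2 := integrable_bumps_cvg (lg _ cK abO).
  apply: (cvg_unique _ h1) => //.
  have -> : (fun k => \int[leb]_(z in cbox a b) (f z * bumps a b k z)%:E)%E =
      (fun k => \int[leb]_(z in cbox a b) (g z * bumps a b k z)%:E)%E.
    by apply/funext => k; rewrite -!red; apply: fg; exact: bumps_test.
  exact: h2.
have key a b : cbox a b `<=` O -> {ae leb, forall z, box a b z -> f z - g z = 0}.
  move=> abO.
  have bi (h : E -> R) a' b' : cbox a' b' `<=` O ->
      (forall K, compact K -> K `<=` O -> leb.-integrable K (EFin \o h)) ->
      leb.-integrable (box a' b') (EFin \o h).
    move=> sub lh; apply: integrableS (lh _ (@cbox_compact R n a' b') sub) => //.
    - apply: compact_measurable_rV; exact: cbox_compact.
    - exact: measurable_box.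
    - exact: box_cbox.
  apply: box_integral0_ae.
    rewrite (_ : EFin \o _ = (EFin \o f \- (EFin \o g))%E); last exact/funext.
    by apply: integrableB; [exact: measurable_box|exact: bi|exact: bi].
  move=> a' b' sub.
  have [/forallP lt|] := boolP [forall i, a' ord0 i < b' ord0 i].
    have sub' : cbox a' b' `<=` O by apply: subset_trans abO; exact: sub_box_cbox sub.
    under eq_integral => z _ do rewrite EFinB.
    rewrite integralB_EFin//; [|exact: measurable_box|exact: bi|exact: bi].
    rewrite boxeq// subee//; apply: integrable_fin_num; [exact: measurable_box|exact: bi].
  rewrite negb_forall => /existsP[i]; rewrite -leNgt => ba.
  rewrite (_ : box a' b' = set0) ?integral_set0//.
  apply/seteqP; split => // z /(_ i) /andP[h1 h2].
  by have := lt_le_trans h1 h2; rewrite ltNge ba.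
have [F [D [h1 h2]]] := open_boxes oO.
have : {ae leb, forall z, forall k, D k -> box (F k).1 (F k).2 z -> f z - g z = 0}.
  apply: ae_foralln => k; have [Dk|Dk] := pselect (D k); last by apply: aeW.
  by apply: filterS (key _ _ (h1 _ Dk)) => z h _.
apply: filterS => z h Oz; have [k Dk hk] := h2 _ Oz.
by apply/eqP; rewrite -subr_eq0 (h k).
Qed.

Lemma weak_gradient_unique O u g g' : open O ->
  is_weak_gradient O u g -> is_weak_gradient O u g' ->
  {ae leb, forall z, O z -> forall i, g z ord0 i = g' z ord0 i}.
Proof.
move=> oO [_ lg hg] [_ lg' hg'].
have h i : {ae leb, forall z, O z -> g z ord0 i = g' z ord0 i}.
  apply: ae_eq_of_tests => // phi tphi.
  by apply: oppe_inj; rewrite -hg// hg'.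
have : {ae leb, forall z, forall i, O z -> g z ord0 i = g' z ord0 i}.
  by exact: filter_forall.
by apply: filterS => z hz Oz i; exact: hz.
Qed.

(** The gradient in the norm is an arbitrary choice, so the coordinate bound [K] of [lgradv] reaches
    it through uniqueness; the factor [n] comes from bounding the Euclidean norm by the sum of the
    coordinates. *)
Lemma W1p_lip O K M v : open O -> 0 <= K -> elip K v -> bdd M v ->
  W1p +oo%E O v /\ (W1p_norm +oo%E O v <= (M + n%:R * K)%:E)%E.
Proof.
move=> oO K0 vK vM.
have mO := open_measurable_rV oO.
have wg := lip_weak_gradient oO vK vM.
have M0 : 0 <= M by exact: le_trans (vM.2 0).
have vb : {ae leb, forall z, `|(v \_ O) z| <= M}.
  apply: aeW => z; have [Oz|Oz] := pselect (O z).
    by rewrite patchR_in// vM.2.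
  by rewrite patchR_notin// normr0.
have mv : measurable_fun setT (v \_ O).
  by apply: (iffLR (measurable_restrictT _ mO)); apply: measurable_funTS; exact: vM.1.
have wg' : is_weak_gradient O v (weak_gradient O v).
  by apply: weak_gradientP; exists (lgradv K v).
have gb : {ae leb, forall z, `|((enorm \o weak_gradient O v) \_ O) z| <= n%:R * K}.
  apply: filterS (weak_gradient_unique oO wg' wg) => z hz.
  have [Oz|Oz] := pselect (O z); last by rewrite patchR_notin// normr0 mulr_ge0.
  rewrite patchR_in//= ger0_norm ?enorm_ge0//; apply: le_trans (enorm_le_sum _) _.
  rewrite mulr_natl -[X in _ <= _ *+ X](card_ord n) -sumr_const; apply: ler_sum => i _.
  by rewrite hz// mxE clip_le.
have mg : measurable_fun setT ((enorm \o weak_gradient O v) \_ O).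
  apply: (iffLR (measurable_restrictT _ mO)).
  have [_ lg _] := wg'.
  rewrite (_ : enorm \o _ = (fun z => Num.sqrt (\sum_i (weak_gradient O v z ord0 i) ^+ 2)))//.
  apply: (measurableT_comp (continuous_measurable_fun (@sqrt_continuous R))).
  apply: measurable_sum => i; apply: measurable_funX; exact: (lg i).1.
split; first split.
- exact: mem_Lfun_oo vb.
- by exists (lgradv K v).
- exact: mem_Lfun_oo gb.
- by rewrite EFinD; apply: leeD; exact: Lnorm_oo_le.
Qed.

End sobolev_infty.

(** * Functions with bounded weak gradients are locally Lipschitz *)

Section box_oscillation.
Context {R : realType} {n : nat}.
Local Notation E := 'rV[R]_n.
Local Notation "''e_' i" := (delta_mx ord0 i : E) (at level 8, i at level 2).
Implicit Types (O : set E) (z w a b : E) (i : 'I_n).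

Lemma normr_sub_le (X Y Z : R) :
  0 <= X -> 0 <= Y -> X <= Z -> Y <= Z -> `|X - Y| <= Z.
Proof. by move=> *; rewrite ler_norml; apply/andP; split; lra. Qed.

Definition upd a i (x : R) : E := \row_j if j == i then x else a ord0 j.

Lemma updE a i x j : (upd a i x) ord0 j = if j == i then x else a ord0 j.
Proof. by rewrite mxE. Qed.

Definition vlt a b := forall i, a ord0 i < b ord0 i.

Lemma cbox_cube a b : exists2 r : R, 0 < r & cbox a b `<=` cube r.
Proof. by apply: compact_sub_box; exact: cbox_compact. Qed.

Definition boxint (f : E -> R) a b : R := integ (fun z => f z * \1_(box a b) z).

Lemma bfun_indic a b : exists r, bfun 1 r (\1_(box a b) : E -> R).
Proof.
have [r r0 hr] := cbox_cube a b; exists r; split; first split.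
- by apply: measurable_indic; exact: measurable_box.
- by move=> z; rewrite indicE ger0_norm//; case: (_ \in _).
- by move=> z hz; rewrite indicE memNset// => /box_cbox /hr.
Qed.

Lemma integ_indic a b : vlt a b -> integ (\1_(box a b) : E -> R) = vol a b.
Proof.
move=> ab; rewrite /integ /Rintegral integral_indic//; last exact: measurable_box.
by rewrite setIT -[RHS]/(fine (vol a b)%:E) -leb_boxE// => i; exact: ltW (ab i).
Qed.

Lemma vol_gt0 a b : vlt a b -> 0 < vol a b.
Proof. by move=> ab; apply: prodr_gt0 => i _; rewrite subr_gt0. Qed.

Lemma vol_upd a b i p q : vol (upd a i p) (upd b i q) =
  (q - p) * \prod_(j | j != i) (b ord0 j - a ord0 j).
Proof.
rewrite /vol (bigD1 i)//= !updE eqxx; congr (_ * _).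
by apply: eq_bigr => j /negbTE ji; rewrite !updE ji.
Qed.

Lemma boxint_le (f : E -> R) M a b : bdd M f -> vlt a b -> `|boxint f a b| <= M * vol a b.
Proof.
move=> fM ab; have [r hr] := bfun_indic a b.
have bf := bfunM fM hr; apply: le_trans (normr_integ bf) _.
rewrite -integ_indic// -(integZ _ hr).
apply: le_integ (bfun_norm bf) (bfunZ M hr) _ => z.
rewrite normrM (ger0_norm (_ : 0 <= \1_(box a b) z)) ?indicE//.
by rewrite ler_wpM2r// fM.2.
Qed.

Variables (O : set E) (U : E -> R) (M L : R).
Hypotheses (oO : open O) (UM : bdd M U) (L0 : 0 <= L).
Hypothesis weakU : forall i phi, test_function O phi ->
  `|integ (fun z => U z * partial i phi z)| <= L * integ (fun z => `|phi z|).

(* The test function is a product of bumps in the variables [j != i] and, in the variable [i], of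
   a primitive of the difference of the normalized bumps of [p, q] and [p', q']. *)
Lemma box_osc a b i p q p' q' : vlt a b -> p < q -> p' < q' ->
  cbox (upd a i (Num.min p p')) (upd b i (Num.max q q')) `<=` O ->
  `|(q' - p') * boxint U (upd a i p) (upd b i q) - (q - p) * boxint U (upd a i p') (upd b i q')|
  <= L * ((q - p) * (q' - p') * (Num.max q q' - Num.min p p')) *
     \prod_(j | j != i) (b ord0 j - a ord0 j).
Proof.
move=> ab pq pq'; set lo := Num.min p p'; set hi := Num.max q q' => hullO.
pose al := upd a i lo; pose bh := upd b i hi.
have lop : lo <= p by rewrite ge_min lexx.
have lop' : lo <= p' by rewrite ge_min lexx orbT.
have qhi : q <= hi by rewrite le_max lexx.
have qhi' : q' <= hi by rewrite le_max lexx orbT.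
pose c k := bump_mass p q k; pose c' k := bump_mass p' q' k.
have c0 k : 0 <= c k by rewrite (le_trans (bumpI_ge0 p q k p)) ?bumpI_le_mass.
have c0' k : 0 <= c' k by rewrite (le_trans (bumpI_ge0 p' q' k p')) ?bumpI_le_mass.
have cle k : c k <= q - p by exact: bump_mass_le.
have cle' k : c' k <= q' - p' by exact: bump_mass_le.
(* The crossed masses make the two bumps carry the same total mass, so that [P] returns to 0 to the
   right of both intervals and gives a function of compact support. *)
pose P k x := c' k * bumpI p q k x - c k * bumpI p' q' k x.
pose dP k x := c' k * sbump p q k x - c k * sbump p' q' k x.
have Pd k x : is_derive x (1 : R) (P k) (dP k x).
  by apply: is_deriveB; apply: is_deriveZ; exact: bumpI_derive.
have Ps k : smooth1 (P k) by apply: smooth1B; apply: smooth1Z; exact: smooth1_bumpI.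
have P0 k x : ~~ (lo < x <= hi) -> P k x = 0.
  rewrite negb_and -leNgt -ltNge => /orP[xlo|hix].
    have h1 := bumpI_eq0 q k (le_trans xlo lop).
    have h2 := bumpI_eq0 q' k (le_trans xlo lop').
    by rewrite /P h1 h2 !mulr0 subrr.
  rewrite /P !bumpI_mass ?(le_trans qhi (ltW hix)) ?(le_trans qhi' (ltW hix))//.
  by rewrite -/(c k) -/(c' k) mulrC subrr.
have Pb k x : `|P k x| <= (q - p) * (q' - p').
  have h1 : 0 <= c' k * bumpI p q k x by rewrite mulr_ge0 ?bumpI_ge0.
  have h2 : 0 <= c k * bumpI p' q' k x by rewrite mulr_ge0 ?bumpI_ge0.
  have h3 : c' k * bumpI p q k x <= (q - p) * (q' - p').
    rewrite mulrC; apply: ler_pM; [exact: bumpI_ge0|exact: c0'| |exact: cle'].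
    exact: le_trans (bumpI_le_mass _ _ _ _) (cle k).
  have h4 : c k * bumpI p' q' k x <= (q - p) * (q' - p').
    apply: ler_pM; [exact: c0|exact: bumpI_ge0|exact: cle|].
    exact: le_trans (bumpI_le_mass _ _ _ _) (cle' k).
  exact: normr_sub_le.
have dPb k x : `|dP k x| <= (q' - p') + (q - p).
  have h1 : c' k * sbump p q k x <= q' - p'.
    rewrite -[leRHS]mulr1; apply: ler_pM;
      [exact: c0'|exact: bump_ge0|exact: cle'|exact: bump_le1].
  have h2 : c k * sbump p' q' k x <= q - p.
    rewrite -[leRHS]mulr1; apply: ler_pM;
      [exact: c0|exact: bump_ge0|exact: cle|exact: bump_le1].
  apply: normr_sub_le.
  - by apply: mulr_ge0; [exact: c0'|exact: bump_ge0].
  - by apply: mulr_ge0; [exact: c0|exact: bump_ge0].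
  - by apply: le_trans h1 _; rewrite lerDl subr_ge0 ltW.
  - by apply: le_trans h2 _; rewrite lerDr subr_ge0 ltW.
pose f k j := sbump (a ord0 j) (b ord0 j) k.
pose phi k := prodf (repl (f k) i (P k)).
have tphi k : test_function O (phi k).
  apply: (prodf_test _ _ hullO) => j.
    by rewrite /repl; case: eqP => // _; exact: smooth1_bump.
  move=> x; rewrite !updE /repl; case: eqP => [_ h|_ h].
    by apply: P0; apply: contra h => /andP[/ltW -> ->].
  by apply: bump_eq0; apply: contra h => /andP[/ltW -> /ltW ->].
have dphi k z : partial i (phi k) z = prodf (repl (f k) i (dP k)) z.
  have [x|_ ->] := @prodf_derive _ _ (repl (f k) i (P k)) i (dP k) _ z.
    by rewrite /repl eqxx; exact: Pd.
  by rewrite !prodf_repl; congr (_ * _); apply: eq_bigr => j /negbTE ji; rewrite /repl ji.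
have [r r0 hr] := cbox_cube al bh.
have phib k : `|integ (fun z => U z * partial i (phi k) z)| <=
    L * ((q - p) * (q' - p') * (hi - lo)) * \prod_(j | j != i) (b ord0 j - a ord0 j).
  apply: le_trans (weakU i (tphi k)) _.
  rewrite -!mulrA ler_wpM2l// !mulrA -(mulrA (_ * _)) -vol_upd -/al -/bh.
  have albh : vlt al bh.
    move=> j; rewrite !updE; case: eqP => // _.
    by rewrite (le_lt_trans lop)// (lt_le_trans pq).
  have [r' hr'] := bfun_indic al bh.
  have [P1 [r1 [b1 _ _]]] := test_bfun (tphi k).
  rewrite -integ_indic// -(integZ _ hr').
  apply: le_integ (bfun_norm b1) (bfunZ _ hr') _ => z.
  have [zb|zb] := pselect (box al bh z).
    rewrite indicE mem_set// mulr1 /phi prodf_repl normrM -[leRHS]mulr1.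
    apply: ler_pM => //; rewrite ger0_norm; last by apply: prodr_ge0 => j _; exact: bump_ge0.
    by apply: prodr_ile1 => j _; rewrite bump_ge0 bump_le1.
  rewrite indicE memNset// mulr0 normr_le0 /phi prodf_repl.
  have [h|h] := boolP (lo < z ord0 i <= hi); last by rewrite P0// mul0r.
  have [j hj] : exists j, ~ al ord0 j < z ord0 j <= bh ord0 j by apply/existsNP.
  have ji : j != i by apply/eqP => ji; apply: hj; rewrite ji !updE eqxx.
  rewrite (bigD1 j)//= /f bump_eq0 ?mul0r ?mulr0//.
  by apply: (contra_notN _ hj); rewrite !updE (negbTE ji) => /andP[-> /ltW ->].
pose F z := (q' - p') * (U z * \1_(box (upd a i p) (upd b i q)) z) -
  (q - p) * (U z * \1_(box (upd a i p') (upd b i q')) z).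
have [s1 hs1] := bfun_indic (upd a i p) (upd b i q).
have [s2 hs2] := bfun_indic (upd a i p') (upd b i q').
have cvgI : integ (fun z => U z * partial i (phi k) z) @[k --> \oo] --> integ F.
  apply: (@dominated_integ _ _ (M * ((q' - p') + (q - p))) r).
  - move=> k; have [P1 [r1 [_ b1 _]]] := test_bfun (tphi k).
    apply: bfunM => //; split; first split.
    + exact: (b1 i).1.1.
    + move=> z; rewrite dphi prodf_repl normrM -[leRHS]mulr1; apply: ler_pM => //.
      rewrite ger0_norm; last by apply: prodr_ge0 => j _; exact: bump_ge0.
      by apply: prodr_ile1 => j _; rewrite bump_ge0 bump_le1.
    + move=> z hz; have hzb : ~ cbox al bh z by move=> /hr.
      have [j hj] : exists j, ~ al ord0 j <= z ord0 j <= bh ord0 j by apply/existsNP.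
      rewrite dphi prodf_repl; have [ji|ji] := eqVneq j i.
        rewrite /dP !bump_eq0 ?mulr0 ?subrr ?mul0r//; apply: (contra_notN _ hj);
        by rewrite ji !updE eqxx => /andP[h1 h2]; apply/andP; split; apply/ltW;
          [apply: le_lt_trans h1|apply: lt_le_trans h2 _].
      rewrite (bigD1 j)//= /f bump_eq0 ?mul0r ?mulr0//.
      by apply: (contra_notN _ hj); rewrite !updE (negbTE ji) => /andP[/ltW -> /ltW ->].
  - apply: measurable_funB; apply: measurable_funM => //; apply: measurable_funM => //;
      [exact: UM.1|exact: hs1.1.1|exact: UM.1|exact: hs2.1.1].
  - have ae1 := @ae_neq_coord R n b.
    have ae2 := @ae_neq_coord R n (upd b i q).
    have ae3 := @ae_neq_coord R n (upd b i q').
    apply: filterS3 ae1 ae2 ae3 => z h1 h2 h3.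
    have {}h2 := h2 i; have {}h3 := h3 i; rewrite !updE eqxx in h2 h3.
    have -> : F z = U z * ((((q' - p') * \1_(`]p, q]%classic) (z ord0 i)) -
        (q - p) * \1_(`]p', q']%classic) (z ord0 i)) *
        \prod_(j <- index_enum _ | j != i) (\1_(`]a ord0 j, b ord0 j]%classic) (z ord0 j))).
      rewrite /F !indic_box (bigD1 i)//= [X in _ - _ * (_ * X)](bigD1 i)//= !updE eqxx.
      rewrite (eq_bigr (fun j => \1_(`]a ord0 j, b ord0 j]%classic) (z ord0 j))); last first.
        by move=> j /negbTE ji; rewrite !updE ji.
      rewrite [X in _ - _ * (_ * (_ * X))](eq_bigr (fun j => \1_(`]a ord0 j, b ord0 j]%classic) (z ord0 j))).
        by ring.
      by move=> j /negbTE ji; rewrite !updE ji.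
    apply: cvgM; first exact: cvg_cst.
    under eq_fun do rewrite dphi prodf_repl.
    apply: cvgM.
      apply: cvgB; apply: cvgM; [exact: bump_mass_cvg|exact: bump_cvg_itv|exact: bump_mass_cvg|exact: bump_cvg_itv].
    under eq_fun do rewrite -big_filter; rewrite -big_filter.
    by apply: cvg_prod_seq => j; apply: bump_cvg_itv.
have <- : integ F = (q' - p') * boxint U (upd a i p) (upd b i q) - (q - p) * boxint U (upd a i p') (upd b i q').
  have b1 := bfunM UM hs1; have b2 := bfunM UM hs2.
  by rewrite /F (integB (bfunZ _ b1) (bfunZ _ b2)) (integZ _ b1) (integZ _ b2).
by apply: (cvg_le_cst (cvg_norm cvgI)).
Qed.

End box_oscillation.

Lemma seq_cauchy_cvg {R : realType} (u : nat -> R) :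
  (forall e, 0 < e -> exists N, forall k, (N <= k)%N -> `|u N - u k| < e) -> cvgn u.
Proof.
move=> h; apply: R_complete; apply: cauchy_exP => e e0.
have [N hN] := h e e0; exists (u N); exists N => // k /= Nk; exact: hN.
Qed.

(** * The representative obtained as a limit of averages *)

Section lipschitz_representative.
Context {R : realType} {n : nat}.
Local Notation E := 'rV[R]_n.
Implicit Types (z w a b : E) (i : 'I_n).

Variables (O : set E) (U : E -> R) (M L : R).
Hypotheses (oO : open O) (UM : bdd M U) (L0 : 0 <= L).
Hypothesis weakU : forall i phi, test_function O phi ->
  `|integ (fun z => U z * partial i phi z)| <= L * integ (fun z => `|phi z|).

Definition avg a b : R := boxint U a b / vol a b.

Definition vmin z w : E := \row_i Num.min (z ord0 i) (w ord0 i).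
Definition vmax z w : E := \row_i Num.max (z ord0 i) (w ord0 i).

Lemma avg_osc1 a b i p q p' q' : vlt a b -> p < q -> p' < q' ->
  cbox (upd a i (Num.min p p')) (upd b i (Num.max q q')) `<=` O ->
  `|avg (upd a i p) (upd b i q) - avg (upd a i p') (upd b i q')|
  <= L * (Num.max q q' - Num.min p p').
Proof.
move=> ab pq pq' hull.
have := box_osc UM L0 weakU ab pq pq' hull.
rewrite /avg !vol_upd.
set V := \prod_(j | j != i) _.
have V0 : 0 < V by apply: prodr_gt0 => j _; rewrite subr_gt0.
set X := boxint _ _ _; set Y := boxint _ _ _; set D := Num.max _ _ - _ => h.
have l0 : 0 < q - p by rewrite subr_gt0.
have l0' : 0 < q' - p' by rewrite subr_gt0.
have c0 : 0 < (q - p) * (q' - p') * V by rewrite !mulr_gt0.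
rewrite -(ler_pM2l c0) -{1}(gtr0_norm c0) -normrM.
rewrite (_ : _ * (X / _ - _) = (q' - p') * X - (q - p) * Y).
  by apply: le_trans h _; rewrite le_eqVlt; apply/orP; left; apply/eqP; ring.
by field; rewrite !gt_eqF.
Qed.

(** Interpolates between two boxes by exchanging one coordinate at a time, so that [avg_osc1] bounds
    each change. *)
Definition mix (s : seq 'I_n) a a' : E :=
  \row_j if j \in s then a' ord0 j else a ord0 j.

Lemma avg_osc a b a' b' : vlt a b -> vlt a' b' ->
  cbox (vmin a a') (vmax b b') `<=` O ->
  `|avg a b - avg a' b'| <=
    L * \sum_i (Num.max (b ord0 i) (b' ord0 i) - Num.min (a ord0 i) (a' ord0 i)).
Proof.
move=> ab ab' hull.
suff key s : uniq s -> `|avg a b - avg (mix s a a') (mix s b b')| <=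
    L * \sum_(i <- s) (Num.max (b ord0 i) (b' ord0 i) - Num.min (a ord0 i) (a' ord0 i)).
  have := key (index_enum 'I_n) (index_enum_uniq _).
  have mixT x y : mix (index_enum 'I_n) x y = y.
    by apply/rowP => j; rewrite mxE mem_index_enum.
  by rewrite !mixT.
elim: s => [_|i s IH /= /andP[ins us]].
  have mix0 x y : mix [::] x y = x by apply/rowP => j; rewrite mxE.
  by rewrite !mix0 subrr normr0 big_nil mulr0.
have mixS x y : mix (i :: s) x y = upd (mix s x y) i (y ord0 i).
  by apply/rowP => j; rewrite !mxE inE; case: eqP => //= ->.
have mixI x y : mix s x y = upd (mix s x y) i (x ord0 i).
  by apply/rowP => j; rewrite !mxE; case: eqP => //= ->; rewrite (negbTE ins).
rewrite big_cons mulrDr.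
rewrite -(subrK (avg (mix s a a') (mix s b b')) (avg a b)) -addrA.
apply: le_trans (ler_normD _ _) _; rewrite [leRHS]addrC; apply: lerD; first exact: IH.
rewrite !mixS {1}(mixI a a') {1}(mixI b b'); apply: avg_osc1 => //.
  by move=> j; rewrite !mxE; case: ifP.
apply: subset_trans hull => z hz j; have := hz j; rewrite !mxE.
case: eqP => [->//|_]; case: ifP => _ /andP[h1 h2].
  by rewrite ge_min h1 orbT le_max h2 orbT.
by rewrite ge_min h1 le_max h2.
Qed.

Definition hk (k : nat) : E := const_mx k.+1%:R^-1.

(** The averaging cubes have [z] as their upper corner: half-open, they contain [z], and from some
    index on they stay inside the closure of any given box around [z]. *)
Definition rep z : R := limn (fun k => avg (z - hk k) z).

Lemma vlt_hk z k : vlt (z - hk k) z.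
Proof. by move=> i; rewrite !mxE ltrBlDr ltrDl invr_gt0. Qed.

Lemma hk_small a b z : box a b z -> exists N, forall k, (N <= k)%N ->
  forall i, a ord0 i <= (z - hk k) ord0 i.
Proof.
move=> zab.
have hi i : exists N, forall k, (N <= k)%N -> a ord0 i <= (z - hk k) ord0 i.
  have d0 : 0 < z ord0 i - a ord0 i by rewrite subr_gt0; have /andP[] := zab i.
  exists (Num.bound (z ord0 i - a ord0 i)^-1) => k Nk.
  rewrite !mxE lerBrDl -lerBrDr.
  rewrite invf_ple ?posrE//.
  apply: ltW; apply: lt_le_trans (archi_boundP _) _; first by rewrite invr_ge0 ltW.
  by rewrite ler_nat (leq_trans Nk).
have [N hN] := choice hi.
exists (\max_i N i)%N => k Nk i; apply: hN; apply: leq_trans Nk.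
exact: leq_bigmax.
Qed.

Lemma rep_cvg a b z : cbox a b `<=` O -> box a b z ->
  avg (z - hk k) z @[k --> \oo] --> rep z.
Proof.
move=> abO zab.
have [N hN] := hk_small zab.
have cboxk k l : (N <= k)%N -> (N <= l)%N -> cbox (vmin (z - hk k) (z - hk l)) (vmax z z) `<=` O.
  move=> Nk Nl; apply: subset_trans abO => w hw i; have := hw i.
  rewrite [_ (vmin _ _) _ _]mxE [_ (vmax _ _) _ _]mxE maxxx => /andP[h1 h2].
  have /andP[_ zb] := zab i; rewrite (le_trans h2 zb) andbT; apply: le_trans h1.
  by rewrite le_min !hN.
suff : cvgn (fun k => avg (z - hk k) z) by [].
apply: seq_cauchy_cvg => e e0.
have e1 : 0 < L * n%:R + 1 by rewrite ltr_wpDl// mulr_ge0.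
exists (maxn N (Num.bound ((L * n%:R + 1) / e))) => k Kk.
set N' := maxn _ _ in Kk *.
have NN' : (N <= N')%N by rewrite leq_maxl.
apply: le_lt_trans (avg_osc (@vlt_hk _ _) (@vlt_hk _ _) (cboxk _ _ NN' (leq_trans NN' Kk))) _.
apply: (@le_lt_trans _ _ (L * (\sum_(i < n) N'.+1%:R^-1))).
  rewrite ler_wpM2l//; apply: ler_sum => i _; rewrite maxxx !mxE.
  rewrite lerBlDr -lerBlDl le_min lexx/= lerD2l lerN2.
  by rewrite lef_pV2 ?posrE// ler_nat ltnS.
rewrite sumr_const card_ord -[X in L * X]mulr_natl mulrA ltr_pdivrMr//.
apply: (@lt_trans _ _ (L * n%:R + 1)); first by rewrite ltrDl.
rewrite -ltr_pdivrMl// mulrC.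
apply: lt_le_trans (archi_boundP _) _; first by rewrite divr_ge0 ?ltW.
by rewrite ler_nat /N' (leq_trans (leq_maxr N _)).
Qed.

Lemma avg_le a b : vlt a b -> `|avg a b| <= M.
Proof.
move=> ab; rewrite /avg normrM normfV (gtr0_norm (vol_gt0 ab)).
by rewrite ler_pdivrMr ?vol_gt0//; exact: boxint_le.
Qed.

Lemma cvg_near_le (u : nat -> R) (l c : R) N : u k @[k --> \oo] --> l ->
  (forall k, (N <= k)%N -> u k <= c) -> l <= c.
Proof.
move=> ul h; apply: (@cvg_le_cst _ (fun k => u (k + N)%N)).
  by rewrite (cvg_shiftn N u).
by move=> k; apply: h; rewrite leq_addl.
Qed.

Lemma rep_le a b z : cbox a b `<=` O -> box a b z -> `|rep z| <= M.
Proof.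
move=> abO zab; apply: (cvg_le_cst (cvg_norm (rep_cvg abO zab))) => k.
exact: avg_le (@vlt_hk _ _).
Qed.

Lemma rep_avg a b z : vlt a b -> cbox a b `<=` O -> box a b z ->
  `|avg a b - rep z| <= L * \sum_i (b ord0 i - a ord0 i).
Proof.
move=> ab abO zab; have [N hN] := hk_small zab.
have c : avg a b - avg (z - hk k) z @[k --> \oo] --> avg a b - rep z.
  by apply: cvgB; [exact: cvg_cst|exact: rep_cvg zab].
apply: (cvg_near_le (N := N) (cvg_norm c)) => k Nk.
have E1 : vmin a (z - hk k) = a.
  by apply/rowP => i; rewrite mxE min_l// hN.
have E2 : vmax b z = b.
  by apply/rowP => i; rewrite mxE max_l//; have /andP[] := zab i.
have := @avg_osc a b (z - hk k) z ab (@vlt_hk _ _); rewrite E1 E2 => /(_ abO).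
move=> h; apply: le_trans h _; rewrite ler_wpM2l//; apply: ler_sum => i _.
by rewrite max_l ?min_l ?hN//; have /andP[] := zab i.
Qed.

Lemma rep_lip a b z w : cbox a b `<=` O -> box a b z -> box a b w ->
  `|rep z - rep w| <= L * \sum_i `|z ord0 i - w ord0 i|.
Proof.
move=> abO zab wab; have [N hN] := hk_small zab; have [N' hN'] := hk_small wab.
have c : avg (z - hk k) z - avg (w - hk k) w - (L * n%:R) * k.+1%:R^-1 @[k --> \oo]
    --> rep z - rep w - (L * n%:R) * 0.
  apply: cvgB; first by apply: cvgB; [exact: rep_cvg zab|exact: rep_cvg wab].
  by apply: cvgM; [exact: cvg_cst|exact: cvg_harmonic].
have c' : avg (w - hk k) w - avg (z - hk k) z - (L * n%:R) * k.+1%:R^-1 @[k --> \oo]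
    --> rep w - rep z - (L * n%:R) * 0.
  apply: cvgB; first by apply: cvgB; [exact: rep_cvg wab|exact: rep_cvg zab].
  by apply: cvgM; [exact: cvg_cst|exact: cvg_harmonic].
(* The common hull of the two cubes exceeds the coordinate distances of [z] and [w] by the side
   [1/(k+1)] in each direction, which disappears in the limit. *)
have key k : (maxn N N' <= k)%N -> `|avg (z - hk k) z - avg (w - hk k) w| <=
    L * \sum_i `|z ord0 i - w ord0 i| + (L * n%:R) * k.+1%:R^-1.
  rewrite geq_max => /andP[Nk Nk'].
  have sub : cbox (vmin (z - hk k) (w - hk k)) (vmax z w) `<=` O.
    apply: subset_trans abO => y hy i; have := hy i; rewrite [_ (vmin _ _) _ _]mxE [_ (vmax _ _) _ _]mxE.
    move=> /andP[h1 h2]; apply/andP; split.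
      by apply: le_trans h1; rewrite le_min hN// hN'.
    by apply: (le_trans h2); rewrite ge_max; have /andP[_ ->] := zab i; have /andP[_ ->] := wab i.
  apply: le_trans (avg_osc (@vlt_hk _ _) (@vlt_hk _ _) sub) _.
  rewrite -mulrA -mulrDr ler_wpM2l//.
  rewrite mulr_natl -[X in _ + _ *+ X](card_ord n) -sumr_const -big_split/=.
  apply: ler_sum => i _; rewrite !mxE.
  have k0 : 0 < k.+1%:R^-1 :> R by rewrite invr_gt0.
  move: (k.+1%:R^-1) k0 => d d0.
  have := ler_norm (z ord0 i - w ord0 i); have := ler_norm (w ord0 i - z ord0 i).
  by rewrite (distrC (w ord0 i)) maxEle minEle; case: ifP => h1; case: ifP => h2; lra.
rewrite ler_norml; apply/andP; split.
  rewrite lerNl opprB -[leLHS]subr0 -[X in _ - X](mulr0 (L * n%:R)).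
  apply: (cvg_near_le (N := maxn N N') c') => k Nk.
  by have := key k Nk; rewrite distrC ler_norml => /andP[_ h]; rewrite lerBlDr.
rewrite -[leLHS]subr0 -[X in _ - X](mulr0 (L * n%:R)).
apply: (cvg_near_le (N := maxn N N') c) => k Nk.
by have := key k Nk; rewrite ler_norml => /andP[_ h]; rewrite lerBlDr.
Qed.

Lemma rep_near z : O z -> exists a b, [/\ vlt a b, cbox a b `<=` O &
  forall w, (forall i, `|z ord0 i - w ord0 i| < (b ord0 i - a ord0 i) / 2) -> box a b w].
Proof.
move=> Oz; have /nbhs_rVP[e e0 he] : nbhs z O by exact: open_nbhs_nbhs.
exists (\row_i (z ord0 i - e / 2)), (\row_i (z ord0 i + e / 2)); split.
- by move=> i; rewrite !mxE; lra.
- move=> w hw; apply: he => i; have := hw i; rewrite !mxE => /andP[h1 h2].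
  by rewrite ltr_norml; apply/andP; split; lra.
- move=> w hw i; have := hw i; rewrite !mxE ltr_norml => /andP[h1 h2].
  by apply/andP; split; lra.
Qed.

Lemma rep_continuous z : O z -> {for z, continuous rep}.
Proof.
move=> Oz; have [a [b [ab abO hb]]] := rep_near Oz.
have zab : box a b z.
  by apply: hb => i; rewrite subrr normr0 divr_gt0// subr_gt0.
have [d d0 hd] : exists2 d, 0 < d & forall w, enorm (z - w) < d -> box a b w.
  have /nbhs_eballP[d d0 hd] : nbhs z (box a b).
    apply/nbhs_rVP.
    have [d d0 hd] : exists2 d : R, 0 < d & forall i, d <= (b ord0 i - a ord0 i) / 2.
      exists (\big[Num.min/1]_i ((b ord0 i - a ord0 i) / 2)).
        by apply: lt_bigmin => // i _; rewrite divr_gt0// subr_gt0.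
      by move=> i; apply: bigmin_le_cond.
    by exists d => // w hw; apply: hb => i; exact: lt_le_trans (hw i) (hd i).
  by exists d => // w hw; apply: hd; rewrite /eball /= enormB.
apply: (enorm_continuous_gen (K := L * n%:R) d0) => w hw.
apply: le_trans (rep_lip abO zab (hd _ hw)) _.
rewrite -mulrA ler_wpM2l// mulr_natl -[X in _ <= _ *+ X](card_ord n) -sumr_const.
by apply: ler_sum => i _; have := ler_coord_enorm (z - w) i; rewrite !mxE.
Qed.

Definition repO : E -> R := rep \_ O.

Lemma repO_bdd : bdd M repO.
Proof.
have mO := open_measurable_rV oO; split.
  apply: (iffLR (measurable_restrictT _ mO)); apply: continuous_measurable_rV => //.
  exact: rep_continuous.
move=> z; have [Oz|Oz] := pselect (O z); last first.
  by rewrite /repO patchR_notin// normr0 (le_trans _ (UM.2 0)).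
have [a [b [ab abO hb]]] := rep_near Oz.
rewrite /repO patchR_in//; apply: rep_le abO _; apply: hb => i.
by rewrite subrr normr0 divr_gt0// subr_gt0.
Qed.

Let V z := U z - repO z.

Lemma V_bdd : bdd (M + M) V.
Proof.
have h := repO_bdd; split; first by apply: measurable_funB; [exact: UM.1|exact: h.1].
by move=> z; apply: le_trans (ler_normB _ _) _; apply: lerD; [exact: UM.2|exact: h.2].
Qed.

Lemma boxint_diff_le a b : vlt a b -> cbox a b `<=` O ->
  `|boxint V a b| <= vol a b * \sum_i (L * (b ord0 i - a ord0 i)).
Proof.
move=> ab abO; rewrite -mulr_sumr; have [r hr] := bfun_indic a b.
set c := L * _.
have bU := bfunM UM hr; have bR := bfunM repO_bdd hr.
have JU : boxint U a b = avg a b * vol a b by rewrite /avg divfK// gt_eqF// vol_gt0.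
have -> : boxint V a b = integ (fun z => (avg a b - repO z) * \1_(box a b) z).
  rewrite [RHS](_ : _ = integ (fun z => avg a b * \1_(box a b) z - repO z * \1_(box a b) z)).
    rewrite (integB (bfunZ _ hr) bR) (integZ _ hr) (integ_indic ab) -JU.
    rewrite -(integB bU bR); congr integ; apply/funext => z; exact: mulrBl.
  by congr integ; apply/funext => z; exact: mulrBl.
have ba : bdd (`|avg a b| + M) (fun z => avg a b - repO z).
  split; first by apply: measurable_funB => //; exact: repO_bdd.1.
  by move=> z; apply: le_trans (ler_normB _ _) _; rewrite lerD2l repO_bdd.2.
have bf := bfunM ba hr.
apply: le_trans (normr_integ bf) _; rewrite mulrC -integ_indic// -(integZ _ hr).
apply: le_integ (bfun_norm bf) (bfunZ _ hr) _ => z.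
have [zab|zab] := pselect (box a b z); last by rewrite indicE memNset// !mulr0 normr0.
rewrite indicE mem_set// !mulr1 /repO patchR_in; first exact: rep_avg.
by apply: abO; exact: box_cbox.
Qed.

Lemma boxint_split f N a b i (c : R) : bdd N f -> a ord0 i < c -> c < b ord0 i ->
  boxint f a b = boxint f a (upd b i c) + boxint f (upd a i c) b.
Proof.
move=> fN ac cb; have [r hr] := bfun_indic a (upd b i c).
have [s hs] := bfun_indic (upd a i c) b.
rewrite -(integD (bfunM fN hr) (bfunM fN hs)); congr integ; apply/funext => z.
rewrite -mulrDr; congr (_ * _); rewrite !indicE.
have [h1|h1] := pselect (box a (upd b i c) z).
  have h2 : ~ box (upd a i c) b z.
    move=> /(_ i); have := h1 i; rewrite !updE eqxx => /andP[_ h2] /andP[h3 _].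
    by move: h3; rewrite ltNge h2.
  rewrite (mem_set h1) (memNset h2) addr0 mem_set// => j; have := h1 j; rewrite updE.
  by case: eqP => [->/andP[-> /le_trans->]//|//]; exact: ltW.
rewrite (memNset h1) add0r; congr (_%:R); congr nat_of_bool.
apply/idP/idP; rewrite !inE => h.
  move=> j; have := h j; rewrite updE; case: eqP => // -> /andP[h2 h3].
  rewrite h3 andbT ltNge; apply/negP => zc; apply: h1 => k; rewrite updE.
  by case: eqP => [->|_]; [rewrite h2|exact: h].
by move=> j; have := h j; rewrite updE; case: eqP => // -> /andP[/(lt_trans ac) -> ->].
Qed.

(* Cutting a box in two in direction [i] preserves a bound of the form volume times sides, and
   halves the side; iterating in all directions makes the difference negligible. *)
Lemma boxint_diff_halve (c : 'I_n -> R) i : (forall a b, vlt a b -> cbox a b `<=` O ->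
    `|boxint V a b| <= vol a b * \sum_j (c j * (b ord0 j - a ord0 j))) ->
  forall a b, vlt a b -> cbox a b `<=` O ->
    `|boxint V a b| <= vol a b * \sum_j ((if j == i then c j / 2 else c j) * (b ord0 j - a ord0 j)).
Proof.
move=> hc a b ab abO; pose m := (a ord0 i + b ord0 i) / 2.
have am : a ord0 i < m by have := ab i; rewrite /m; lra.
have mb : m < b ord0 i by have := ab i; rewrite /m; lra.
rewrite (boxint_split V_bdd am mb); apply: le_trans (ler_normD _ _) _.
have updid (x : E) : upd x i (x ord0 i) = x by apply/rowP => j; rewrite updE; case: eqP => [->|].
have volE : vol a b = (b ord0 i - a ord0 i) * \prod_(j | j != i) (b ord0 j - a ord0 j).
  by rewrite -[in LHS](updid a) -[in LHS](updid b) vol_upd.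
have v1 : vol a (upd b i m) = vol a b / 2.
  by rewrite -[in LHS](updid a) vol_upd volE /m; field.
have v2 : vol (upd a i m) b = vol a b / 2.
  by rewrite -[in LHS](updid b) vol_upd volE /m; field.
have h1 : `|boxint V a (upd b i m)| <= vol a (upd b i m) * \sum_j (c j * ((upd b i m) ord0 j - a ord0 j)).
  apply: hc.
    by move=> j; rewrite updE; case: eqP => [->|_]; [exact: am|exact: ab].
  apply: subset_trans abO => z hz j; have := hz j; rewrite updE.
  by case: eqP => // -> /andP[-> /le_trans->]//; exact: ltW.
have h2 : `|boxint V (upd a i m) b| <= vol (upd a i m) b * \sum_j (c j * (b ord0 j - (upd a i m) ord0 j)).
  apply: hc.
    by move=> j; rewrite updE; case: eqP => [->|_]; [exact: mb|exact: ab].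
  apply: subset_trans abO => z hz j; have := hz j; rewrite updE.
  by case: eqP => // -> /andP[/(le_trans (ltW am)) -> ->].
have s1 : \sum_j (c j * ((upd b i m) ord0 j - a ord0 j)) =
    \sum_j ((if j == i then c j / 2 else c j) * (b ord0 j - a ord0 j)).
  by apply: eq_bigr => j _; rewrite updE; case: eqP => // ->; rewrite /m; field.
have s2 : \sum_j (c j * (b ord0 j - (upd a i m) ord0 j)) =
    \sum_j ((if j == i then c j / 2 else c j) * (b ord0 j - a ord0 j)).
  by apply: eq_bigr => j _; rewrite updE; case: eqP => // ->; rewrite /m; field.
rewrite v1 s1 in h1; rewrite v2 s2 in h2.
apply: le_trans (lerD h1 h2) _; rewrite -mulrDl.
by rewrite (_ : vol a b / 2 + vol a b / 2 = vol a b)//; field.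
Qed.

Lemma boxint_diff_eq0 a b : vlt a b -> cbox a b `<=` O -> boxint V a b = 0.
Proof.
have half (c : R) (s : seq 'I_n) : uniq s -> (forall a b, vlt a b -> cbox a b `<=` O ->
    `|boxint V a b| <= vol a b * \sum_j (c * (b ord0 j - a ord0 j))) ->
  forall a b, vlt a b -> cbox a b `<=` O ->
    `|boxint V a b| <= vol a b * \sum_j ((if j \in s then c / 2 else c) * (b ord0 j - a ord0 j)).
  elim: s => [_ h//|i s IH /= /andP[ins us] h a' b' ab abO].
  have := boxint_diff_halve i (IH us h) ab abO; congr (_ <= _ * _).
  apply: eq_bigr => j _; congr (_ * _); rewrite inE.
  by case: eqP => //= ->; rewrite (negbTE ins).
have all m a' b' : vlt a' b' -> cbox a' b' `<=` O ->
    `|boxint V a' b'| <= vol a' b' * \sum_j (L / 2 ^+ m * (b' ord0 j - a' ord0 j)).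
  elim: m a' b' => [|m IH] a' b' ab abO; first by rewrite expr0 divr1; exact: boxint_diff_le.
  have := half _ _ (index_enum_uniq _) IH a' b' ab abO; congr (_ <= _ * _).
  by apply: eq_bigr => j _; rewrite mem_index_enum exprSr invfM mulrA.
move=> ab abO; apply/eqP; rewrite -normr_le0.
set S := vol a b * \sum_j (L * (b ord0 j - a ord0 j)).
apply: (@cvg_le_cst _ (fun m => `|boxint V a b| - S * 2^-1 ^+ m)).
  rewrite -[X in _ --> X]subr0 -[X in _ - X](mulr0 S); apply: cvgB; first exact: cvg_cst.
  apply: cvgM; first exact: cvg_cst.
  by apply: cvg_expr; rewrite ger0_norm ?invr_ge0// invf_lt1// ltr1n.
move=> m; rewrite subr_le0; apply: le_trans (all m a b ab abO) _.
rewrite /S -!mulr_sumr exprVn; set X := \sum_i _.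
by rewrite le_eqVlt; apply/orP; left; apply/eqP; ring.
Qed.

Lemma rep_ae : {ae leb, forall z, O z -> U z = repO z}.
Proof.
have key a b : cbox a b `<=` O -> {ae leb, forall z, box a b z -> V z = 0}.
  move=> abO; have [r hr] := bfun_indic a b.
  apply: box_integral0_ae.
    apply: measurable_bounded_integrable.
    - exact: measurable_box.
    - exact: leb_box_fin.
    - by apply: measurable_funTS; exact: V_bdd.1.
    - exists (M + M); split; first exact: num_real.
      by move=> x Mx z _ /=; apply: le_trans (V_bdd.2 z) (ltW Mx).
  move=> a' b' sub.
  have mb := @measurable_box R n a' b'.
  have [/forallP lt|] := boolP [forall i, a' ord0 i < b' ord0 i].
    have := boxint_diff_eq0 lt (subset_trans (sub_box_cbox lt sub) abO).
    have [r' hr'] := bfun_indic a' b'.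
    have := bfun_EFin (bfunM V_bdd hr'); rewrite -/(boxint V a' b') => E1 E2.
    rewrite E2 in E1; rewrite -[RHS]E1 integral_mkcond; congr integral.
    apply/funext => z; rewrite patchE indicE.
    by case: (_ \in _) => /=; rewrite ?mulr1 ?mulr0.
  rewrite negb_forall => /existsP[i]; rewrite -leNgt => ba.
  rewrite (_ : box a' b' = set0) ?integral_set0//.
  apply/seteqP; split => // z /(_ i) /andP[h1 h2].
  by have := lt_le_trans h1 h2; rewrite ltNge ba.
have [F [D [h1 h2]]] := open_boxes oO.
have : {ae leb, forall z, forall k, D k -> box (F k).1 (F k).2 z -> V z = 0}.
  apply: ae_foralln => k; have [Dk|Dk] := pselect (D k); last by apply: aeW.
  by apply: filterS (key _ _ (h1 _ Dk)) => z h _.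
apply: filterS => z h Oz; have [k Dk hk] := h2 _ Oz.
by apply/eqP; rewrite -subr_eq0 -/(V z) (h k).
Qed.

End lipschitz_representative.

(** * Lipschitz extension from quasiconvex open sets *)

Section lipschitz_extension.
Context {R : realType} {n : nat}.
Local Notation E := 'rV[R]_n.
Implicit Types (O A : set E) (z w p q : E).

(** Clipping [u] and its weak gradient at their essential bounds alters them on null sets only,
    hence no integral, and turns almost everywhere bounds into bounds everywhere. *)
Lemma W1p_oo_rep O u : open O -> W1p +oo%E O u -> exists M L W,
  [/\ (W1p_norm +oo%E O u = (M + L)%:E)%E /\ 0 <= M, 0 <= L, bdd M W,
      ae_eq_on O u W &
      forall a b, cbox a b `<=` O -> forall z w, box a b z -> box a b w ->
        `|W z - W w| <= L * \sum_i `|z ord0 i - w ord0 i|].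
Proof.
move=> oO /W1p_oo_data[M [L [NE M0 L0 uM [g [lu lg hg] gL]]]].
have mO := open_measurable_rV oO.
pose U z := clip M ((u \_ O) z).
have mU : measurable_fun setT (u \_ O).
  by apply: (iffLR (measurable_restrictT _ mO)); exact: lu.1.
have UM : bdd M U by split; [exact: measurable_clip|move=> z; exact: clip_le].
have uU : {ae leb, forall z, O z -> u z = U z}.
  by apply: filterS uM => z h Oz; rewrite /U patchR_in// clip_id// h.
have weakU i phi : test_function O phi ->
    `|integ (fun z => U z * partial i phi z)| <= L * integ (fun z => `|phi z|).
  move=> tphi; have [P [r [b1 b2 p0]]] := test_bfun tphi.
  pose G z := clip L (((fun z => g z ord0 i) \_ O) z).
  have mG : measurable_fun setT ((fun z => g z ord0 i) \_ O).
    by apply: (iffLR (measurable_restrictT _ mO)); exact: (lg i).1.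
  have GL : bdd L G by split; [exact: measurable_clip|move=> z; exact: clip_le].
  have gG : {ae leb, forall z, O z -> g z ord0 i = G z}.
    by apply: filterS gL => z h Oz; rewrite /G patchR_in// clip_id// h.
  have := hg i phi tphi.
  have mphi D : measurable_fun D phi by apply: measurable_funTS; exact: b1.1.1.
  have mdphi D : measurable_fun D (partial i phi) by apply: measurable_funTS; exact: (b2 i).1.1.
  have -> : (\int[leb]_(z in O) (u z * partial i phi z)%:E =
      \int[leb]_(z in O) (U z * partial i phi z)%:E)%E.
    apply: ae_eq_integral => //.
    - by apply/measurable_EFinP/measurable_funM => //; exact: lu.1.
    - by apply/measurable_EFinP/measurable_funM => //; apply: measurable_funTS; exact: UM.1.
    - by apply: filterS uU => z h Oz; rewrite h.
  have -> : (\int[leb]_(z in O) (g z ord0 i * phi z)%:E =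
      \int[leb]_(z in O) (G z * phi z)%:E)%E.
    apply: ae_eq_integral => //.
    - by apply/measurable_EFinP/measurable_funM => //; exact: (lg i).1.
    - by apply/measurable_EFinP/measurable_funM => //; apply: measurable_funTS; exact: GL.1.
    - by apply: filterS gG => z h Oz; rewrite h.
  rewrite (integral_support mO); last by move=> z /p0[_ ->]; rewrite mulr0.
  rewrite (integral_support mO); last by move=> z /p0[-> _]; rewrite mulr0.
  rewrite (bfun_EFin (bfunM UM (b2 i))) (bfun_EFin (bfunM GL b1)) -EFinN => -[->].
  rewrite normrN; have bf := bfunM GL b1.
  apply: le_trans (normr_integ bf) _; rewrite -(integZ _ (bfun_norm b1)).
  apply: le_integ (bfun_norm bf) (bfunZ _ (bfun_norm b1)) _ => z.
  by rewrite normrM ler_wpM2r// GL.2.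
exists M, L, (repO O U); split => //.
- exact: repO_bdd L0 weakU.
- apply: filterS2 uU (rep_ae oO UM L0 weakU) => z h1 h2 Oz.
  by rewrite h1// h2.
- move=> a b abO z w za wa.
  have Oz := abO _ (box_cbox za); have Ow := abO _ (box_cbox wa).
  by rewrite /repO (patchR_in _ Oz) (patchR_in _ Ow); exact: (rep_lip UM L0 weakU abO za wa).
Qed.

(** Induction along the interval: the supremum of the times up to which the bound holds satisfies
    the bound itself, and if it were less than 1 the local hypothesis there would carry the bound
    further. No uniform [d] is needed. *)
Lemma local_lip_itv (f : R -> R) (K : R) : 0 <= K ->
  (forall t, 0 <= t <= 1 -> exists2 d, 0 < d &
     forall s, 0 <= s <= 1 -> `|s - t| < d -> `|f s - f t| <= K * `|s - t|) ->
  `|f 1 - f 0| <= K.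
Proof.
move=> K0 h.
pose S := [set t : R | 0 <= t <= 1 /\ forall s, 0 <= s <= t -> `|f s - f 0| <= K * s].
have S0 : S 0.
  split; first by rewrite lexx ler01.
  move=> s /andP[s0 s1]; have -> : s = 0 by apply/eqP; rewrite eq_le s0 s1.
  by rewrite subrr normr0 mulr0.
have supS : has_sup S.
  by split; [exists 0|exists 1 => t [/andP[_ ->]]].
pose t := sup S.
have t0 : 0 <= t by apply: ub_le_sup => //; exact: supS.2.
have t1 : t <= 1 by apply: ge_sup => [|s [/andP[_ ->]]//]; exists 0.
have [d d0 hd] : exists2 d, 0 < d &
     forall s, 0 <= s <= 1 -> `|s - t| < d -> `|f s - f t| <= K * `|s - t|.
  by apply: h; rewrite t0 t1.
have [s [s01 hs] sd] := sup_adherent d0 supS.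
have st : s <= t by apply: ub_le_sup; [exact: supS.2|split].
have /andP[s0 s1] := s01.
have ft : `|f t - f 0| <= K * t.
  have := hd s s01; rewrite ler0_norm ?subr_le0// => /(_ _)h1.
  have {}h1 : `|f s - f t| <= K * - (s - t) by apply: h1; rewrite /t; lra.
  have h2 : `|f s - f 0| <= K * s by apply: hs; rewrite s0 lexx.
  have := ler_distD (f s) (f t) (f 0).
  by rewrite (distrC (f t) (f s)); nra.
have Sall r : 0 <= r < t -> `|f r - f 0| <= K * r.
  move=> /andP[r0 rt]; have tr : 0 < t - r by rewrite subr_gt0.
  have [s' [_ hs'] sr] := sup_adherent tr supS.
  by apply: hs'; rewrite r0/=; move: sr; rewrite opprB addrCA subrr addr0 => /ltW.
have [t1'|h1] := ltP t 1; last first.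
  have t1E : t = 1 by apply/eqP; rewrite eq_le t1 h1.
  by move: ft; rewrite t1E mulr1.
exfalso; pose r := Num.min 1 (t + d / 2).
have tr : t < r by rewrite lt_min t1' ltrDl divr_gt0.
suff : r <= t by rewrite leNgt tr.
apply: ub_le_sup; first exact: supS.2.
split; first by rewrite (le_trans t0 (ltW tr))/= ge_min lexx.
move=> x /andP[x0 xr].
have [xt|xt|->] := ltgtP x t; [by apply: Sall; rewrite x0 xt| |exact: ft].
have x1 : x <= 1 by apply: (le_trans xr); rewrite ge_min lexx.
have xd : x <= t + d / 2 by apply: (le_trans xr); rewrite ge_min lexx orbT.
have := hd x; rewrite x0 x1 gtr0_norm ?subr_gt0// => /(_ isT) h1.
have {}h1 : `|f x - f t| <= K * (x - t) by apply: h1; lra.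
have := ler_distD (f t) (f x) (f 0); nra.
Qed.

Definition seg z w (t : R) : E := z + t *: (w - z).

Definition seg_in O z w := forall t, 0 <= t <= 1 -> O (seg z w t).

Lemma seg0 z w : seg z w 0 = z.
Proof. by rewrite /seg scale0r addr0. Qed.

Lemma seg1 z w : seg z w 1 = w.
Proof. by rewrite /seg scale1r addrC subrK. Qed.

Lemma segB z w s t : seg z w s - seg z w t = (s - t) *: (w - z).
Proof. by rewrite /seg opprD addrACA subrr add0r -scalerBl. Qed.

Lemma near_box O z : open O -> O z -> exists a b (d : R),
  [/\ 0 < d, cbox a b `<=` O & forall w, enorm (z - w) < d -> box a b w].
Proof.
move=> oO Oz; have /nbhs_rVP[e e0 he] : nbhs z O by exact: open_nbhs_nbhs.
exists (\row_i (z ord0 i - e / 2)), (\row_i (z ord0 i + e / 2)), (e / 2); split.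
- exact: divr_gt0.
- move=> w hw; apply: he => i; have := hw i; rewrite !mxE => /andP[h1 h2].
  by rewrite ltr_norml; apply/andP; split; lra.
- move=> w hw i; have := ler_coord_enorm (z - w) i.
  rewrite !mxE => /le_lt_trans /(_ hw); rewrite ltr_norml => /andP[h1 h2].
  by apply/andP; split; lra.
Qed.

Lemma sum_abs_le (z : E) : \sum_i `|z ord0 i| <= n%:R * enorm z.
Proof.
rewrite mulr_natl -[X in _ <= _ *+ X](card_ord n) -sumr_const.
by apply: ler_sum => i _; exact: ler_coord_enorm.
Qed.

Lemma seg_lip O (W : E -> R) L z w : open O -> 0 <= L -> 
  (forall a b, cbox a b `<=` O -> forall z w, box a b z -> box a b w ->
    `|W z - W w| <= L * \sum_i `|z ord0 i - w ord0 i|) ->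
  seg_in O z w -> `|W z - W w| <= L * n%:R * enorm (z - w).
Proof.
move=> oO L0 hW zw.
have := @local_lip_itv (fun t => W (seg z w t)) (L * n%:R * enorm (z - w)).
rewrite seg0 seg1 distrC; apply; first by rewrite !mulr_ge0// enorm_ge0.
move=> t /zw Ot; have [a [b [d [d0 abO hb]]]] := near_box oO Ot.
have n0 : 0 < enorm (w - z) + 1 by rewrite ltr_wpDl// enorm_ge0.
exists (d / (enorm (w - z) + 1)); first exact: divr_gt0.
move=> s _ std.
have dst : enorm (seg z w s - seg z w t) = `|s - t| * enorm (w - z) by rewrite segB enormZ.
have lt_d : enorm (seg z w t - seg z w s) < d.
  rewrite enormB dst; move: std; rewrite ltr_pdivlMr// => std; apply: le_lt_trans std.
  by rewrite ler_wpM2l// lerDl.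
apply: le_trans (hW a b abO _ _ (hb _ lt_d) (hb _ _)) _; first by rewrite subrr enorm0.
rewrite -!mulrA ler_wpM2l//.
have := sum_abs_le (seg z w s - seg z w t); rewrite dst (enormB z) (mulrC `|_|).
by under eq_bigr => i _ do rewrite [_ (_ - _) _ _]mxE [_ (- _) _ _]mxE.
Qed.

(* [K]-quasiconvexity, with polygonal paths of three edges, at scales below [d]. *)
Definition lqc O (K d : R) := forall z w, O z -> O w -> enorm (z - w) < d ->
  exists p q, [/\ seg_in O z p, seg_in O p q, seg_in O q w &
    enorm (z - p) + enorm (p - q) + enorm (q - w) <= K * enorm (z - w)].

Lemma clip_lip (M x y : R) : 0 <= M -> `|clip M x - clip M y| <= `|x - y|.
Proof.
move=> M0; rewrite /clip !maxEle !minEle.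
have := ler_norm (x - y); have := ler_norm (y - x); rewrite (distrC y).
rewrite ler_norml; do 4?case: ifPn => //; rewrite -?ltNge => *; apply/andP; split; lra.
Qed.

(** The infimum over [A] of the cones [f w + K * enorm (z - w)]; clipping it at [M] preserves both
    the Lipschitz constant and the values on [A]. *)
Lemma mcshane A (f : E -> R) (K M : R) : 0 <= K -> 0 <= M ->
  (forall z w, A z -> A w -> `|f z - f w| <= K * enorm (z - w)) ->
  (forall z, A z -> `|f z| <= M) ->
  exists V, [/\ elip K V, bdd M V & forall z, A z -> V z = f z].
Proof.
move=> K0 M0 fK fM.
have [[z0 A0]|A0] := pselect (A !=set0); last first.
  exists (fun=> 0); split.
  - by move=> z w; rewrite subrr normr0 mulr_ge0// enorm_ge0.
  - by split=> [|z]; [exact: measurable_cst|rewrite normr0].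
  - by move=> z Az; exfalso; apply: A0; exists z.
pose S z := [set f w + K * enorm (z - w) | w in A].
have Slb z w : A w -> lbound (S z) (f w - K * enorm (z - w)).
  move=> Aw _ [y Ay <-]; have := fK w y Aw Ay; have := enorm_triangle w z y.
  rewrite ler_norml (enormB w z) => h1 /andP[_ h2]; nra.
have Sinf z : has_inf (S z).
  by split; [exists (f z0 + K * enorm (z - z0)), z0|exists (f z0 - K * enorm (z - z0)); exact: Slb].
pose g z := inf (S z).
have gle z w : g z <= g w + K * enorm (z - w).
  rewrite -lerBlDr; apply: lb_le_inf; first exact: (Sinf w).1.
  move=> _ [y Ay <-]; rewrite lerBlDr.
  apply: (@le_trans _ _ (f y + K * enorm (z - y))).
    by apply: ge_inf; [exact: (Sinf z).2|exists y].
  by have := enorm_triangle z w y; nra.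
have gK : elip K g.
  move=> z w; rewrite ler_norml; apply/andP; split; last by rewrite lerBlDl; have := gle z w; lra.
  by have := gle w z; rewrite enormB; lra.
have VK : elip K (fun z => clip M (g z)).
  by move=> z w; apply: le_trans (clip_lip _ _ M0) _; exact: gK.
exists (fun z => clip M (g z)); split => //.
- split; last by move=> z; exact: clip_le.
  exact: continuous_measurableT_rV (elip_continuous VK).
- move=> z Az; rewrite (_ : g z = f z) ?clip_id ?fM//.
  apply/eqP; rewrite eq_le; apply/andP; split.
    by apply: ge_inf; [exact: (Sinf z).2|exists z => //; rewrite subrr enorm0 mulr0 addr0].
  have := Slb z z Az; rewrite subrr enorm0 mulr0 subr0 => h.
  by apply: lb_le_inf => //; exact: (Sinf z).1.
Qed.

Lemma lqc_extend O (K d : R) : open O -> 0 <= K -> 0 < d -> lqc O K d ->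
  exists2 C : R, 0 <= C & forall u, W1p +oo%E O u -> exists M L V,
    [/\ (W1p_norm +oo%E O u = (M + L)%:E)%E, 0 <= M /\ 0 <= L,
        elip (C * (M + L)) V, bdd M V & ae_eq_on O u V].
Proof.
(* The first summand serves the pairs at distance less than [d], joined by a path of three segments;
   for the others the difference is at most [2 * M], hence at most [2 / d * M] times the
   distance. *)
move=> oO K0 d0 qO; pose C : R := n%:R * K + 2 / d.
have C0 : 0 <= C by apply: addr_ge0; [exact: mulr_ge0|apply: divr_ge0 => //; exact: ltW].
exists C => // u /(W1p_oo_rep oO)[M [L [W [[NE M0] L0 WM uW hW]]]].
have WK z w : O z -> O w -> `|W z - W w| <= C * (M + L) * enorm (z - w).
  move=> Oz Ow; have e0 := enorm_ge0 (z - w).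
  have [zw|zw] := ltP (enorm (z - w)) d.
    have [p [q [h1 h2 h3 len]]] := qO z w Oz Ow zw.
    have := seg_lip oO L0 hW h1; have := seg_lip oO L0 hW h2; have := seg_lip oO L0 hW h3.
    have := ler_distD (W p) (W z) (W w); have := ler_distD (W q) (W p) (W w).
    have nL : 0 <= L * n%:R by rewrite mulr_ge0.
    set e := enorm (z - w) in e0 len *; move=> i1 i2 i3 i4 i5.
    apply: (@le_trans _ _ (L * n%:R * (K * e))); first nra.
    rewrite (_ : L * n%:R * (K * e) = (n%:R * K) * L * e); last ring.
    rewrite ler_wpM2r// ler_pM ?mulr_ge0//; last by rewrite lerDr.
    by rewrite /C lerDl divr_ge0 ?ltW.
  apply: (@le_trans _ _ (M + M)).
    by apply: le_trans (ler_normB _ _) _; apply: lerD; exact: WM.2.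
  apply: (@le_trans _ _ (2 / d * M * d)).
    by rewrite (_ : 2 / d * M * d = M + M)//; field; rewrite gt_eqF.
  have d2 : 0 <= 2 / d by apply: divr_ge0 => //; exact: ltW.
  apply: ler_pM zw; [exact: mulr_ge0|exact: ltW|].
  apply: ler_pM => //; last by rewrite lerDl.
  by rewrite /C lerDr mulr_ge0.
have [V [VK VM VW]] := @mcshane O W (C * (M + L)) M (mulr_ge0 C0 (addr_ge0 M0 L0)) M0 WK
  (fun z _ => WM.2 z).
exists M, L, V; split => //.
by apply: filterS uW => z h Oz; rewrite h// VW.
Qed.

End lipschitz_extension.

Lemma lqc_extension_domain {R : realType} (n : nat) (O : set 'rV[R]_n) (K d : R) :
  is_domain O -> 0 <= K -> 0 < d -> lqc O K d -> extension_domain +oo%E +oo%E O.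
Proof.
move=> dO K0 d0 qO; split=> //.
have [oO _ _] := dO; have [C C0 hC] := lqc_extend oO K0 d0 qO.
exists (1 + n%:R * C) => u /hC[M [L [V [NE [M0 L0] VC VM uV]]]]; exists V.
have CML : 0 <= C * (M + L) by rewrite mulr_ge0// addr_ge0.
have oC : open (~` closure O) by apply: closed_openC; exact: closed_closure.
have [V1 V2] := W1p_lip oC CML VC VM.
split=> //.
- by move=> A oA _ _; exact: (W1p_lip oA CML VC VM).1.
- by apply: filterS uV => z h Oz; rewrite h.
- apply: (le_trans V2); rewrite NE -EFinM lee_fin.
  by rewrite mulrDl mul1r lerD ?lerDl// mulrA lexx.
Qed.

(** * Real powers: tangents, convexity and Lipschitz bounds *)

Section powers.
Context {R : realType}.
Implicit Types a b s y : R.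

Lemma le_powR s a b : 0 <= s -> 0 <= a -> a <= b -> a `^ s <= b `^ s.
Proof. by move=> s0 a0 ab; apply: ge0_ler_powR; rewrite ?nnegrE// (le_trans a0). Qed.

Lemma lt_powR s a b : 0 < s -> 0 <= a -> a < b -> a `^ s < b `^ s.
Proof. by move=> s0 a0 ab; apply: gt0_ltr_powR; rewrite ?nnegrE// (le_trans a0)// ltW. Qed.

(** Young's inequality for [y] and 1 with the exponents [s] and [s / (s - 1)]. *)
Lemma powR_bernoulli s y : 1 < s -> 0 <= y -> s * (y - 1) <= y `^ s - 1.
Proof.
move=> s1 y0; have s0 : 0 < s by rewrite (lt_trans ltr01).
have q0 : 0 < 1 - s^-1 by rewrite subr_gt0 invf_lt1.
have /= := @conjugate_powR R y 1 s (1 - s^-1)^-1 y0 ler01.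
rewrite invr_gt0 q0 s0 invrK addrC subrK powR1 => /(_ isT isT erefl).
rewrite mulr1 mul1r -(ler_pM2l s0) mulrDr mulrBr !mulrA (mulrC s (y `^ s)).
rewrite mulfK ?gt_eqF// divff ?gt_eqF//; lra.
Qed.

Lemma powRS s a : 0 <= a -> 1 < s -> a * a `^ (s - 1) = a `^ s.
Proof. by move=> a0 s1; rewrite mulr_powRB1// (lt_trans ltr01). Qed.

(** Bernoulli's inequality at [b / a]. Convexity and the Lipschitz bound on [0, 1] both follow from
    these tangents, without differentiating powers. *)
Lemma powR_tangent s a b : 1 < s -> 0 <= a -> 0 <= b ->
  s * a `^ (s - 1) * (b - a) <= b `^ s - a `^ s.
Proof.
move=> s1; rewrite le_eqVlt => /predU1P[<-|a0] b0.
  rewrite !powR0 ?subr_eq0 ?gt_eqF//; last by rewrite (lt_trans ltr01).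
  by rewrite mulr0 mul0r subr0 powR_ge0.
have a0' := ltW a0.
have := powR_bernoulli s1 (divr_ge0 b0 a0').
have ap : 0 < a `^ s by exact: powR_gt0.
rewrite -(ler_pM2r ap) [X in _ <= X]mulrBl mul1r -powRM// ?divr_ge0//.
rewrite divfK ?(gt_eqF a0)//; congr (_ <= _).
by rewrite -(powRS a0' s1); field; rewrite gt_eqF.
Qed.

Lemma powR_le1 s a : 0 <= s -> 0 <= a <= 1 -> a `^ s <= 1.
Proof. by move=> s0 /andP[a0 a1]; have := le_powR s0 a0 a1; rewrite powR1. Qed.

Lemma powR_lip s a b : 1 < s -> 0 <= a <= 1 -> 0 <= b <= 1 ->
  `|a `^ s - b `^ s| <= s * `|a - b|.
Proof.
move=> s1; wlog ab : a b / b <= a.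
  move=> H a01 b01; have [/H->//|/ltW/H] := leP b a.
  by rewrite (distrC a) (distrC (a `^ s)); exact.
move=> a01 /andP[b0 b1]; have /andP[a0 a1] := a01.
have s0 : 0 <= s by rewrite ltW// (lt_trans ltr01).
rewrite !ger0_norm ?subr_ge0 ?le_powR//.
have := powR_tangent s1 a0 b0.
have : a `^ (s - 1) <= 1 by rewrite powR_le1// subr_ge0 ltW.
have sab : 0 <= s * (a - b) by rewrite mulr_ge0// subr_ge0.
set p := a `^ (s - 1) => p1 h.
have : p * (s * (a - b)) <= s * (a - b) by rewrite ler_piMl.
rewrite (_ : p * _ = - (s * p * (b - a))); [lra|ring].
Qed.

Lemma powR_convex s a b (l : R) : 1 < s -> 0 <= a -> 0 <= b -> 0 <= l <= 1 ->
  ((1 - l) * a + l * b) `^ s <= (1 - l) * a `^ s + l * b `^ s.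
Proof.
move=> s1 a0 b0 /andP[l0 l1]; set m := (1 - l) * a + l * b.
have l1' : 0 <= 1 - l by rewrite subr_ge0.
have m0 : 0 <= m by rewrite addr_ge0 ?mulr_ge0.
have := ler_wpM2l l1' (powR_tangent s1 m0 a0); have := ler_wpM2l l0 (powR_tangent s1 m0 b0).
set p := s * _; move=> h1 h2.
have : l * (p * (b - m)) + (1 - l) * (p * (a - m)) = 0 by rewrite /m; ring.
lra.
Qed.

Lemma powR_sqr s t : (t `^ s) ^+ 2 = t `^ (2 * s).
Proof. by rewrite mulrC powRrM powR_mulrn// powR_ge0. Qed.

End powers.

(** * The cusp and its exterior *)

Section cusp_geometry.
Context {R : realType} {n : nat}.
Local Notation E := 'rV[R]_n.+1.
Implicit Types (z w : E) (t l : R) (x y : 'rV[R]_n).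

Lemma tcoordD z w : tcoord (z + w) = tcoord z + tcoord w.
Proof. by rewrite /tcoord mxE. Qed.
Lemma tcoordZ l z : tcoord (l *: z) = l * tcoord z.
Proof. by rewrite /tcoord mxE. Qed.
Lemma tcoordB z w : tcoord (z - w) = tcoord z - tcoord w.
Proof. by rewrite /tcoord !mxE. Qed.
Lemma xcoordD z w : xcoord (z + w) = xcoord z + xcoord w.
Proof. by apply/rowP => j; rewrite !mxE. Qed.
Lemma xcoordZ l z : xcoord (l *: z) = l *: xcoord z.
Proof. by apply/rowP => j; rewrite !mxE. Qed.
Lemma xcoordB z w : xcoord (z - w) = xcoord z - xcoord w.
Proof. by apply/rowP => j; rewrite !mxE. Qed.

Definition ptE := (tcoordB, xcoordB, tcoordD, tcoordZ, xcoordD, xcoordZ, @tcoord_pt R n, @xcoord_pt R n).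

Lemma tcoord_seg z w l : tcoord (seg z w l) = (1 - l) * tcoord z + l * tcoord w.
Proof. by rewrite /seg !ptE; ring. Qed.

Lemma segE m (u v : 'rV[R]_m) l : seg u v l = (1 - l) *: u + l *: v.
Proof. by rewrite /seg scalerBr scalerBl scale1r addrA addrAC. Qed.

Lemma xcoord_seg z w l : xcoord (seg z w l) = (1 - l) *: xcoord z + l *: xcoord w.
Proof. by rewrite segE !ptE. Qed.

Lemma dotp_tx z w : dotp z w = tcoord z * tcoord w + dotp (xcoord z) (xcoord w).
Proof.
rewrite /dotp big_ord_recl; congr (_ + _).
by apply: eq_bigr => j _; rewrite !mxE.
Qed.

Lemma enorm_xcoord z : enorm (xcoord z) <= enorm z.
Proof.
by rewrite enorm_leP ?enorm_ge0// sqr_enorm (dotp_tx z) lerDr -expr2 sqr_ge0.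
Qed.

Lemma normr_tcoord z : `|tcoord z| <= enorm z.
Proof. exact: ler_coord_enorm. Qed.

Lemma enorm_tx z : enorm z <= `|tcoord z| + enorm (xcoord z).
Proof.
rewrite enorm_leP ?addr_ge0 ?enorm_ge0// (dotp_tx z) -sqr_enorm sqrrD real_normK ?num_real//.
by rewrite -expr2 lerD2r lerDl mulrn_wge0// mulr_ge0// enorm_ge0.
Qed.

(** The last term is the exact convexity defect of the squared norm along a segment, which the
    detour in the exterior has to outweigh. *)
Lemma dotp_seg m (u v : 'rV[R]_m) l :
  dotp ((1 - l) *: u + l *: v) ((1 - l) *: u + l *: v) =
  (1 - l) * dotp u u + l * dotp v v - l * (1 - l) * dotp (u - v) (u - v).
Proof.
rewrite !(dotpDl, dotpDr, dotpZl, dotpZr, dotpNl, dotpNr) (dotpC v u); ring.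
Qed.

Lemma eballE t z (r : R) : eball (pt t 0) (Num.sqrt r) z <->
  (tcoord z - t) ^+ 2 + dotp (xcoord z) (xcoord z) < r.
Proof.
have [r0|r0] := leP 0 r; last first.
  rewrite /eball/= ler0_sqrtr ?(ltW r0)//; split; first by rewrite ltNge enorm_ge0.
  by rewrite ltNge (le_trans (ltW r0))// addr_ge0 ?sqr_ge0// dotp_ge0.
by rewrite /eball/= enorm_ltP ?sqrtr_ge0// sqr_sqrtr// dotp_tx !ptE subr0 -expr2.
Qed.

Lemma eball_seg c (r : R) z w : eball c r z -> eball c r w -> seg_in (eball c r) z w.
Proof.
move=> zr wr l /andP[l0 l1]; rewrite /eball/= segE.
rewrite (_ : _ - c = (1 - l) *: (z - c) + l *: (w - c)); last first.
  by rewrite !scalerBr addrACA -opprD -scalerDl subrK scale1r.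
apply: le_lt_trans (enormD _ _) _; rewrite !enormZ !ger0_norm ?subr_ge0//.
move: zr wr; rewrite /eball/= => zr wr.
have [->|ln0] := eqVneq l 0; first by rewrite subr0 mul1r mul0r addr0.
have lp : 0 < l by rewrite lt_neqAle eq_sym ln0.
have := ler_wpM2l (_ : 0 <= 1 - l) (ltW zr); rewrite subr_ge0 l1 => /(_ isT).
by have := ltr_pM2l lp (enorm (w - c)) r; rewrite wr; lra.
Qed.

Variable s : R.
Hypothesis s1 : 1 < s.
Local Notation Om := (cusp_domain n s).

Let s0 : 0 < s. Proof. exact: lt_trans s1. Qed.

Lemma cusp_domainE z : Om z <->
  [/\ 0 < tcoord z, tcoord z <= 1 & enorm (xcoord z) < tcoord z `^ s] \/
  (tcoord z - 2) ^+ 2 + dotp (xcoord z) (xcoord z) < 2.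
Proof. by rewrite -eballE. Qed.

Lemma cusp_domain_down z w : Om z -> tcoord w = tcoord z ->
  enorm (xcoord w) <= enorm (xcoord z) -> Om w.
Proof.
rewrite !cusp_domainE => zO -> xwz; case: zO => [[h1 h2 h3]|h]; [left|right].
  by split => //; exact: le_lt_trans h3.
by apply: le_lt_trans h; rewrite lerD2l -!sqr_enorm ler_pXn2r ?nnegrE ?enorm_ge0.
Qed.

(** The profile increases up to height 1, where it is 1; for heights between 1 and 2 the ball
    contains all points at distance less than 1 from the axis. *)
Lemma cusp_domain_mono z w : Om z -> xcoord w = xcoord z ->
  tcoord z <= tcoord w <= 2 -> Om w.
Proof.
rewrite !cusp_domainE => zO -> /andP[zw w2]; have x0 := enorm_ge0 (xcoord z).
case: zO => [[h1 h2 h3]|h]; last first.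
  by right; apply: le_lt_trans h; rewrite lerD2r; nra.
have [w1|w1] := leP (tcoord w) 1.
  by left; split => //; [exact: lt_le_trans zw|apply: lt_le_trans h3 _; rewrite le_powR// ltW].
right; rewrite -sqr_enorm.
have x1 : enorm (xcoord z) < 1 by apply: lt_le_trans h3 _; rewrite powR_le1// ?(ltW s0)// (ltW h1).
nra.
Qed.

Lemma seg_in_seg0 m (O : set 'rV[R]_m) u : O u -> seg_in O u u.
Proof. by move=> Ou l _; rewrite /seg subrr scaler0 addr0. Qed.

Lemma seg_in_sym m (O : set 'rV[R]_m) u v : seg_in O u v -> seg_in O v u.
Proof.
move=> uv l /andP[l0 l1]; have -> : seg v u l = seg u v (1 - l).
  by rewrite !segE opprB addrCA subrr addr0 addrC.
by apply: uv; apply/andP; split; lra.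
Qed.

(** From the lower point one moves parallel to the axis, where the domain widens up to height 2, and
    then across at constant height. The first edge is no longer than the distance of the endpoints,
    so the second is at most twice that distance, whence 3. An endpoint above height 2 is reached by
    a last segment in the convex ball. *)
Lemma cusp_domain_lqc d : lqc Om 3 d.
Proof.
suff H z w : Om z -> Om w -> tcoord z <= tcoord w -> exists p,
    [/\ seg_in Om z p, seg_in Om p w, seg_in Om p z & seg_in Om w p /\
        enorm (z - p) <= enorm (z - w)].
  move=> z w Oz Ow _; have [zw|/ltW zw] := leP (tcoord z) (tcoord w).
    have [p [h1 h2 _ [_ h3]]] := H _ _ Oz Ow zw.
    exists p, w; split => //; first exact: seg_in_seg0.
    rewrite subrr enorm0 addr0; have := enorm_triangle p z w; rewrite (enormB p z); lra.
  have [p [_ _ h1 [h2 h3]]] := H _ _ Ow Oz zw.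
  exists p, w; split => //; first exact: seg_in_seg0.
  rewrite subrr enorm0 addr0.
  have := enorm_triangle z w p; rewrite (enormB w z) in h3; rewrite (enormB p w); lra.
move=> Oz Ow zw.
suff [p [h1 h2 h3]] : exists p,
    [/\ seg_in Om z p, seg_in Om p w & enorm (z - p) <= enorm (z - w)].
  by exists p; split; [| |exact: seg_in_sym|split => //; exact: seg_in_sym].
have [w2|w2] := leP (tcoord w) 2.
  exists (pt (tcoord w) (xcoord z)); split.
  - move=> l /andP[l0 l1]; apply: (cusp_domain_mono Oz).
      by rewrite xcoord_seg xcoord_pt -scalerDl subrK scale1r.
    by rewrite tcoord_seg tcoord_pt; apply/andP; split; nra.
  - move=> l /andP[l0 l1].
    have e : tcoord (seg (pt (tcoord w) (xcoord z)) w l) = tcoord w.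
      by rewrite tcoord_seg tcoord_pt -mulrDl subrK mul1r.
    have xl : enorm (xcoord (seg (pt (tcoord w) (xcoord z)) w l)) <=
       (1 - l) * enorm (xcoord z) + l * enorm (xcoord w).
      rewrite xcoord_seg xcoord_pt; apply: le_trans (enormD _ _) _.
      by rewrite !enormZ !ger0_norm ?subr_ge0.
    have [xzw|xzw] := leP (enorm (xcoord z)) (enorm (xcoord w)).
      by apply: (cusp_domain_down Ow) => //; apply: le_trans xl _; nra.
    have Ow' : Om (pt (tcoord w) (xcoord z)).
      by apply: (cusp_domain_mono Oz); rewrite ?xcoord_pt// tcoord_pt zw w2.
    apply: (cusp_domain_down Ow'); rewrite ?e ?tcoord_pt// xcoord_pt.
    by apply: le_trans xl _; nra.
  - apply: (le_trans (enorm_tx _)); rewrite !ptE subrr enorm0 addr0 -tcoordB.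
    exact: normr_tcoord.
move: (Ow); rewrite cusp_domainE => -[[_ w1 _]|wB]; first lra.
move: (Oz); rewrite cusp_domainE => -[[z0 z1 zx]|zB].
  exists (pt 1 (xcoord z)); split.
  - move=> l /andP[l0 l1]; apply: (cusp_domain_mono Oz).
      by rewrite xcoord_seg xcoord_pt -scalerDl subrK scale1r.
    by rewrite tcoord_seg tcoord_pt; apply/andP; split; nra.
  - move=> l l01; right; apply: (eball_seg _ _ l01); last by case: Ow => [[]|//]; lra.
    apply/eballE; rewrite !ptE -sqr_enorm.
    have x1 : enorm (xcoord z) < 1 by apply: lt_le_trans zx _; rewrite powR_le1// ?(ltW s0)// (ltW z0).
    by have := enorm_ge0 (xcoord z); nra.
  - apply: (le_trans (enorm_tx _)); rewrite !ptE subrr enorm0 addr0.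
    apply: (le_trans _ (normr_tcoord _)); rewrite !ptE !ler0_norm; lra.
exists w; split => //; last exact: seg_in_seg0.
by move=> l l01; right; apply: (eball_seg _ _ l01); apply/eballE.
Qed.

End cusp_geometry.

(** * Connectedness through polygonal paths *)

Section polygonal_connectedness.
Context {R : realType} {m : nat}.
Implicit Types (O : set 'rV[R]_m) (u v : 'rV[R]_m).

Lemma seg_continuous u v : continuous (seg u v).
Proof.
move=> t A /nbhs_eballP[e e0 he]; have n0 : 0 < enorm (v - u) + 1 by rewrite ltr_wpDl// enorm_ge0.
apply/nbhs_ballP; exists (e / (enorm (v - u) + 1)); first exact: divr_gt0.
move=> r; rewrite /ball/= distrC ltr_pdivlMr// => rt; apply: he; rewrite /eball/= segB enormZ.
by apply: le_lt_trans rt; rewrite ler_wpM2l// lerDl.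
Qed.

Definition segset u v := seg u v @` `[0, 1].

Lemma segsetP O u v : seg_in O u v <-> segset u v `<=` O.
Proof.
split=> [h _ [t + <-]|h t t01]; first by rewrite /= in_itv; exact: h.
by apply: h; exists t => //; rewrite /= in_itv.
Qed.

Lemma segset_connected u v : connected (segset u v).
Proof.
apply: connected_continuous_connected; first exact: segment_connected.
by apply: continuous_subspaceT; exact: seg_continuous.
Qed.

Lemma segset_l u v : segset u v u.
Proof. by exists 0; [rewrite /= in_itv/= lexx ler01|rewrite seg0]. Qed.

Lemma segset_r u v : segset u v v.
Proof. by exists 1; [rewrite /= in_itv/= lexx ler01|rewrite seg1]. Qed.

Definition path3 z p q w := segset z p `|` segset p q `|` segset q w.

Lemma path3_connected z p q w : connected (path3 z p q w).
Proof.
apply: connectedU; last exact: segset_connected.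
- exists q; split; [right; exact: segset_r|exact: segset_l].
- apply: connectedU; try exact: segset_connected.
  by exists p; split; [exact: segset_r|exact: segset_l].
Qed.

Lemma path3_in O z p q w : path3 z p q w `<=` O <->
  [/\ seg_in O z p, seg_in O p q & seg_in O q w].
Proof.
rewrite /path3 !subUset; split=> [[[h1 h2] h3]|[h1 h2 h3]].
  by split; apply/segsetP.
by do 2?split; apply/segsetP.
Qed.

Lemma polygonally_connected O :
  (forall z w, O z -> O w -> exists p q, [/\ seg_in O z p, seg_in O p q & seg_in O q w]) ->
  connected O.
Proof.
move=> H; have [[z0 O0]|O0] := pselect (O !=set0); last first.
  have -> : O = set0 by apply/seteqP; split => // z Oz; apply: O0; exists z.
  exact: connected0.
have /choice[P hP] : forall w, exists pq, O w -> path3 z0 pq.1 pq.2 w `<=` O.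
  move=> w; have [Ow|nOw] := pselect (O w); last by exists (0, 0) => /nOw.
  by have [p [q h]] := H _ _ O0 Ow; exists (p, q) => _; apply/path3_in.
rewrite (_ : O = \bigcup_(w in O) path3 z0 (P w).1 (P w).2 w); last first.
  apply/seteqP; split=> [w Ow|y [w Ow]]; last exact: hP.
  by exists w => //; right; exact: segset_r.
apply: bigcup_connected; last by move=> *; exact: path3_connected.
by exists z0 => w _; left; left; exact: segset_l.
Qed.

End polygonal_connectedness.

(** * Openness, connectedness and closure of the cuspidal domain *)

Section cusp_topology.
Context {R : realType} {n : nat}.
Local Notation E := 'rV[R]_n.+1.
Variable s : R.
Hypothesis s1 : 1 < s.
Local Notation Om := (cusp_domain n s).
Local Notation ptE := (@ptE R n).
Implicit Types (z w : E).

Let s0 : 0 < s. Proof. exact: lt_trans s1. Qed.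

Lemma elip_tcoord : elip 1 (@tcoord R n).
Proof. exact: elip_coord. Qed.

Lemma elip_enorm_xcoord : elip 1 (fun z : E => enorm (xcoord z)).
Proof.
move=> z w; rewrite mul1r; apply: le_trans (enorm_subr _ _) _.
by rewrite -xcoordB enorm_xcoord.
Qed.

(** The clipped expression is the projection of the height to [0, 1]. There the power [s] is
    Lipschitz, so the gauge that describes the cusp is Lipschitz on the whole space, and its
    sublevel sets are open or closed. *)
Lemma elip_cusp_gauge : elip 1 (fun z : E => clip 2^-1 (tcoord z - 2^-1) + 2^-1) /\
  elip (1 + s) (fun z : E => enorm (xcoord z) - (clip 2^-1 (tcoord z - 2^-1) + 2^-1) `^ s).
Proof.
have h0 : (0 : R) <= 2^-1 by rewrite invr_ge0.
have e1 : elip 1 (fun z : E => clip 2^-1 (tcoord z - 2^-1) + 2^-1).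
  move=> z w; rewrite opprD addrACA subrr addr0; apply: le_trans (clip_lip _ _ h0) _.
  by rewrite opprB addrA subrK; exact: elip_tcoord.
split=> // z w.
have b01 (y : R) : 0 <= clip 2^-1 y + 2^-1 <= 1.
  by have := clip_le y h0; rewrite ler_norml; lra.
have := powR_lip s1 (b01 (tcoord z - 2^-1)) (b01 (tcoord w - 2^-1)).
have := e1 z w; have := elip_enorm_xcoord z w; rewrite !mul1r.
set a := _ `^ s; set b := _ `^ s; set c := `|clip _ _ + _ - _|; set e := enorm (z - w).
set p := enorm (xcoord z); set q := enorm (xcoord w); move=> h1 h2 h3.
rewrite (_ : p - a - (q - b) = (p - q) + (b - a)); last ring.
apply: le_trans (ler_normD _ _) _; rewrite (distrC b).
rewrite mulrDl mul1r lerD// (le_trans h3)// ler_wpM2l// ltW//.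
Qed.

Lemma elip_open_lt (k c : R) (f : E -> R) : elip k f -> open [set z | f z < c].
Proof.
move=> fk; apply: (@open_comp _ _ f [set y | y < c]); last exact: open_lt.
by move=> z _; exact: elip_continuous fk z.
Qed.

Lemma elip_closed_le (k c : R) (f : E -> R) : elip k f -> closed [set z | f z <= c].
Proof.
move=> fk; apply: (@closed_comp _ _ f [set y | y <= c]); last exact: closed_le.
by move=> z _; exact: elip_continuous fk z.
Qed.

Lemma elipN (k : R) (f : E -> R) : elip k f -> elip k (fun z => - f z).
Proof. by move=> fk z w; rewrite -opprD normrN; exact: fk. Qed.

Definition closed_cusp : set E :=
  [set z | 0 <= tcoord z <= 1 /\ enorm (xcoord z) <= tcoord z `^ s] `|`
  [set z | (tcoord z - 2) ^+ 2 + dotp (xcoord z) (xcoord z) <= 2].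

Lemma clip01 (t : R) : 0 <= t <= 1 -> clip 2^-1 (t - 2^-1) + 2^-1 = t.
Proof. by move=> /andP[h1 h2]; rewrite clip_id ?subrK// ler_norml; apply/andP; split; lra. Qed.

Lemma cusp_domain_open : open Om.
Proof.
have [e1 e2] := elip_cusp_gauge.
rewrite (_ : Om = ([set z : E | - tcoord z < 0] `&` [set z : E | tcoord z < 1] `&`
    [set z : E | enorm (xcoord z) - (clip 2^-1 (tcoord z - 2^-1) + 2^-1) `^ s < 0]) `|`
    eball (pt 2 0) (Num.sqrt 2)); last first.
  apply/seteqP; split=> z; last first.
    move=> [[[/= h1 h2] h3]|]; [left|by right].
    by move: h3; rewrite subr_lt0 clip01; [split; lra|lra].
  move=> [[h1 h2 h3]|]; last by right.
  move: (h2); rewrite le_eqVlt => /predU1P[t1|t1]; last first.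
    by left; split; [split => //=; lra|rewrite /= subr_lt0 clip01//; lra].
  right; apply/eballE; rewrite -sqr_enorm t1.
  by move: h3; rewrite t1 powR1; have := enorm_ge0 (xcoord z); nra.
apply: openU; last exact: open_eball.
apply: openI; last exact: elip_open_lt e2.
by apply: openI; [apply: elip_open_lt (elipN elip_tcoord)|apply: elip_open_lt elip_tcoord].
Qed.

Lemma cusp_domain_domain : is_domain Om.
Proof.
split; first exact: cusp_domain_open.
- apply: polygonally_connected => z w Oz Ow.
  have [p [q [h1 h2 h3 _]]] := cusp_domain_lqc s1 Oz Ow (ltr_pwDr ltr01 (lexx _)).
  by exists p, q.
- exists (pt 2 0); apply/cusp_domainE; right.
  by rewrite !ptE subrr expr0n add0r -sqr_enorm enorm0 expr0n.
Qed.

Lemma closed_cusp_closed : closed closed_cusp.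
Proof.
have [e1 e2] := elip_cusp_gauge.
apply: closedU.
  rewrite (_ : [set z | _] = ([set z : E | - tcoord z <= 0] `&` [set z : E | tcoord z <= 1] `&`
    [set z : E | enorm (xcoord z) - (clip 2^-1 (tcoord z - 2^-1) + 2^-1) `^ s <= 0])); last first.
    apply/seteqP; split=> z /=; rewrite oppr_le0 subr_le0.
      by move=> [/[dup] t01 /andP[h1 h2] h3]; rewrite clip01.
    by move=> [[h1 h2]]; rewrite clip01 ?h1 ?h2.
  apply: closedI; last exact: elip_closed_le e2.
  by apply: closedI; [apply: elip_closed_le (elipN elip_tcoord)|apply: elip_closed_le elip_tcoord].
rewrite (_ : [set z | _] = [set z : E | enorm (z - pt 2 0) <= Num.sqrt 2]).
  apply: (@elip_closed_le 1) => z w; rewrite mul1r; apply: le_trans (enorm_subr _ _) _.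
  by rewrite opprB addrA subrK.
apply/seteqP; split=> z /=;
  by rewrite enorm_leP ?sqrtr_ge0// sqr_sqrtr// (dotp_tx (z - _)) !ptE subr0 -expr2.
Qed.

Lemma closure_seg (O : set E) z c :
  (forall l, 0 < l <= 1 -> O (seg z c l)) -> closure O z.
Proof.
move=> h A /nbhs_eballP[e e0 he]; have n0 : 0 < enorm (c - z) + 1 by rewrite ltr_wpDl// enorm_ge0.
pose l := Num.min 1 (e / (enorm (c - z) + 1) / 2).
have l0 : 0 < l by rewrite lt_min ltr01/= !divr_gt0.
exists (seg z c l); split; first by apply: h; rewrite l0 ge_min lexx.
apply: he; rewrite /eball/= addrC addKr enormZ gtr0_norm//.
have : l <= e / (enorm (c - z) + 1) / 2 by rewrite ge_min lexx orbT.
rewrite ler_pdivlMr// ler_pdivlMr// => le; nra.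
Qed.

(** Every point of the closed set is the end of a segment otherwise inside the domain: towards (1,
    0) from the cusp, towards the centre from the ball. *)
Lemma closure_cuspE : closure Om = closed_cusp.
Proof.
apply/seteqP; split.
  rewrite (iffLR (closure_id _) closed_cusp_closed); apply: closureS.
  move=> z /cusp_domainE[[h1 h2 h3]|h]; [left|right; exact: ltW].
  by split; [rewrite ltW|exact: ltW].
move=> z [[/andP[t0 t1] xt]|/= h].
  apply: (@closure_seg _ _ (pt 1 0)) => l /andP[l0 l1]; apply/cusp_domainE; left.
  rewrite tcoord_seg xcoord_seg !ptE scaler0 addr0 mulr1 enormZ ger0_norm ?subr_ge0//.
  have tl : 0 < (1 - l) * tcoord z + l by nra.
  split => //; first nra.
  have : tcoord z `^ s <= ((1 - l) * tcoord z + l) `^ s by rewrite le_powR ?(ltW s0)//; nra.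
  have := powR_gt0 s tl; have := enorm_ge0 (xcoord z); nra.
apply: (@closure_seg _ _ (pt 2 0)) => l /andP[l0 l1]; apply/cusp_domainE; right.
rewrite tcoord_seg xcoord_seg !ptE scaler0 addr0 dotpZl dotpZr.
set Q := (X in X <= _) in h; set Q' := (X in X < _).
have -> : Q' = (1 - l) ^+ 2 * Q by rewrite /Q /Q'; ring.
have q1 : (1 - l) ^+ 2 < 1 by nra.
by apply: le_lt_trans (ler_wpM2l (sqr_ge0 _) h) _; lra.
Qed.

(** Squaring makes the exterior a pair of conditions on the squared distance to the axis, to which
    [dotp_seg] applies; the profile becomes [t ^ (2 * s)]. *)
Lemma exteriorE z : (~` closure Om) z <->
  2 - (tcoord z - 2) ^+ 2 < dotp (xcoord z) (xcoord z) /\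
  (0 <= tcoord z <= 1 -> tcoord z `^ (2 * s) < dotp (xcoord z) (xcoord z)).
Proof.
have xs : (enorm (xcoord z) <= tcoord z `^ s) = (dotp (xcoord z) (xcoord z) <= tcoord z `^ (2 * s)).
  by rewrite enorm_leP ?powR_ge0// powR_sqr.
rewrite closure_cuspE /setC/=; split.
  move=> h; split; first by rewrite ltNge; apply/negP => h'; apply: h; right => /=; lra.
  by move=> t01; rewrite ltNge -xs; apply/negP => h'; apply: h; left.
move=> [h1 h2] [[t01]|/=]; last lra.
by rewrite xs leNgt h2.
Qed.

End cusp_topology.

Lemma dotp_delta {R : realType} n (i : 'I_n) (x : 'rV[R]_n) : dotp (delta_mx ord0 i) x = x ord0 i.
Proof.
rewrite /dotp (bigD1 i)//= mxE !eqxx mul1r big1 ?addr0// => j ji.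
by rewrite mxE (negbTE ji) andbF mul0r.
Qed.

(** The first two coordinates of [x] turned by a right angle, normalized. If they vanish, the first
    basis vector is orthogonal to [x]. Passing to the opposite vector settles the sign against
    [y]. *)
Lemma unit_orthogonal {R : realType} n (x y : 'rV[R]_n) : (2 <= n)%N ->
  exists e, [/\ enorm e = 1, dotp e x = 0 & 0 <= dotp e y].
Proof.
case: n x y => [|[|n]]// x y _.
suff [e [e1 ex]] : exists e, enorm e = 1 /\ dotp e x = 0.
  have [ey|/ltW ey] := leP 0 (dotp e y); first by exists e.
  by exists (- e); rewrite enormN !dotpNl ex oppr0 oppr_ge0.
pose i1 : 'I_n.+2 := lift ord0 ord0.
pose f := x ord0 i1 *: delta_mx ord0 ord0 - x ord0 ord0 *: delta_mx ord0 i1 : 'rV[R]_n.+2.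
have fx : dotp f x = 0 by rewrite dotpDl dotpNl !dotpZl !dotp_delta mulrC subrr.
have [f0|f0] := eqVneq f 0; last first.
  have n0 : enorm f != 0 by rewrite enorm_eq0.
  exists ((enorm f)^-1 *: f); rewrite enormZ dotpZl fx mulr0 ger0_norm ?invr_ge0 ?enorm_ge0//.
  by rewrite mulVf.
exists (delta_mx ord0 ord0); rewrite dotp_delta; split.
  by rewrite -[delta_mx _ _]scale1r enorm_delta normr1.
have := congr1 (fun v : 'rV[R]_n.+2 => v ord0 i1) f0; rewrite !mxE !eqxx/= mulr0 mulr1 add0r.
by move/eqP; rewrite oppr_eq0 => /eqP.
Qed.

(** For [v] up to this value [v <= 1] and [v * (6 * s + 1) <= 2 * s - 2]. This is what
    [cusp_le_ball] needs to absorb the terms [v^2 + 4 s v^2 + 2 s v^3] into [(2 s - 2) v]. *)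
Definition junction_gap {R : realType} (s : R) : R := Num.min 1 ((2 * s - 2) / (6 * s + 1)).

Section cusp_exterior.
Context {R : realType} {n : nat}.
Local Notation E := 'rV[R]_n.+1.
Variable s : R.
Hypotheses (n2 : (2 <= n)%N) (s1 : 1 < s).
Local Notation Om := (cusp_domain n s).
Local Notation ptE := (@ptE R n).
Local Notation dlt := (junction_gap s).
Implicit Types (z w : E).

Let s0 : 0 < s. Proof. exact: lt_trans s1. Qed.
Let s2 : 1 < 2 * s. Proof. by have := s1; lra. Qed.

Lemma exterior_up z w : (~` closure Om) z -> tcoord w = tcoord z ->
  dotp (xcoord z) (xcoord z) <= dotp (xcoord w) (xcoord w) -> (~` closure Om) w.
Proof.
move=> /exteriorE-/(_ s1)[h1 h2] tw xw; apply/exteriorE => //; rewrite tw.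
by split=> [|/h2 {}h2]; exact: lt_le_trans xw.
Qed.

(** At height [1 - v] the squared radius of the ball is [2 - (1 + v)^2]. Since
    [(1 - v)(1 + v) <= 1], Bernoulli's inequality bounds the squared profile by [1 / (1 + 2 s v)],
    which is smaller for small [v]. *)
Lemma cusp_le_ball (v : R) : 0 <= v <= dlt -> (1 - v) `^ (2 * s) <= 2 - (1 + v) ^+ 2.
Proof.
rewrite le_min => /andP[v0 /andP[v1]]; have sp := s0.
rewrite ler_pdivlMr; last lra.
move=> vs; have /(powR_bernoulli s2) : 0 <= 1 + v by lra.
have : ((1 - v) * (1 + v)) `^ (2 * s) <= 1.
  by rewrite powR_le1//; [lra|apply/andP; split; nra].
rewrite powRM ?subr_ge0//; last lra.
have := powR_ge0 (1 - v) (2 * s).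
set p := (1 - v) `^ _; set q := (1 + v) `^ _ => p0 pq qs.
have sv : 0 <= s * v by rewrite mulr_ge0 ?(ltW sp).
have h1 : p * (1 + 2 * (s * v)) <= 1.
  by apply: le_trans pq; rewrite ler_wpM2l//; lra.
have h2 : 1 <= (2 - (1 + v) ^+ 2) * (1 + 2 * (s * v)).
  have : v * (v + 4 * (s * v) + 2 * (s * v)) <= v * (2 * s - 2) by rewrite ler_wpM2l//; lra.
  have : s * v * v * v <= s * v * v by rewrite ler_piMr// mulr_ge0.
  nra.
rewrite -(@ler_pM2r _ (1 + 2 * (s * v))); lra.
Qed.

(* From [z] move away from the cusp in a direction [e] orthogonal to [xcoord z], go parallel to
   [w - z], and come back to [w]; the square of the distance to the axis then grows by at least
   the convexity defect of the profile of the cusp. The orthogonal direction needs [2 <= n]. *)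
Lemma exterior_path (T : R) z w : (~` closure Om) z -> (~` closure Om) w ->
  0 < T -> enorm (z - w) <= T -> T <= dlt \/ 2 <= T -> exists p q,
  [/\ seg_in (~` closure Om) z p, seg_in (~` closure Om) p q,
     seg_in (~` closure Om) q w &
     enorm (z - p) + enorm (p - q) + enorm (q - w) <= 2 * T + enorm (z - w)].
Proof.
move=> Ez Ew T0 zwT HT; have [e [e1 ez ew]] := unit_orthogonal (xcoord z) (xcoord w) n2.
have ee : dotp e e = 1 by rewrite -sqr_enorm e1 expr1n.
have T0' := ltW T0.
pose u : E := pt 0 (T *: e).
have uT : enorm u <= T.
  by apply: le_trans (enorm_tx _) _; rewrite !ptE normr0 add0r enormZ e1 mulr1 ger0_norm.
have up v l : (~` closure Om) v -> 0 <= dotp e (xcoord v) -> 0 <= l <= 1 ->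
    (~` closure Om) (seg v (v + u) l).
  move=> Ev ev /andP[l0 l1]; apply: (exterior_up Ev).
    by rewrite /seg !ptE addr0; ring.
  rewrite /seg (addrC v u) addrK !ptE !(dotpDl, dotpDr, dotpZl, dotpZr) ee (dotpC _ e).
  have : 0 <= l * (T * dotp e (xcoord v)) by rewrite !mulr_ge0.
  have : 0 <= (l * T) ^+ 2 by exact: sqr_ge0.
  nra.
exists (z + u), (w + u); split.
- by move=> l l01; apply: up => //; rewrite ez.
- move=> l l01; have /andP[l0 l1] := l01.
  have l1' : 0 <= 1 - l by lra.
  have -> : seg (z + u) (w + u) l = seg z w l + u by rewrite /seg opprD addrACA subrr addr0 addrAC.
  move/exteriorE: Ez => /(_ s1)[z1 z2]; move/exteriorE: Ew => /(_ s1)[w1 w2].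
  have zwT2 : (tcoord z - tcoord w) ^+ 2 + dotp (xcoord z - xcoord w) (xcoord z - xcoord w) <= T ^+ 2.
    rewrite -tcoordB -xcoordB expr2 -dotp_tx -sqr_enorm ler_pXn2r ?nnegrE ?enorm_ge0//.
  pose N := dotp (xcoord (seg z w l + u)) (xcoord (seg z w l + u)).
  pose X := dotp (xcoord z) (xcoord z); pose X' := dotp (xcoord w) (xcoord w).
  have lT : l * (1 - l) * T ^+ 2 <= T ^+ 2 / 4.
    have : 0 <= (1 - 2 * l) ^+ 2 * T ^+ 2 by rewrite mulr_ge0 ?sqr_ge0.
    nra.
  have ll : 0 <= l * (1 - l) by rewrite mulr_ge0.
  have lzw := ler_wpM2l ll zwT2.
  have TT : 0 < T ^+ 2 by rewrite exprn_gt0.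
  (* The detour gains [T^2], and the convexity defect costs at most [T^2 / 4]. The term in the
     heights is kept because it is the defect of [(t - 2)^2], needed to stay outside the ball. *)
  have NX : (1 - l) * X + l * X' + l * (1 - l) * (tcoord z - tcoord w) ^+ 2 + T ^+ 2 / 2 < N.
    rewrite /N xcoordD xcoord_seg xcoord_pt; set y := (1 - l) *: xcoord z + l *: xcoord w.
    have -> : dotp (y + T *: e) (y + T *: e) = dotp y y + 2 * T * dotp e y + T ^+ 2.
      by move: y => y; rewrite !(dotpDl, dotpDr, dotpZl, dotpZr) (dotpC y e) ee; ring.
    have -> : dotp e y = l * dotp e (xcoord w) by rewrite dotpDr !dotpZr ez mulr0 add0r.
    rewrite dotp_seg; have : 0 <= T * (l * dotp e (xcoord w)) by rewrite !mulr_ge0.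
    rewrite -/X -/X'; lra.
  pose tt := tcoord (seg z w l + u).
  have ttE : tt = (1 - l) * tcoord z + l * tcoord w.
    by rewrite /tt tcoordD tcoord_pt addr0 tcoord_seg.
  have N1 : 2 - (tt - 2) ^+ 2 < N.
    have := ler_wpM2l l0 (ltW w1); have := ler_wpM2l l1' (ltW z1); rewrite -/X -/X' ttE.
    by move: NX TT; clear - n2 s1 s0 s2; lra.
  have [X0 X0'] : 0 <= X /\ 0 <= X' by split; exact: dotp_ge0.
  apply/exteriorE => //; split => // t01; rewrite -/tt -/N in t01 *; have /andP[t0 t1] := t01.
  have NX' : (1 - l) * X + l * X' < N.
    have : 0 <= l * (1 - l) * (tcoord z - tcoord w) ^+ 2 by rewrite mulr_ge0 ?sqr_ge0.
    by move: NX TT; clear - n2 s1 s0 s2; lra.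
  (* If [T >= 2] the squared distance to the axis exceeds 2, more than the cusp ever reaches; this
     case serves connectedness. *)
  case: HT => [Td|T2]; last first.
    have s20 : 0 <= 2 * s by exact: ltW (lt_trans ltr01 s2).
    apply: le_lt_trans (powR_le1 s20 t01) _.
    have : 0 <= l * (1 - l) * (tcoord z - tcoord w) ^+ 2 by rewrite mulr_ge0 ?sqr_ge0.
    have := mulr_ge0 l0 X0'; have := mulr_ge0 l1' X0.
    have : 2 * 2 <= T * T by exact: ler_pM.
    by move: NX; rewrite -expr2; clear - n2 s1 s0 s2; lra.
  have tzw : `|tcoord z - tcoord w| <= T.
    by rewrite -tcoordB (le_trans (normr_tcoord _)).
  have tz : `|tt - tcoord z| <= T.
    rewrite ttE (_ : _ - _ = - (l * (tcoord z - tcoord w))); last ring.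
    by rewrite normrN normrM (ger0_norm l0) (le_trans _ tzw)// ler_piMl.
  have tw : `|tt - tcoord w| <= T.
    rewrite ttE (_ : _ - _ = (1 - l) * (tcoord z - tcoord w)); last ring.
    by rewrite normrM (ger0_norm l1') (le_trans _ tzw)// ler_piMl//; move: l0; clear - n2 s1 s0 s2; lra.
  rewrite !ler_norml in tz tw; have /andP[tz1 tz2] := tz; have /andP[tw1 tw2] := tw.
  (* Within [T] of the junction the ball covers the cusp, so being outside the ball suffices. *)
  have near1 : 1 - T <= tt -> tt `^ (2 * s) < N.
    move=> h; have -> : tt = 1 - (1 - tt) by ring.
    apply: le_lt_trans (cusp_le_ball _) _; first by rewrite subr_ge0 t1 (le_trans _ Td)// lerBlDl -lerBlDr.
    by apply: le_lt_trans N1; rewrite -subr_ge0 (_ : _ - _ = 0)//; ring.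
  have [z1'|z1'] := leP (tcoord z) 1; last by apply: near1; move: z1' tz1; clear - n2 s1 s0 s2; lra.
  have [w1'|w1'] := leP (tcoord w) 1; last by apply: near1; move: w1' tw1; clear - n2 s1 s0 s2; lra.
  (* Negative heights are replaced by 0: the profile extended by 0 is still convex and monotone. *)
  have XP (v : E) : tcoord v <= 1 -> (0 <= tcoord v <= 1 -> tcoord v `^ (2 * s) < dotp (xcoord v) (xcoord v)) ->
      (Num.max 0 (tcoord v)) `^ (2 * s) <= dotp (xcoord v) (xcoord v).
    move=> v1 hv; have [v0|v0] := leP (tcoord v) 0; last by rewrite ltW// hv// ltW.
    by rewrite powR0 ?dotp_ge0// gt_eqF// (lt_trans _ s2).
  have [mz mw] : 0 <= Num.max 0 (tcoord z) /\ 0 <= Num.max 0 (tcoord w) by rewrite !le_max lexx.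
  have := powR_convex s2 mz mw l01.
  have := ler_wpM2l l1' (XP z z1' z2); have := ler_wpM2l l0 (XP w w1' w2); rewrite -/X -/X'.
  have : tt `^ (2 * s) <= ((1 - l) * Num.max 0 (tcoord z) + l * Num.max 0 (tcoord w)) `^ (2 * s).
    rewrite le_powR//; first exact: ltW (lt_trans ltr01 s2).
    by rewrite ttE lerD// ler_wpM2l// le_max lexx orbT.
  by move: NX'; clear - n2 s1 s0 s2; lra.
- by apply: seg_in_sym => l l01; exact: up.
- have -> : z + u - (w + u) = z - w by rewrite opprD addrACA subrr addr0.
  rewrite opprD addrA subrr add0r enormN (addrC w u) addrK; lra.
Qed.

Lemma exterior_lqc : 0 < dlt /\ lqc (~` closure Om) 3 dlt.
Proof.
split; first by rewrite lt_min ltr01/= divr_gt0//; have := s1; lra.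
move=> z w Ez Ew zw; have [->|zwn] := eqVneq z w.
  exists w, w; split; try exact: seg_in_seg0.
  by rewrite subrr enorm0; lra.
have zw0 : 0 < enorm (z - w) by rewrite lt_neqAle enorm_ge0 eq_sym enorm_eq0 subr_eq0 zwn.
have [p [q [h1 h2 h3 h4]]] := exterior_path Ez Ew zw0 (lexx _) (or_introl (ltW zw)).
by exists p, q; split => //; lra.
Qed.

Lemma exterior_domain : is_domain (~` closure Om).
Proof.
split.
- by apply: closed_openC; exact: closed_closure.
- apply: polygonally_connected => z w Ez Ew.
  have T2 : 2 <= enorm (z - w) + 2 by rewrite lerDr enorm_ge0.
  have T0 : 0 < enorm (z - w) + 2 by lra.
  have [|p [q [h1 h2 h3 h4]]] := exterior_path Ez Ew T0 _ (or_intror T2); first lra.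
  by exists p, q.
- exists (pt (-1) 0); apply/exteriorE => //; rewrite !ptE; split; last by lra.
  have := dotp_ge0 (0 : 'rV[R]_n); lra.
Qed.

Lemma cusp_extension_domains : extension_domain +oo%E +oo%E Om /\
  extension_domain +oo%E +oo%E (~` closure Om).
Proof.
have n3 : (0 : R) <= 3 by [].
have [d0 dq] := exterior_lqc; split.
  exact: lqc_extension_domain (cusp_domain_domain s1) n3 ltr01 (@cusp_domain_lqc _ _ _ s1 _).
exact: lqc_extension_domain exterior_domain n3 d0 dq.
Qed.

End cusp_exterior.

(** * No reflection extends from the exterior *)

Section ae_continuous.
Context {R : realType} {n : nat}.
Local Notation E := 'rV[R]_n.
Local Notation Ehat := (one_point_compactification E).

Lemma ae_nbhs_exists (P : E -> Prop) (z : E) V : {ae leb, forall w, P w} -> nbhs z V ->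
  exists2 w, V w & P w.
Proof.
move=> [N [mN N0 PN]] /nbhs_rVP[e e0 he]; apply: contrapT => nex.
pose b := box (z - const_mx (e / 2)) (z + const_mx (e / 2)).
have bV : b `<=` V.
  move=> w hw; apply: he => i; have := hw i; rewrite !mxE => /andP[h1 h2].
  by rewrite ltr_norml; apply/andP; split; lra.
have bN : b `<=` N by move=> w bw; apply: PN => /= Pw; apply: nex; exists w => //; exact: bV.
have : (leb b <= leb N)%E by apply: le_measure; rewrite ?inE//; exact: measurable_box.
rewrite N0 leb_boxE; last by move=> i; rewrite !mxE; lra.
rewrite lee_fin leNgt prodr_gt0// => i _; rewrite !mxE; lra.
Qed.

Lemma ae_eq_on_continuous O (f g : E -> R) z : ae_eq_on O f g -> nbhs z O ->
  {for z, continuous f} -> {for z, continuous g} -> f z = g z.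
Proof.
move=> fg zO cf cg; apply: contrapT => /eqP; rewrite -subr_eq0 => fgz.
have cfg : (fun w => f w - g w) @ nbhs z --> f z - g z.
  exact: (@cvgB _ _ _ (nbhs z) (nbhs_filter z) f g).
have ne := @cvgr_neq0 _ _ _ (nbhs z) (nbhs_filter z) _ _ cfg fgz.
have [w [Ow /= hw] /(_ Ow) e] := ae_nbhs_exists fg (filterI zO ne).
by move: hw; rewrite e subrr eqxx.
Qed.

Lemma finpart_continuous (r : Ehat -> Ehat) z : continuous r -> r (Some z) <> None ->
  {for z, continuous (finpart r)}.
Proof.
move=> cr; case rz : (r (Some z)) => [y|//] _ A; rewrite /finpart rz /= => Ay.
have : nbhs (r (Some z)) (Some @` A : set Ehat).
  by rewrite rz; exact: one_point_compactification_some_nbhs.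
move=> /cr h; have : nbhs z [set w | (Some @` A) (r (Some w))] by exact: h.
by apply: filterS => w [y' Ay' e] /=; rewrite -e.
Qed.

Lemma finpartE (r : Ehat -> Ehat) z y : r (Some z) = Some y -> finpart r z = y.
Proof. by rewrite /finpart => ->. Qed.

End ae_continuous.

Section no_outer_extension.
Context {R : realType} {n : nat}.
Local Notation E := 'rV[R]_n.+1.
Local Notation Ehat := (one_point_compactification E).
Variable s : R.
Hypotheses (n2 : (2 <= n)%N) (s1 : 1 < s).
Local Notation Om := (cusp_domain n s).
Local Notation ptE := (@ptE R n).
Implicit Types (z w y : E) (r : Ehat -> Ehat).

Let s0 : 0 < s. Proof. exact: lt_trans s1. Qed.

Lemma origin_boundary : boundary Om 0.
Proof.
have t0 : tcoord (0 : E) = 0 by rewrite /tcoord mxE.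
have x0 : enorm (xcoord (0 : E)) = 0.
  by apply/eqP; rewrite enorm_eq0; apply/eqP/rowP => j; rewrite !mxE.
split.
  rewrite closure_cuspE//; left; split; first by rewrite t0 lexx ler01.
  by rewrite x0 powR_ge0.
move=> /interior_subset/cusp_domainE; rewrite t0 -sqr_enorm x0 ltxx => -[[]//|].
rewrite expr0n/=; lra.
Qed.

Lemma apex_boundary : boundary Om (pt (2 + Num.sqrt 2) 0).
Proof.
have q0 : 0 < Num.sqrt (2 : R) by rewrite sqrtr_gt0.
have q2 : (Num.sqrt (2 : R)) ^+ 2 = 2 by rewrite sqr_sqrtr.
have d0 : dotp (0 : 'rV[R]_n) 0 = 0 by rewrite -sqr_enorm enorm0 expr0n.
split.
  by rewrite closure_cuspE//; right; rewrite /= !ptE d0; lra.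
move=> /interior_subset/cusp_domainE; rewrite !ptE d0 => -[[_ h _]|h]; lra.
Qed.

Lemma clip_lt (M x : R) : `|clip M x| < M -> clip M x = x.
Proof.
move=> h; have [/clip_id//|] := leP `|x| M.
move: h; rewrite /clip !maxEle !minEle => h.
rewrite ltNge ler_norml negb_and -!ltNge; move: h; rewrite ltr_norml.
by do 3?case: ifPn => //; rewrite -?ltNge => *; lra.
Qed.

Lemma outer_extension_coord r (i : 'I_n.+1) : is_reflection Om r ->
  induces_ext_from_outside +oo%E +oo%E Om r -> exists K d, [/\ 0 <= K, 0 < d &
  forall z w, Om z -> (~` closure Om) w -> enorm z < d -> enorm w < d ->
    r (Some z) <> None /\
    `|clip 4 (finpart r z ord0 i) - clip 4 (w ord0 i)| <= K * enorm (z - w)].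
Proof.
move=> [[r' [rK r'K cr cr']] rext rOm rb] [U [oU bU [C _ hU]]].
have [p [Op rp]] : exists p, Om p /\ r (Some p) = None.
  have : (r @` (Some @` Om)) None by rewrite rOm => -[].
  by move=> [_ [p Op <-] rp]; exists p.
have [a [b [d0 [d00 abU hb]]]] := near_box oU (bU _ origin_boundary).
have c4 : (0 : R) <= 4 by [].
pose u z := clip 4 (z ord0 i).
have uK : elip 1 u.
  move=> z w; apply: le_trans (clip_lip _ _ c4) _; exact: elip_coord.
have uM : bdd 4 u.
  by split; [exact: continuous_measurableT_rV (elip_continuous uK)|move=> z; exact: clip_le].
have oext : open (~` closure Om) by apply: closed_openC; exact: closed_closure.
have [v [vext vOm v1 _]] := hU u (W1p_lip oext ler01 uK uM).1.
have [M [L [W [[_ M0] L0 _ vW WL]]]] := W1p_oo_rep oU v1.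
(* The second bound keeps away from the point [p] that the reflection sends to infinity. *)
pose d := Num.min d0 (enorm p).
have p0 : 0 < enorm p.
  rewrite lt_neqAle enorm_ge0 andbT eq_sym enorm_eq0; apply/eqP => pE.
  have [_] := origin_boundary; apply; rewrite -pE.
  by rewrite /interior; apply: open_nbhs_nbhs; split => //; exact: cusp_domain_open.
have dd : 0 < d by rewrite lt_min d00 p0.
have inbox z : enorm z < d -> box a b z.
  by rewrite lt_min => /andP[zd _]; apply: hb; rewrite add0r enormN.
have WK z w : enorm z < d -> enorm w < d -> `|W z - W w| <= L * n.+1%:R * enorm (z - w).
  move=> zd wd; apply: le_trans (WL a b abU _ _ (inbox _ zd) (inbox _ wd)) _.
  rewrite -mulrA ler_wpM2l//; have := sum_abs_le (z - w).
  by under eq_bigr => j _ do rewrite [_ (_ - _) _ _]mxE [_ (- _) _ _]mxE.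
have Wc z : enorm z < d -> {for z, continuous W}.
  move=> zd; apply: (@enorm_continuous_gen _ _ W (L * n.+1%:R) z (d - enorm z)); first by rewrite subr_gt0.
  move=> w wz; apply: WK => //; have := enorm_subr w z; rewrite enormB => h.
  have := le_trans (ler_norm _) h; lra.
have db z : enorm z < d -> nbhs z [set w | enorm w < d].
  move=> zd; apply: open_nbhs_nbhs; split => //.
  exact: (elip_open_lt (elip_enorm)).
have inU z : enorm z < d -> U z by move=> /inbox/box_cbox/abU.
exists (L * n.+1%:R), d; split => //; first by rewrite mulr_ge0.
move=> z w Oz Ew zd wd.
have rz : r (Some z) <> None.
  move=> rz; have : Some z = Some p by rewrite -(rK (Some z)) rz -rp rK.
  by move=> [zp]; move: zd; rewrite zp lt_min ltxx andbF.
split => //.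
have -> : clip 4 (w ord0 i) = W w.
  symmetry; apply: (@ae_eq_on_continuous _ _ ((~` closure Om) `&` [set w | enorm w < d]) W u).
  - apply: filterS2 vext vW => x h1 h2 [Ex xd]; have Ux := inU _ xd.
    by rewrite -h2// h1.
  - by apply: filterI (db _ wd); exact: open_nbhs_nbhs.
  - exact: Wc.
  - exact: elip_continuous uK w.
have -> : clip 4 (finpart r z ord0 i) = W z.
  symmetry; apply: (@ae_eq_on_continuous _ _ (Om `&` [set w | enorm w < d]) W (u \o finpart r)).
  - apply: filterS2 vOm vW => x h1 h2 [Ox xd]; have Ux := inU _ xd.
    by rewrite -h2// h1.
  - by apply: filterI (db _ zd); apply: open_nbhs_nbhs; split => //; exact: cusp_domain_open.
  - exact: Wc.
  - apply: (@continuous_comp _ _ _ (finpart r) u); first exact: finpart_continuous.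
    exact: elip_continuous uK _.
exact: WK.
Qed.

Lemma outer_extension_lip r : is_reflection Om r ->
  induces_ext_from_outside +oo%E +oo%E Om r -> exists K d, [/\ 0 <= K, 0 < d &
  forall z w, Om z -> (~` closure Om) w -> enorm z < d -> enorm w < d ->
    exists2 y, r (Some z) = Some y & enorm (y - w) <= K * enorm (z - w)].
Proof.
move=> hr hi.
have /choice[Kd hKd] : forall i : 'I_n.+1, exists Kd : R * R, [/\ 0 <= Kd.1, 0 < Kd.2 &
  forall z w, Om z -> (~` closure Om) w -> enorm z < Kd.2 -> enorm w < Kd.2 ->
    r (Some z) <> None /\
    `|clip 4 (finpart r z ord0 i) - clip 4 (w ord0 i)| <= Kd.1 * enorm (z - w)].
  by move=> i; have [K [d h]] := outer_extension_coord i hr hi; exists (K, d).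
pose K := \sum_i (Kd i).1.
have K0 : 0 <= K by apply: sumr_ge0 => i _; case: (hKd i).
have KK i : (Kd i).1 <= K.
  by rewrite /K (bigD1 i)//= lerDl sumr_ge0// => j _; case: (hKd j).
(* With [d <= 1] and [d * (K + 1) <= 1] the clipped coordinates of the reflected point are below 1 +
   2 in absolute value, hence less than 4, and the clipping is inactive. *)
pose d := Num.min (Num.min 1 (K + 1)^-1) (\big[Num.min/1]_i (Kd i).2).
have d0 : 0 < d.
  rewrite !lt_min ltr01 invr_gt0 ltr_wpDl//=.
  by apply: (big_ind (fun x : R => 0 < x)) => // [x y x0 y0|i _]; [rewrite lt_min x0 y0|case: (hKd i)].
have dd i : d <= (Kd i).2.
  by rewrite /d ge_min; apply/orP; right; exact: bigmin_le_cond.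
exists K, d; split => // z w Oz Ew zd wd.
have h i : r (Some z) <> None /\ `|finpart r z ord0 i - w ord0 i| <= (Kd i).1 * enorm (z - w).
  have [k0 _ /(_ z w Oz Ew (lt_le_trans zd (dd i)) (lt_le_trans wd (dd i)))[rz]] := hKd i.
  have wi := ler_coord_enorm w i.
  have d1 : d <= 1 by rewrite /d !ge_min lexx.
  have dK : d * (K + 1) <= 1.
    by rewrite -ler_pdivlMr ?ltr_wpDl// div1r /d !ge_min lexx orbT.
  rewrite (@clip_id _ 4 (w ord0 i)); last by lra.
  move=> hc; split => //; rewrite -(@clip_lt 4 (finpart r z ord0 i))//.
  have zw : enorm (z - w) <= 2 * d by have := enormD z (- w); rewrite enormN; lra.
  have : (Kd i).1 * enorm (z - w) <= K * (2 * d) by apply: ler_pM => //; exact: enorm_ge0.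
  have := ler_distD (w ord0 i) (clip 4 (finpart r z ord0 i)) 0; rewrite !subr0; nra.
have [rz _] := h ord0; case E : (r (Some z)) rz => [y|]// _; exists y => //.
apply: le_trans (enorm_le_sum _) _; rewrite /K mulr_suml; apply: ler_sum => i _.
by have [_] := h i; rewrite (finpartE E) !mxE.
Qed.

Lemma cusp_slice z : Om z -> tcoord z <= 2^-1 -> 0 < tcoord z /\ enorm (xcoord z) < tcoord z `^ s.
Proof.
move=> /cusp_domainE[[? ? ?]|h] t2 //; exfalso.
have := dotp_ge0 (xcoord z); nra.
Qed.

(* Points of the cusp at height [t] are at distance O(t^s) from the exterior, so their reflections
   are at distance O(t^s) from the axis point at height [t], and [s > 1]. *)
Lemma small_slice r : is_reflection Om r ->
  induces_ext_from_outside +oo%E +oo%E Om r -> exists t : R, [/\ 0 < t, t <= 4^-1 &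
  forall z, Om z -> tcoord z = t -> exists2 y, r (Some z) = Some y & enorm (y - pt t 0) < t].
Proof.
move=> hr hi; have [K [d [K0 d0 hK]]] := outer_extension_lip hr hi.
(* The comparison point [w] lies at height [t] and distance [2 t^s] from the axis, so [z] is within
   [3 t^s] of it and the reflection of [z] within [(3 K + 2) t^s] of the axis point. With
   [t^(s-1) <= c] this is less than [t]. *)
pose c := (3 * K + 3)^-1.
have c0 : 0 < c by rewrite invr_gt0; lra.
have s10 : 0 < s - 1 by rewrite subr_gt0.
pose t0 := c `^ (s - 1)^-1.
have t0c : t0 `^ (s - 1) = c by rewrite -powRrM mulVf ?gt_eqF// powRr1// ltW.
pose t := Num.min t0 (Num.min (d / 4) 4^-1).
have tp : 0 < t by rewrite !lt_min powR_gt0//= divr_gt0//=.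
have td : t <= d / 4 by rewrite /t !ge_min lexx orbT.
have t4 : t <= 4^-1 by rewrite /t !ge_min lexx !orbT.
have tc : t `^ (s - 1) <= c.
  by rewrite -t0c le_powR ?(ltW s10) ?(ltW tp)// /t ge_min lexx.
exists t; split => // z Oz zt; have z2 : tcoord z <= 2^-1 by lra.
have [_] := cusp_slice Oz z2; rewrite zt => xz.
have ts : t `^ s <= c * t by rewrite -(powRS (ltW tp) s1) mulrC ler_wpM2r// ltW.
have tsp : 0 < t `^ s by exact: powR_gt0.
have [e [e1 _ _]] := unit_orthogonal (0 : 'rV[R]_n) 0 n2.
pose w : E := pt t ((2 * t `^ s) *: e).
have xw : enorm (xcoord w) = 2 * t `^ s.
  by rewrite xcoord_pt enormZ e1 mulr1 ger0_norm// mulr_ge0// ltW.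
have Ew : (~` closure Om) w.
  apply/exteriorE => //; rewrite -sqr_enorm xw tcoord_pt -powR_sqr; split => [|_]; nra.
have c1 : c * (3 * K + 3) = 1 by rewrite mulVf// gt_eqF//; lra.
have ct : c * t * (3 * K + 3) = t by rewrite mulrAC c1 mul1r.
have zd : enorm z < d by apply: le_lt_trans (enorm_tx _) _; rewrite zt gtr0_norm//; nra.
have wd : enorm w < d by apply: le_lt_trans (enorm_tx _) _; rewrite xw tcoord_pt gtr0_norm//; nra.
have [y ry yw] := hK z w Oz Ew zd wd; exists y => //.
have zw : enorm (z - w) <= 3 * t `^ s.
  apply: le_trans (enorm_tx _) _; rewrite tcoordB xcoordB zt tcoord_pt subrr normr0 add0r.
  by have := enormD (xcoord z) (- xcoord w); rewrite enormN xw; lra.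
have wt : enorm (w - pt t 0) <= 2 * t `^ s.
  by apply: le_trans (enorm_tx _) _; rewrite tcoordB xcoordB !tcoord_pt (xcoord_pt t 0) subr0 xw subrr normr0 add0r.
apply: le_lt_trans (enorm_triangle y w _) _.
have : K * enorm (z - w) <= K * (3 * t `^ s) by rewrite ler_wpM2l.
have : (3 * K + 2) * t `^ s <= (3 * K + 2) * (c * t) by rewrite ler_wpM2l//; lra.
have : 0 < c * t by rewrite mulr_gt0.
nra.
Qed.

Lemma reflection_inv_ext r r' : cancel r r' ->
  r @` (Some @` Om) = ~` (Some @` closure Om) ->
  forall y, (~` closure Om) y -> exists2 q, r' (Some y) = Some q & Om q /\ r (Some q) = Some y.
Proof.
move=> rK rOm y Ey; have : (r @` (Some @` Om)) (Some y).
  by rewrite rOm => -[z cz [zy]]; apply: Ey; rewrite -zy.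
by move=> [_ [q Oq <-] rq]; exists q; rewrite -?rq ?rK.
Qed.

Lemma no_outer_extension r : is_reflection Om r ->
  ~ induces_ext_from_outside +oo%E +oo%E Om r.
Proof.
move=> hr hi; have [t [t0 t4 ht]] := small_slice hr hi.
have [[r' [rK r'K cr cr']] rext rOm rb] := hr.
have inv := reflection_inv_ext rK rOm.
pose h z := tcoord (finpart r' z).
have hc z : r' (Some z) <> None -> {for z, continuous h}.
  move=> rz; apply: (@continuous_comp _ _ _ (finpart r') (@tcoord R n)).
    exact: finpart_continuous.
  exact: elip_continuous elip_tcoord _.
have r'b z : boundary Om z -> r' (Some z) = Some z.
  by move=> /rb h'; rewrite -[in LHS]h' rK.
have hb z : boundary Om z -> h z = tcoord z /\ {for z, continuous h}.
  by move=> /r'b h'; split; [rewrite /h (finpartE h')|apply: hc; rewrite h'].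
have near z (A : set R) : boundary Om z -> nbhs (tcoord z) A -> exists2 e, 0 < e &
    forall w, enorm (w - z) < e -> A (h w).
  move=> /hb[hz cz] Az; have : nbhs z (h @^-1` A) by apply: cz; rewrite hz.
  by move=> /nbhs_eballP[e e0 he]; exists e => // w /he.
have [e1 e10 h1] : exists2 e, 0 < e & forall w, enorm (w - 0) < e -> h w < t.
  apply: (near 0 [set x | x < t] origin_boundary).
  by apply: open_nbhs_nbhs; split; [exact: open_lt|rewrite /= /tcoord mxE].
have q0 : 0 < Num.sqrt (2 : R) by rewrite sqrtr_gt0.
have q2 : (Num.sqrt (2 : R)) ^+ 2 = 2 by rewrite sqr_sqrtr.
have [e2 e20 h2] : exists2 e, 0 < e & forall w, enorm (w - pt (2 + Num.sqrt 2) 0) < e -> t < h w.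
  apply: (near _ [set x | t < x] apex_boundary).
  by apply: open_nbhs_nbhs; split; [exact: open_gt|rewrite /= tcoord_pt; lra].
have [e [ee _ _]] := unit_orthogonal (0 : 'rV[R]_n) 0 n2.
pose a := - (e1 / 2); pose b := 2 + Num.sqrt 2 + e2 / 2.
pose V : set E := [set z | (~` closure Om) z /\ t <= enorm (z - pt t 0)].
have a0 : a < 0 by rewrite /a oppr_lt0 divr_gt0.
have b0 : 2 + Num.sqrt 2 < b by rewrite /b ltrDl divr_gt0.
have Vt z : tcoord z < 0 \/ 2 + Num.sqrt 2 < tcoord z -> V z.
  move=> tz; split.
    apply/exteriorE => //; have := dotp_ge0 (xcoord z); split; last by lra.
    by case: tz => tz; nra.
  apply: le_trans (normr_tcoord _); rewrite tcoordB tcoord_pt ler_normr.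
  by apply/orP; case: tz => tz; [right|left]; lra.
have Vx z : enorm (xcoord z) = 2 -> V z.
  move=> xz; split.
    apply/exteriorE => //; rewrite -sqr_enorm xz; split; first by have := sqr_ge0 (tcoord z - 2); lra.
    by move=> t01; apply: le_lt_trans (powR_le1 _ t01) _; have := s0; lra.
  by apply: le_trans (enorm_xcoord _); rewrite xcoordB xcoord_pt subr0 xz; lra.
(* At distance 2 from the axis the path passes outside the ball of radius [sqrt 2], the cusp, and
   the ball of radius [t] around the axis point. The end edges run below the tip and above the
   apex. *)
pose S := path3 (pt a 0) (pt a (2 *: e)) (pt b (2 *: e)) (pt b 0).
have SV : S `<=` V.
  apply/path3_in; split=> l /andP[l0 l1].
  - by apply: Vt; left; rewrite tcoord_seg !tcoord_pt; lra.
  - apply: Vx; rewrite xcoord_seg !xcoord_pt -scalerDl subrK scale1r enormZ ee mulr1.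
    by rewrite ger0_norm.
  - by apply: Vt; right; rewrite tcoord_seg !tcoord_pt; lra.
have cS : connected (h @` S).
  apply: connected_continuous_connected; first exact: path3_connected.
  apply: continuous_in_subspaceT => z /set_mem/SV[Ez _]; apply: hc.
  by have [q -> _] := inv z Ez.
have [y Sy hy] : (h @` S) t.
  apply: (iffLR (connected_intervalP _) cS (h (pt a 0)) (h (pt b 0))).
  - by exists (pt a 0) => //; left; left; exact: segset_l.
  - by exists (pt b 0) => //; right; exact: segset_r.
  apply/andP; split; apply: ltW.
    apply: h1; rewrite subr0; apply: le_lt_trans (enorm_tx _) _.
    by rewrite tcoord_pt xcoord_pt enorm0 addr0 /a normrN gtr0_norm; lra.
  apply: h2; apply: le_lt_trans (enorm_tx _) _.
  rewrite tcoordB xcoordB !tcoord_pt !xcoord_pt subrr enorm0 addr0 /b addrAC subrr add0r.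
  by rewrite gtr0_norm; lra.
have [Ey yt] := SV y Sy; have [q r'y [Oq rq]] := inv y Ey.
have qt : tcoord q = t by rewrite -hy /h (finpartE r'y).
have [y' ry yt'] := ht q Oq qt.
by move: ry yt'; rewrite rq => -[<-]; rewrite ltNge yt.
Qed.

End no_outer_extension.

(** * Inverse Lipschitz maps pull null sets back to null sets *)

Section outer_regularity.
Context {R : realType} {n : nat}.
Local Notation E := 'rV[R]_n.
Implicit Types (A B N O : set E).

Lemma leb_decreasing_small (G : nat -> set E) (e : R) : 0 < e -> (forall k, measurable (G k)) ->
  (leb (G 0%N) < +oo)%E -> (forall k l, (k <= l)%N -> G l `<=` G k) ->
  \bigcap_k G k = set0 -> exists k, (leb (G k) < e%:E)%E.
Proof.
move=> e0 mG G0 dG G00; apply: contrapT => /forallNP h.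
have c : leb \o G @ \oo --> leb (\bigcap_k G k).
  apply: nonincreasing_cvg_mu => //; first by rewrite G00.
  by move=> k l kl; apply/subsetPset/dG.
rewrite G00 measure0 in c.
have : (e%:E <= 0 :> \bar R)%E.
  rewrite -(cvg_lim _ c)//; apply: lime_ge; first by apply/cvg_ex; exists 0%E.
  by apply: nearW => k /=; rewrite leNgt; apply/negP/h.
by rewrite lee_fin leNgt e0.
Qed.

(** Approximating from inside and outside at once makes the property symmetric under complements;
    intersecting with [B] of finite measure allows continuity from above. *)
Definition regular B A := forall e : R, 0 < e -> exists O F,
  [/\ open O, closed F, F `<=` A, A `<=` O & (leb ((O `\` F) `&` B) < e%:E)%E].

Variable B : set E.
Hypotheses (mB : measurable B) (finB : (leb B < +oo)%E).

Let open_diff_meas O F : open O -> closed F -> measurable ((O `\` F) `&` B).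
Proof.
move=> oO cF; apply: measurableI => //; apply: measurableD.
- exact: open_measurable_rV.
- exact: closed_measurable_rV.
Qed.

Let diff_fin O F : open O -> closed F -> (leb ((O `\` F) `&` B) < +oo)%E.
Proof.
move=> oO cF; apply: le_lt_trans finB; apply: le_measure; rewrite ?inE//.
exact: open_diff_meas.
Qed.

Lemma open_box_open (a b : E) : open [set z : E | forall i, a ord0 i < z ord0 i < b ord0 i].
Proof.
rewrite openE => z hz; have h i : nbhs z [set w : E | a ord0 i < w ord0 i < b ord0 i].
  have zi : z ord0 i \in `](a ord0 i), (b ord0 i)[ by rewrite in_itv; exact: hz.
  have c : nbhs z ((fun z : E => z ord0 i) @^-1` [set x | x \in `](a ord0 i), (b ord0 i)[]).
    exact: (elip_continuous (elip_coord i)) (near_in_itvoo zi).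
  by apply: filterS c => w; rewrite /= in_itv.
exact: (@filter_forall _ _ (fun i => [set w : E | a ord0 i < w ord0 i < b ord0 i]) (nbhs z) (nbhs_filter z) h).
Qed.

Lemma regular_box a b : regular B (box a b).
Proof.
move=> e e0.
pose O (k : nat) : set E := [set z : E | forall i, a ord0 i < z ord0 i < (b + const_mx k.+1%:R^-1) ord0 i].
pose F (k : nat) := cbox (a + const_mx k.+1%:R^-1) b.
have oO k : open (O k) by exact: open_box_open.
have cF k : closed (F k) by apply: compact_closed; [exact: norm_hausdorff|exact: cbox_compact].
have kp (k : nat) : 0 < k.+1%:R^-1 :> R by rewrite invr_gt0.
have [||||k hk] := @leb_decreasing_small (fun k => (O k `\` F k) `&` B) e e0.
- by move=> k; exact: open_diff_meas.
- exact: diff_fin.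
- move=> k l kl z [[Oz Fz] Bz]; have lk : l.+1%:R^-1 <= k.+1%:R^-1 :> R by rewrite lef_pV2 ?posrE// ler_nat.
  split => //; split.
    by move=> i; have := Oz i; rewrite !mxE => /andP[-> /=] /lt_le_trans; apply; rewrite lerD2l.
  by move=> Fk; apply: Fz => i; have := Fk i; rewrite !mxE => /andP[h ->]; rewrite andbT; apply: le_trans h; rewrite lerD2l.
- apply/seteqP; split => // z h.
  have arch (x : R) : 0 < x -> exists k : nat, k.+1%:R^-1 < x.
    move=> x0; exists (Num.truncn x^-1); rewrite -[ltRHS]invrK ltf_pV2 ?posrE ?invr_gt0//.
    exact: truncnS_gt.
  have zO i : a ord0 i < z ord0 i <= b ord0 i.
    apply/andP; split; first by have [[/(_ i)/andP[]]] := h 0%N I.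
    rewrite leNgt; apply/negP => bz; have [|k hk] := arch (z ord0 i - b ord0 i); first by rewrite subr_gt0.
    by have [[/(_ i)/andP[_ +] _] _] := h k I; rewrite !mxE -ltrBlDl => /lt_trans /(_ hk); rewrite ltxx.
  have zF i : exists k : nat, a ord0 i + k.+1%:R^-1 <= z ord0 i.
    have /andP[h1 _] := zO i; have [|k hk] := arch (z ord0 i - a ord0 i); first by rewrite subr_gt0.
    by exists k; rewrite addrC -lerBrDr ltW.
  have [k hk] := choice zF; pose m := (\max_i k i)%N.
  have [[_ +] _] := h m I; apply => i; rewrite !mxE; have /andP[_ ->] := zO i; rewrite andbT.
  apply: le_trans (hk i); rewrite lerD2l lef_pV2 ?posrE// ler_nat ltnS.
  exact: leq_bigmax.
- exists (O k), (F k); split => // z.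
    by move=> h i; have := h i; rewrite !mxE => /andP[h1 ->]; rewrite andbT; apply: lt_le_trans h1; rewrite ltrDl.
  by move=> h i; have := h i; rewrite !mxE => /andP[-> h1]/=; apply: le_lt_trans h1 _; rewrite ltrDl.
Qed.

(** The open sets are united with errors summing to [e / 2]. An infinite union of closed sets need
    not be closed, so only finitely many are kept; continuity from above makes the remainder smaller
    than [e / 2]. *)
Lemma regular_bigcup (A : nat -> set E) : (forall k, regular B (A k)) ->
  regular B (\bigcup_k A k).
Proof.
move=> rA e e0; have e20 : 0 < e / 2 by rewrite divr_gt0.
have /choice[OF hOF] : forall k, exists OF : set E * set E,
  [/\ open OF.1, closed OF.2, OF.2 `<=` A k, A k `<=` OF.1 &
      (leb ((OF.1 `\` OF.2) `&` B) < (e / 2 / (2 ^ k.+1)%:R)%:E)%E].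
  move=> k; have [|O [F h]] := rA k (e / 2 / (2 ^ k.+1)%:R); last by exists (O, F).
  by rewrite divr_gt0// ltr0n expn_gt0.
pose O := \bigcup_k (OF k).1; pose F J := \bigcup_(k < J) (OF k).2.
have oO : open O by apply: bigcup_open => k _; case: (hOF k).
have cF J : closed (F J) by apply: closed_bigcup => // k _; case: (hOF k).
have mF : measurable (\bigcup_k (OF k).2).
  by apply: bigcupT_measurable => k; apply: closed_measurable_rV; case: (hOF k).
pose G := (O `\` \bigcup_k (OF k).2) `&` B.
have mG : measurable G by apply: measurableI => //; apply: measurableD => //; exact: open_measurable_rV.
have Gle : (leb G <= (e / 2)%:E)%E.
  apply: (@le_trans _ _ (\sum_(k <oo) leb (((OF k).1 `\` (OF k).2) `&` B))%E).
    apply: measure_sigma_subadditive => //.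
      by move=> k; apply: open_diff_meas; case: (hOF k).
    by move=> z [[[k _ Oz] Fz] Bz]; exists k => //; split => //; split => // h; apply: Fz; exists k.
  apply: le_trans (epsilon_trick0 xpredT (ltW e20)).
  by apply: lee_nneseries => // k _; apply: ltW; case: (hOF k).
have [||||J hJ] := @leb_decreasing_small (fun J => ((O `\` F J) `&` B) `\` G) (e / 2) e20.
- by move=> J; apply: measurableD => //; exact: open_diff_meas.
- apply: le_lt_trans (diff_fin oO (cF 0)); apply: le_measure; rewrite ?inE//.
  + by apply: measurableD => //; exact: open_diff_meas.
  + exact: open_diff_meas.
- move=> J L JL z [[[Oz Fz] Bz] Gz]; split => //; split => //; split => // -[k /= kJ Fk].
  by apply: Fz; exists k => //=; exact: leq_trans JL.
- apply/seteqP; split => // z h; have [[[Oz _] Bz] Gz] := h 0%N I; apply: Gz; split => //; split => // -[k _ Fk].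
  by have [[[_ +] _] _] := h k.+1 I; apply; exists k => /=.
- exists O, (F J); split => //.
  + by move=> z [k _ Fk]; exists k => //; case: (hOF k) => _ _ + _ _; apply.
  + by move=> z [k _ Ak]; exists k => //; case: (hOF k) => _ _ _ + _; apply.
  + rewrite (splitr e) EFinD.
    apply: (@le_lt_trans _ _ (leb G + leb (((O `\` F J) `&` B) `\` G))%E).
      have mD : measurable (((O `\` F J) `&` B) `\` G) by apply: measurableD => //; exact: open_diff_meas.
      apply: le_trans (measureU2 _ mG mD); apply: le_measure; rewrite ?inE//.
      - exact: open_diff_meas.
      - exact: measurableU.
      - by move=> z hz; have [Gz|Gz] := pselect (G z); [left|right; split].
    by apply: lee_ltD => //; rewrite ge0_fin_numE// (le_lt_trans Gle)// ltry.
Qed.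

Lemma measurable_regular A : measurable A -> regular B A.
Proof.
rewrite measurable_rVE; apply: smallest_sub => [|_ [[a b] _ <-]]; last exact: regular_box.
split.
- move=> e e0; exists set0, set0; split => //; [exact: closed0|].
  by rewrite setD0 set0I measure0 lte_fin.
- move=> C rC e e0; have [Q [F [oO cF FC OC h]]] := rC e e0.
  exists (~` F), (~` Q); split.
  + exact: closed_openC.
  + exact: open_closedC.
  + by rewrite setTD; exact: subsetC.
  + by rewrite setTD; exact: subsetC.
  + by rewrite (_ : ~` F `\` ~` Q = Q `\` F)// !setDE setCK setIC.
- exact: regular_bigcup.
Qed.

End outer_regularity.

Section lipschitz_null.
Context {R : realType} {n : nat}.
Local Notation E := 'rV[R]_n.
Implicit Types (A B N O : set E).

(** The closed set of the approximation lies in [N] and is null, so the bound passes to the open set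
    itself, once it is cut by the ball to lie in the cube where regularity holds. *)
Lemma null_open N M (e : R) : measurable N -> leb N = 0%E -> N `<=` eball 0 M -> 0 < e ->
  exists2 O, open O & N `<=` O /\ (leb O < e%:E)%E.
Proof.
move=> mN N0 NM e0; pose B := cube M : set E.
have mB : measurable B by exact: measurable_box.
have [ O [F [oO cF FN NO Oe]]] := measurable_regular mB (leb_box_fin _ _) mN e0.
have oO' : open (O `&` eball 0 M) by apply: openI => //; exact: open_eball.
have F0 : (leb F <= 0)%E.
  by rewrite -N0; apply: le_measure; rewrite ?inE//; exact: closed_measurable_rV.
exists (O `&` eball 0 M) => //; split; first by move=> z Nz; split; [exact: NO|exact: NM].
have mOF : measurable ((O `\` F) `&` B).
  apply: measurableI => //; apply: measurableD; first exact: open_measurable_rV.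
  exact: closed_measurable_rV.
apply: (@le_lt_trans _ _ (leb (((O `\` F) `&` B) `|` F))).
  apply: le_measure; rewrite ?inE.
  - exact: open_measurable_rV.
  - by apply: measurableU => //; exact: closed_measurable_rV.
  - move=> z [Oz zM]; have [Fz|Fz] := pselect (F z); [by right|left; split => //].
    apply/cubeP => i; have := ler_coord_enorm z i.
    by move: zM; rewrite /eball/= subr0 ler_norml => h /andP[h1 h2]; apply/andP; split; lra.
apply: le_lt_trans (measureU2 _ mOF (closed_measurable_rV cF)) _.
by apply: le_lt_trans (leeD2l _ F0) _; rewrite adde0.
Qed.

(** The code of the half-open grid cell of side [h] containing [z]; natural numbers as codes make
    the cells a countable disjoint family. *)
Definition gridpt (h : R) (z : E) : nat := pickle (\row_i Num.floor (z ord0 i / h) : 'rV[int]_n).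

Lemma gridptP h z w : 0 < h -> gridpt h z = gridpt h w -> enorm (z - w) <= n%:R * h.
Proof.
move=> h0 /(pcan_inj pickleK)/rowP zw; apply: le_trans (enorm_le_sum _) _.
rewrite mulr_natl -[X in _ <= _ *+ X](card_ord n) -sumr_const; apply: ler_sum => i _.
have := zw i; rewrite !mxE => e; rewrite -(ler_pM2r (_ : 0 < h^-1)) ?invr_gt0//.
rewrite divff ?gt_eqF// -[X in _ * X]gtr0_norm ?invr_gt0// -normrM mulrBl.
have := floor_itv (z ord0 i / h); have := floor_itv (w ord0 i / h); rewrite e.
by rewrite !intrD ler_norml => /andP[h1 h2] /andP[h3 h4]; apply/andP; split; lra.
Qed.

Lemma gridpt_cell h z : 0 < h ->
  gridpt h @^-1` [set gridpt h z] = [set w : E | forall i, `[(Num.floor (z ord0 i / h))%:~R * h,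
    (Num.floor (z ord0 i / h) + 1)%:~R * h[%classic (w ord0 i)].
Proof.
move=> h0; apply/seteqP; split=> w /=.
  move=> /(pcan_inj pickleK)/rowP e i; have := e i; rewrite !mxE in_itv/= => <-.
  have := floor_itv (w ord0 i / h); by rewrite ltr_pdivrMr// ler_pdivlMr//.
move=> e; congr pickle; apply/rowP => i; rewrite !mxE; apply: floor_def.
by have := e i; rewrite !in_itv/= ltr_pdivrMr// ler_pdivlMr.
Qed.

Lemma leb_gridpt_cell h z : 0 < h -> measurable (gridpt h @^-1` [set gridpt h z]) /\
  leb (gridpt h @^-1` [set gridpt h z]) = (h ^+ n)%:E.
Proof.
move=> h0; rewrite gridpt_cell//; split.
  by apply: measurable_forall_rV => i; apply: measurable_coordset; exact: measurable_itv.
pose A i : set R := `[(Num.floor (z ord0 i / h))%:~R * h, (Num.floor (z ord0 i / h) + 1)%:~R * h[%classic.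
transitivity (\prod_(i < n) lebesgue_measure (A i))%E.
  by apply: (leb_box (A := A)) => i; exact: measurable_itv.
rewrite /A.
under eq_bigr => i _ do rewrite lebesgue_measure_itv/= lte_fin ltr_pM2r// ltr_int ltzD1 lexx -EFinB -mulrBl -rmorphB/= addrAC subrr add0r mul1r.
by rewrite prodEFin prodr_const card_ord.
Qed.

(** The covers obtained at different grid sizes are not nested, but each point belongs to all of
    them from some index on; their lower limit obeys the same bound. *)
Lemma leb_liminf_le (B : nat -> set E) (c : \bar R) : (forall k, measurable (B k)) ->
  (forall k, (leb (B k) <= c)%E) ->
  measurable (\bigcup_K \bigcap_(k in [set k | (K <= k)%N]) B k) /\
  (leb (\bigcup_K \bigcap_(k in [set k | (K <= k)%N]) B k) <= c)%E.
Proof.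
move=> mB Bc; pose D K := \bigcap_(k in [set k | (K <= k)%N]) B k.
have mD K : measurable (D K) by apply: bigcap_measurable => [|k _]; [exists K => /=|exact: mB].
split; first exact: bigcupT_measurable.
have cD : leb \o D @ \oo --> leb (\bigcup_K D K).
  apply: nondecreasing_cvg_mu => //; first exact: bigcupT_measurable.
  move=> K J KJ; apply/subsetPset => z h k /= Jk; apply: h; exact: leq_trans Jk.
rewrite -(cvg_lim _ cD)//; apply: lime_le; first by apply/cvg_ex; eexists; exact: cD.
apply: nearW => K /=; apply: le_trans (Bc K); apply: le_measure; rewrite ?inE//.
by move=> z; apply => /=.
Qed.

Section preimage.
Variables (A : set E) (f : E -> E) (L : R).
Hypotheses (L0 : 0 <= L) (fL : forall z w, A z -> A w -> enorm (z - w) <= L * enorm (f z - f w)).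

(** The preimage of a cell of side [h] has diameter at most [L * n * h], so it fits in a box of
    half-side [(L * n + 1) * h] around any of its points; [C] is the ratio of the volumes. The added
    1 gives the strict inequality at the open faces. *)
Let C : R := (2 * (L * n%:R + 1)) ^+ n.
Let c0 : 0 < L * n%:R + 1. Proof. by rewrite ltr_wpDl// mulr_ge0. Qed.

Lemma cell_preimage_cover h j : 0 < h -> exists S, [/\ measurable S,
  forall z, A z -> gridpt h (f z) = j -> S z &
  measurable (gridpt h @^-1` [set j]) /\ (leb S <= C%:E * leb (gridpt h @^-1` [set j]))%E].
Proof.
move=> h0; have C0 : 0 <= C by rewrite exprn_ge0// mulr_ge0// ltW.
have mj : measurable (gridpt h @^-1` [set j] : set E).
  have [[z <-]|hj] := pselect (exists z : E, gridpt h z = j); first by case: (leb_gridpt_cell z h0).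
  by rewrite (_ : _ @^-1` _ = set0)//; apply/seteqP; split => // z zj; apply: hj; exists z.
have [[z [Az <-]]|hj] := pselect (exists z, A z /\ gridpt h (f z) = j); last first.
  exists set0; split => //; last by rewrite measure0 mule_ge0.
  by move=> z Az zj; apply: hj; exists z.
pose r := (L * n%:R + 1) * h; have r0 : 0 < r by rewrite mulr_gt0.
exists (box (z - const_mx r) (z + const_mx r)); split.
- exact: measurable_box.
- move=> w Aw /esym wz i; have := fL Az Aw; have := ler_coord_enorm (z - w) i.
  have := gridptP h0 wz; have := L0; rewrite !mxE ler_norml => h1 h2 /andP[h3 h4] h5.
  have : L * enorm (f z - f w) <= L * (n%:R * h) by rewrite ler_wpM2l.
  by move=> h6; rewrite /r; apply/andP; split; nra.
- have [m1 ->] := leb_gridpt_cell (f z) h0; split => //.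
  rewrite leb_boxE; last by move=> i; rewrite !mxE; lra.
  rewrite /vol; under eq_bigr => i _.
    rewrite !mxE (_ : _ - _ = 2 * (L * n%:R + 1) * h); last by rewrite /r; ring.
    over.
  by rewrite prodr_const card_ord exprMn -EFinM.
Qed.

(** Summing over the cells contained in [O], which are disjoint. A cell has diameter at most
    [n * h], so the cells meeting points that deep inside [O] are among them. *)
Lemma open_preimage_cover O h : open O -> 0 < h -> exists S, [/\ measurable S,
  (leb S <= C%:E * leb O)%E &
  forall z, A z -> (forall w, enorm (f z - w) <= n%:R * h -> O w) -> S z].
Proof.
move=> oO h0; have C0 : 0 <= C by rewrite exprn_ge0// mulr_ge0// ltW.
have /choice[S hS] : forall j, exists S, [/\ measurable S,
  forall z, A z -> gridpt h (f z) = j -> S z &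
  measurable (gridpt h @^-1` [set j]) /\ (leb S <= C%:E * leb (gridpt h @^-1` [set j]))%E].
  by move=> j; exact: cell_preimage_cover.
pose D := [set j | gridpt h @^-1` [set j] `<=` O].
have mS j : measurable (S j) by case: (hS j).
have mG j : measurable (gridpt h @^-1` [set j] : set E) by case: (hS j) => _ _ [].
have mSD : measurable (\bigcup_(j in D) S j) by exact: bigcup_measurable.
exists (\bigcup_(j in D) S j); split => //; last first.
  move=> z Az zO; exists (gridpt h (f z)); last by case: (hS (gridpt h (f z))) => _ + _; apply.
  by move=> w /= /esym/(gridptP h0)/zO.
have mGD : measurable (\bigcup_(j in D) gridpt h @^-1` [set j] : set E) by exact: bigcup_measurable.
apply: (@le_trans _ _ (C%:E * leb (\bigcup_(j in D) gridpt h @^-1` [set j] : set E))%E); last first.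
  apply: lee_wpmul2l; first by rewrite lee_fin.
  apply: le_measure; rewrite ?inE//; first exact: open_measurable_rV.
  by move=> z [j Dj zj]; exact: Dj.
rewrite (measure_bigcup leb D (fun j => gridpt h @^-1` [set j] : set E))//; last first.
  by apply/trivIsetP => i j _ _ ij; apply/seteqP; split => // z [/= -> e]; move: ij; rewrite e eqxx.
rewrite -nneseriesZl//.
rewrite bigcup_mkcond; have mI j : measurable (if j \in D then S j else set0) by case: ifP.
apply: le_trans (measure_sigma_subadditive leb mI _ (@subset_refl _ _)) _.
  exact: bigcupT_measurable.
rewrite [leRHS]eseries_mkcond; apply: lee_nneseries => // j _.
by case: ifP => _; [case: (hS j) => _ _ []|rewrite measure0].
Qed.

Lemma lipschitz_inverse_null N M : measurable N -> leb N = 0%E -> N `<=` eball 0 M ->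
  leb.-negligible [set z | A z /\ N (f z)].
Proof.
move=> mN N0 NM; have C0 : 0 <= C by rewrite exprn_ge0// mulr_ge0// ltW.
have C1 : 0 < C + 1 by rewrite ltr_wpDl.
suff /choice[S hS] : forall m : nat, exists S, [/\ measurable S, [set z | A z /\ N (f z)] `<=` S &
    (leb S <= (m.+1%:R^-1)%:E)%E].
  exists (\bigcap_m S m); split.
  - by apply: bigcapT_measurable => m; case: (hS m).
  - apply/eqP; rewrite eq_le measure_ge0 andbT; apply/lee_addgt0Pr => e e0.
    rewrite add0e; pose m := Num.truncn e^-1.
    apply: (@le_trans _ _ (leb (S m))).
      apply: le_measure; rewrite ?inE; [|by case: (hS m)|exact: bigcap_inf].
      by apply: bigcapT_measurable => j; case: (hS j).
    case: (hS m) => _ _ /le_trans; apply; rewrite lee_fin -[leRHS]invrK lef_pV2 ?posrE ?invr_gt0//.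
    exact/ltW/truncnS_gt.
  - by move=> z hz m _; case: (hS m) => _ + _; apply.
move=> m; have m0 : 0 < m.+1%:R^-1 / (C + 1) by rewrite divr_gt0// invr_gt0.
have [ O oO [NO Om]] := null_open mN N0 NM m0.
pose h (k : nat) : R := k.+1%:R^-1.
have h0 k : 0 < h k by rewrite invr_gt0.
have /choice[S hS] : forall k, exists S, [/\ measurable S, (leb S <= C%:E * leb O)%E &
  forall z, A z -> (forall w, enorm (f z - w) <= n%:R * h k -> O w) -> S z].
  by move=> k; exact: open_preimage_cover.
have [mS Sle] := @leb_liminf_le S (C%:E * leb O)%E (fun k => let: And3 p _ _ := hS k in p)
  (fun k => let: And3 _ p _ := hS k in p).
exists (\bigcup_K \bigcap_(k in [set k | (K <= k)%N]) S k); split => //.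
  move=> z [Az Nz]; have /nbhs_eballP[e e0 he] : nbhs (f z) O by apply: open_nbhs_nbhs; split => //; exact: NO.
  pose K := Num.truncn (n%:R / e); exists K => // k /= Kk; case: (hS k) => _ _; apply => // w zw.
  apply: he; rewrite /eball/= enormB; apply: le_lt_trans zw _.
  rewrite /h ltr_pdivrMr// mulrC -ltr_pdivrMr//; apply: lt_le_trans (truncnS_gt _) _.
  by rewrite ler_nat ltnS.
apply: le_trans Sle _; apply: le_trans (lee_wpmul2l _ (ltW Om)) _; first by rewrite lee_fin.
rewrite -EFinM lee_fin mulrC -mulrA ler_piMr ?invr_ge0//.
by rewrite mulrC ler_pdivrMr// mul1r lerDl.
Qed.

End preimage.

End lipschitz_null.

(** * The reflection of the cusp *)

Section zone_estimates.
Context {R : realType} {n : nat}.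
Local Notation E := 'rV[R]_n.+1.
Variable s : R.
Hypothesis s1 : 1 < s.
Implicit Types (a b t r c d : R) (x y o : 'rV[R]_n) (z w : E).
Local Notation P a := (a `^ (s - 1)).

Let s0 : 0 < s. Proof. exact: lt_trans s1. Qed.
Let s10 : 0 < s - 1. Proof. by rewrite subr_gt0. Qed.

(** As [b * a ^ (s - 1) <= a ^ s], the product is at most [a ^ s - b ^ s]. *)
Lemma powR_gap a b u : 0 <= b -> b <= a -> a <= 1 -> 0 <= u <= b ->
  0 <= P a - P b /\ (P a - P b) * u <= s * (a - b).
Proof.
move=> b0 ba a1 /andP[u0 ub]; have a0 := le_trans b0 ba.
have Pab : 0 <= P a - P b by rewrite subr_ge0 le_powR// ltW.
split=> //; apply: (@le_trans _ _ ((P a - P b) * b)); first by rewrite ler_wpM2l.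
have := powR_lip s1 (_ : 0 <= a <= 1) (_ : 0 <= b <= 1).
rewrite a0 a1 b0 (le_trans ba a1) => /(_ isT isT); rewrite !ger0_norm ?subr_ge0// ?le_powR// ?(ltW s0)//.
rewrite -(powRS a0 s1) -(powRS b0 s1) => h; have : b * P a <= a * P a by rewrite ler_wpM2r// powR_ge0.
lra.
Qed.

(* Comparing at the larger radius [a], the change of the factor acts on a vector of length at
   most [b], where [b * (P a - P b)] is Lipschitz although [P] itself need not be. *)
Lemma scaled_diff_gap a b x y : 0 <= b -> b <= a -> a <= 1 -> enorm y <= b ->
  enorm (P a *: x - P b *: y - P a *: (x - y)) <= s * (a - b).
Proof.
move=> b0 ba a1 yb; have yb' : 0 <= enorm y <= b by rewrite enorm_ge0.
have [h1 h2] := powR_gap b0 ba a1 yb'.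
rewrite (_ : _ - _ - _ = (P a - P b) *: y); first by rewrite enormZ ger0_norm.
by rewrite scalerBr scalerBl opprB addrC addrA subrK.
Qed.

Lemma scaled_lip a b x y d : 0 <= a <= 1 -> 0 <= b <= 1 -> enorm x <= a -> enorm y <= b ->
  `|a - b| <= d -> enorm (x - y) <= d -> enorm (P a *: x - P b *: y) <= (1 + s) * d.
Proof.
wlog ba : a b x y / b <= a.
  move=> H a01 b01 xa yb ab xy; have [/H->//|/ltW/H h] := leP b a.
  by rewrite enormB; apply: h; rewrite // 1?distrC 1?enormB.
move=> /andP[a0 a1] /andP[b0 b1] xa yb ab xy.
have := scaled_diff_gap x b0 ba a1 yb.
have := enormD (P a *: x - P b *: y - P a *: (x - y)) (P a *: (x - y)); rewrite subrK.
have Pa1 : P a <= 1 by rewrite powR_le1 ?(ltW s10)// a0.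
rewrite enormZ ger0_norm ?powR_ge0//; rewrite ger0_norm ?subr_ge0// in ab.
have : s * (a - b) <= s * d by rewrite ler_wpM2l// ltW.
have : P a * enorm (x - y) <= enorm (x - y) by rewrite ler_piMl// enorm_ge0.
lra.
Qed.

Lemma scaled_inv a b x y c d : 0 <= a <= 1 -> 0 <= b <= 1 -> enorm x <= a -> enorm y <= b ->
  c <= P a -> c <= P b ->
  `|a - b| <= d -> enorm (P a *: x - P b *: y) <= d -> c * enorm (x - y) <= (1 + s) * d.
Proof.
wlog ba : a b x y / b <= a.
  move=> H a01 b01 xa yb ca cb ab xy; have [/H->//|/ltW/H h] := leP b a.
  by rewrite enormB; apply: h; rewrite // 1?distrC 1?enormB.
move=> /andP[a0 a1] /andP[b0 b1] xa yb ca _ ab xy.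
have := scaled_diff_gap x b0 ba a1 yb; rewrite ger0_norm ?subr_ge0// in ab.
have := enormD (P a *: x - P b *: y - (P a *: x - P b *: y - P a *: (x - y))) 0.
have := enormD (P a *: x - P b *: y) (- (P a *: x - P b *: y - P a *: (x - y))).
rewrite enormN opprB addrC subrK enormZ ger0_norm ?powR_ge0// => h1 _ h2.
have : s * (a - b) <= s * d by rewrite ler_wpM2l// ltW.
have : c * enorm (x - y) <= P a * enorm (x - y) by rewrite ler_wpM2r// enorm_ge0.
lra.
Qed.

(** The formulas in zones B and C keep the direction of [x] and change its length, so radial and
    angular differences have to be estimated separately. *)
Lemma polar_diff r t x y : enorm x = 1 -> enorm y = 1 -> 0 <= r -> 0 <= t ->
  [/\ `|r - t| <= enorm (r *: x - t *: y),
      t * enorm (x - y) <= 2 * enorm (r *: x - t *: y) &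
      enorm (r *: x - t *: y) <= `|r - t| + t * enorm (x - y)].
Proof.
move=> x1 y1 r0 t0.
have h1 : `|r - t| <= enorm (r *: x - t *: y).
  by have := enorm_subr (r *: x) (t *: y); rewrite !enormZ x1 y1 !mulr1 (ger0_norm r0) (ger0_norm t0).
have e : r *: x - t *: y = (r - t) *: x + t *: (x - y).
  by rewrite scalerBl scalerBr addrA subrK.
split => //.
  have := enormD (r *: x - t *: y) (- ((r - t) *: x)).
  rewrite {1}e addrC addKr enormN !enormZ x1 mulr1 (ger0_norm t0); lra.
by rewrite e; apply: le_trans (enormD _ _) _; rewrite !enormZ x1 mulr1 (ger0_norm t0).
Qed.

Lemma polar_form x : enorm x != 0 -> exists2 o, enorm o = 1 & x = enorm x *: o /\ (enorm x)^-1 *: x = o.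
Proof.
move=> x0; exists ((enorm x)^-1 *: x); last by rewrite scalerA divff// scale1r.
by rewrite enormZ ger0_norm ?invr_ge0 ?enorm_ge0// mulVf.
Qed.

(* The second bound is an inverse Lipschitz estimate, which may degenerate as [g] tends to 0. *)
Definition tame (g : E -> R) (Z : set E) (f : E -> E) := exists2 K : R, 0 <= K &
  forall z w, Z z -> Z w -> enorm (f z - f w) <= K * enorm (z - w) /\
    forall c, 0 <= c <= 1 -> c <= P (g z) -> c <= P (g w) ->
      c * enorm (z - w) <= K * enorm (f z - f w).

Lemma tame_zoneA : tame (fun z => `|tcoord z|) zoneA
  (fun z => formulaA s (tcoord z) (xcoord z)).
Proof.
exists (2 + 6 * (1 + s)); first by have := s0; lra.
move=> z w [z1 z2 zx] [w1 w2 wx]; rewrite /formulaA.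
have z01 : 0 <= `|tcoord z| <= 1 by rewrite normr_ge0/= ler0_norm//; lra.
have w01 : 0 <= `|tcoord w| <= 1 by rewrite normr_ge0/= ler0_norm//; lra.
have tt : `| `|tcoord z| - `|tcoord w| | = `|tcoord z - tcoord w|.
  by rewrite (ler0_norm z2) (ler0_norm w2) opprK [RHS]distrC addrC.
set a := `|tcoord z| in z01 zx tt *; set b := `|tcoord w| in w01 wx tt *.
rewrite -!scalerA; set F := pt _ _; set G := pt _ _.
have FG : tcoord (F - G) = - (tcoord z - tcoord w) by rewrite tcoordB !tcoord_pt opprD opprK.
have xFG : xcoord (F - G) = 6^-1 *: (P a *: xcoord z - P b *: xcoord w).
  by rewrite xcoordB !xcoord_pt scalerBr.
set D := P a *: _ - _ in xFG; split.
  have h1 := normr_tcoord (z - w); rewrite tcoordB in h1.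
  have h2 := enorm_xcoord (z - w); rewrite xcoordB in h2.
  rewrite -tt in h1; have := scaled_lip z01 w01 zx wx h1 h2; rewrite -/D.
  have := enorm_tx (F - G); rewrite FG xFG normrN -tt enormZ (@ger0_norm _ 6^-1) ?invr_ge0//.
  have := enorm_ge0 (z - w); have := mulr_ge0 (ltW s0) (enorm_ge0 (z - w)); lra.
move=> c /andP[c0 c1] ca cb; set d := enorm (F - G).
have h1 : `|a - b| <= d by rewrite tt -normrN -FG normr_tcoord.
have h2 : enorm D <= 6 * d.
  have := enorm_xcoord (F - G); rewrite xFG enormZ (@ger0_norm _ 6^-1) ?invr_ge0//; rewrite -/d; lra.
have d0 : 0 <= d by exact: enorm_ge0.
have h3 : `|a - b| <= 6 * d by lra.
have := scaled_inv z01 w01 zx wx ca cb h3 h2.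
have := ler_wpM2l c0 (enorm_tx (z - w)); rewrite tcoordB xcoordB -tt mulrDr.
have : c * `|a - b| <= `|a - b| by rewrite ler_piMl.
lra.
Qed.

(** Once [|x| ^ (s - 1)] is taken out, the remaining radius [t / 6 + |x| / 3] is comparable to
    [|x|], because [|t| <= |x|] in this zone. This is the shape required by [scaled_lip] and
    [scaled_inv]. *)
Lemma formulaB_polar z : zoneB z -> xcoord z != 0 -> exists o,
  [/\ enorm o = 1, xcoord z = enorm (xcoord z) *: o &
    formulaB s (tcoord z) (xcoord z) = pt (enorm (xcoord z))
      (P (enorm (xcoord z)) *: ((tcoord z / 6 + enorm (xcoord z) / 3) *: o))] /\
  (0 <= enorm (xcoord z) <= 1 /\
    enorm (xcoord z) / 6 <= tcoord z / 6 + enorm (xcoord z) / 3 <= enorm (xcoord z)).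
Proof.
move=> [z1 z2 zx x2] x0; have x0' : enorm (xcoord z) != 0 by rewrite enorm_eq0.
have [ o o1 [xo _]] := polar_form x0'; exists o; split; last first.
  by have := enorm_ge0 (xcoord z); move: zx; rewrite ler_norml; lra.
split => //; rewrite /formulaB; congr pt.
set a := enorm _ in xo x0' *; have a0 : 0 <= a by exact: enorm_ge0.
rewrite xo !scalerA -scalerDl; congr (_ *: _).
have -> : a `^ (s - 1) = a * a `^ (s - 2).
  by rewrite -(mulr_powRB1 a0 s10); congr (_ * _ `^ _); ring.
ring.
Qed.

Lemma tame_zoneB : tame (fun z => enorm (xcoord z)) [set z | zoneB z /\ xcoord z != 0]
  (fun z => formulaB s (tcoord z) (xcoord z)).
Proof.
exists (3 + 18 * (1 + s)); first by have := s0; lra.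
move=> z w [zB zx] [wB wx].
have [ o [[ o1 zo ->] [a01]]] := formulaB_polar zB zx; have [q [[q1 wq ->] [b01]]] := formulaB_polar wB wx.
set a := enorm (xcoord z) in zo a01 *; set b := enorm (xcoord w) in wq b01 *.
set r := tcoord z / 6 + a / 3; set t := tcoord w / 6 + b / 3 => /andP[tb bt] /andP[ra ar].
have /andP[a0 a1] := a01; have /andP[b0 b1] := b01.
have r0 : 0 <= r by lra.
have t0 : 0 <= t by lra.
have [p1 p2 p3] := polar_diff o1 q1 r0 t0; have [p4 p5 p6] := polar_diff o1 q1 a0 b0.
rewrite -zo -wq -/a -/b in p4 p5 p6.
have ro : enorm (r *: o) <= a by rewrite enormZ o1 mulr1 ger0_norm.
have tq : enorm (t *: q) <= b by rewrite enormZ q1 mulr1 ger0_norm.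
set F := pt _ _; set G := pt _ _.
have FG : tcoord (F - G) = a - b by rewrite tcoordB !tcoord_pt.
have xFG : xcoord (F - G) = P a *: (r *: o) - P b *: (t *: q) by rewrite xcoordB !xcoord_pt.
have rt : r - t = (tcoord z - tcoord w) / 6 + (a - b) / 3 by rewrite /r /t; ring.
have e0 := enorm_ge0 (o - q); split.
  have h1 := normr_tcoord (z - w); rewrite tcoordB in h1.
  have h2 := enorm_xcoord (z - w); rewrite xcoordB in h2.
  set d := enorm (z - w) in h1 h2 *; have d0 : 0 <= d by exact: enorm_ge0.
  have h3 : enorm (r *: o - t *: q) <= 3 * d.
    have : t * enorm (o - q) <= b * enorm (o - q) by rewrite ler_wpM2r.
    have : `|r - t| <= d / 6 + d / 3.
      rewrite rt; apply: le_trans (ler_normD _ _) _; rewrite !normrM !(@ger0_norm _ (_^-1))//.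
      by move: h1 h2 p4; clear - s1 s0 s10; lra.
    by move: p3 p5 h2 d0; clear - s1 s0 s10; lra.
  have h4 : `|a - b| <= 3 * d by move: p4 h2 d0; clear - s1 s0 s10; lra.
  have := scaled_lip a01 b01 ro tq h4 h3; rewrite -xFG.
  have := enorm_tx (F - G); rewrite FG; have := mulr_ge0 (ltW s0) d0.
  by move: p4 h2 d0; clear - s1 s0 s10; lra.
move=> c /andP[c0 c1] ca cb; set d := enorm (F - G); have d0 : 0 <= d by exact: enorm_ge0.
have h1 : `|a - b| <= d by rewrite -FG normr_tcoord.
have h2 : enorm (P a *: (r *: o) - P b *: (t *: q)) <= d by rewrite -xFG enorm_xcoord.
have := scaled_inv a01 b01 ro tq ca cb h1 h2; set y := enorm (r *: o - t *: q) in p1 p2 p3 * => cy.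
have cab : c * `|a - b| <= d by apply: le_trans h1; rewrite ler_piMl.
have ct : c * `|tcoord z - tcoord w| <= 6 * (c * y) + 2 * d.
  have : `|tcoord z - tcoord w| <= 6 * y + 2 * `|a - b|.
    rewrite (_ : _ - _ = 6 * (r - t) - 2 * (a - b)); last by rewrite rt; field.
    apply: le_trans (ler_normB _ _) _; rewrite !normrM !(@ger0_norm _ (_%:R))//.
    by move: p1; clear - s1 s0 s10; lra.
  by move/(ler_wpM2l c0); move: cab; clear - s1 s0 s10; lra.
have cx : c * enorm (xcoord z - xcoord w) <= 12 * (c * y) + d.
  have : enorm (xcoord z - xcoord w) <= 12 * y + `|a - b|.
    have : b * enorm (o - q) <= 6 * t * enorm (o - q).
      by rewrite ler_wpM2r//; move: tb; clear - s1 s0 s10; lra.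
    by move: p2 p6; clear - s1 s0 s10; lra.
  by move/(ler_wpM2l c0); move: cab; clear - s1 s0 s10; lra.
have := ler_wpM2l c0 (enorm_tx (z - w)); rewrite tcoordB xcoordB mulrDr.
by move: ct cx cy d0; clear - s1 s0 s10; lra.
Qed.

(** A lower bound of [1 - t ^ (s - 1)] for [t <= 1/2], which keeps the denominators of [formulaC]
    away from 0. *)
Let kap : R := 1 - P 2^-1.

Let kap0 : 0 < kap.
Proof.
have h0 : (0 : R) <= 2^-1 by rewrite invr_ge0.
have h1 : (2^-1 : R) < 1 by rewrite invf_lt1// ltr1n.
by rewrite subr_gt0; have := lt_powR s10 h0 h1; rewrite powR1.
Qed.

(** The coefficient of [formulaC] with its sign reversed. The reflected radius is
    [t^s - bet t * (|x| - t^s)], which decreases from [t^s] at [|x| = t^s] to [t^s / 2] at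
    [|x| = t]. *)
Let bet t : R := P t / (2 * (1 - P t)).

Lemma cusp_ratio t : 0 < t <= 2^-1 -> [/\ 0 < P t, P t <= 1 - kap & bet t <= (2 * kap)^-1] /\
  P t / 2 <= bet t.
Proof.
move=> /andP[t0 t2]; have Pt : 0 < P t by exact: powR_gt0.
have Pk : P t <= 1 - kap by rewrite /kap subKr le_powR// ltW.
have k0 := kap0.
have P1 : 0 < 2 * (1 - P t) by lra.
split; last first.
  by rewrite /bet ler_pM2l// lef_pV2 ?posrE//; lra.
split => //; rewrite /bet ler_pdivrMr// mulrC ler_pdivlMr; last lra.
have : P t * kap <= 1 * kap by rewrite ler_wpM2r//; [lra|rewrite -(subr_ge0 _ 1)]; lra.
lra.
Qed.

(** [B] bounds [bet], and [G] controls its variation against a factor [v] at most the smaller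
    height: [bet t - bet r] is [P t - P r] over [2 * (1 - P t) * (1 - P r)], and that denominator is
    at least [2 * kap ^ 2]. *)
Let B : R := (2 * kap)^-1.
Let G : R := s / (2 * kap ^+ 2).

Lemma cusp_ratio_diff t r (u v d : R) : 0 < r -> r <= t -> t <= 2^-1 -> 0 <= v <= r -> t - r <= d ->
  `|bet t * u - bet r * v - bet t * (u - v)| <= G * d.
Proof.
move=> r0 rt t2 vr tr; have /andP[v0 v1] := vr; have k0 := kap0.
have tt : 0 < t <= 2^-1 by rewrite t2 (lt_le_trans r0).
have rr : 0 < r <= 2^-1 by rewrite r0 (le_trans rt).
have [[p0 p1 _] _] := cusp_ratio tt; have [[q0 q1 _] _] := cusp_ratio rr.
have t1 : t <= 1 by apply: le_trans t2 _; rewrite invf_le1// ler1n.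
have [h1 h2] := powR_gap (ltW r0) rt t1 vr.
have p1' : 0 < 1 - P t by lra.
have q1' : 0 < 1 - P r by lra.
have -> : bet t * u - bet r * v - bet t * (u - v) = (P t - P r) * v / (2 * (1 - P t) * (1 - P r)).
  by rewrite /bet; field; rewrite !gt_eqF.
have D0 : 0 < 2 * (1 - P t) * (1 - P r) by rewrite !mulr_gt0.
rewrite ger0_norm; last by apply: divr_ge0; [exact: mulr_ge0|exact: ltW].
apply: (@le_trans _ _ (s * d / (2 * kap ^+ 2))); last by rewrite /G mulrAC.
apply: ler_pM; rewrite ?mulr_ge0 ?invr_ge0 ?(ltW D0)//.
  by apply: le_trans h2 _; rewrite ler_wpM2l// ltW.
rewrite lef_pV2 ?posrE ?mulr_gt0 ?exprn_gt0//.
by rewrite -mulrA expr2 ler_wpM2l// ler_pM ?(ltW k0)//; lra.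
Qed.

Lemma cusp_ratio_lip t r (u v d : R) : 0 < t <= 2^-1 -> 0 < r <= 2^-1 -> 0 <= u <= t -> 0 <= v <= r ->
  `|t - r| <= d -> `|bet t * u - bet r * v| <= B * `|u - v| + G * d /\
  forall c, c <= P t -> c <= P r -> c * `|u - v| <= 2 * `|bet t * u - bet r * v| + 2 * (G * d).
Proof.
wlog rt : t r u v / r <= t.
  move=> H t2 r2 ut vr tr; have [rt|/ltW/H h] := leP r t; first exact: H.
  rewrite distrC in tr; have [h1 h2] := h _ _ r2 t2 vr ut tr; rewrite (distrC u) (distrC (bet t * u)).
  by split => // c ct cr; exact: h2.
move=> tt rr ut vr tr; have /andP[r0 _] := rr; have /andP[_ t2] := tt.
rewrite ger0_norm ?subr_ge0// in tr; have := cusp_ratio_diff u r0 rt t2 vr tr.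
have [[p0 p1 p2] p3] := cusp_ratio tt; have b0 : 0 <= bet t by lra.
have e : `|bet t * (u - v)| = bet t * `|u - v| by rewrite normrM ger0_norm.
set X := bet t * u - bet r * v; set Y := bet t * (u - v) in e * => XY.
have h0 : 0 <= `|u - v| by [].
split.
  have := ler_normD (X - Y) Y; rewrite subrK e.
  have : bet t * `|u - v| <= B * `|u - v| by rewrite ler_wpM2r.
  lra.
move=> c ct _; have := ler_normD X (- (X - Y)); rewrite normrN opprB addrC subrK e.
have : c / 2 * `|u - v| <= bet t * `|u - v| by rewrite ler_wpM2r//; lra.
lra.
Qed.

Lemma formulaC_polar z : zoneC s z -> xcoord z != 0 -> exists o,
  [/\ enorm o = 1, xcoord z = enorm (xcoord z) *: o &
    formulaC s (tcoord z) (xcoord z) = pt (tcoord z)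
      ((tcoord z `^ s - (bet (tcoord z) * enorm (xcoord z) - bet (tcoord z) * tcoord z `^ s)) *: o)] /\
  [/\ 0 < tcoord z <= 2^-1, 0 <= enorm (xcoord z) <= tcoord z, 0 <= tcoord z `^ s <= tcoord z,
    tcoord z `^ s <= enorm (xcoord z) &
    tcoord z `^ s / 2 <= tcoord z `^ s - (bet (tcoord z) * enorm (xcoord z) - bet (tcoord z) * tcoord z `^ s)
      <= tcoord z `^ s].
Proof.
move=> [z0 z2 zs zx] x0; have x0' : enorm (xcoord z) != 0 by rewrite enorm_eq0.
have xp : 0 < enorm (xcoord z) by rewrite lt_neqAle eq_sym x0' enorm_ge0.
have zp : 0 < tcoord z by exact: lt_le_trans zx.
have tt : 0 < tcoord z <= 2^-1 by rewrite zp ltW.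
have [ o oo [xo ox]] := polar_form x0'; have [[p0 p1 p2] p3] := cusp_ratio tt; have k0 := kap0.
have pk : 0 < 1 - P (tcoord z) by lra.
have tP : tcoord z `^ s = tcoord z * P (tcoord z) by rewrite powRS// ltW.
exists o; split; last first.
  split => //; first by rewrite (ltW xp).
    by rewrite powR_ge0 tP ler_piMr//; lra.
  have : bet (tcoord z) * (enorm (xcoord z) - tcoord z `^ s) <= tcoord z `^ s / 2.
    apply: (@le_trans _ _ (bet (tcoord z) * (tcoord z * (1 - P (tcoord z))))).
      by rewrite ler_wpM2l//; lra.
    by rewrite tP /bet le_eqVlt; apply/orP; left; apply/eqP; field; rewrite gt_eqF.
  have : 0 <= bet (tcoord z) * (enorm (xcoord z) - tcoord z `^ s) by rewrite mulr_ge0//; lra.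
  by move=> h1 h2; apply/andP; split; lra.
split => //; rewrite /formulaC ox; congr pt.
rewrite [X in _ *: X + _]xo scalerA -scalerDl; congr (_ *: _).
have -> : tcoord z `^ (2 * s - 1) = tcoord z `^ s * P (tcoord z).
  by rewrite -powRD ?(gt_eqF zp) ?implybT//; congr (_ `^ _); ring.
by rewrite /bet; field; rewrite gt_eqF//= subr_eq0 lt_eqF//; lra.
Qed.

Lemma tame_zoneC : tame (@tcoord R n) [set z | zoneC s z /\ xcoord z != 0]
  (fun z => formulaC s (tcoord z) (xcoord z)).
Proof.
have B0 : 0 <= B by rewrite invr_ge0 mulr_ge0// ltW// kap0.
have G0 : 0 <= G by apply: divr_ge0; [exact: ltW|rewrite mulr_ge0// exprn_ge0// ltW// kap0].
have Bs0 : 0 <= B * s by rewrite mulr_ge0// ltW.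
have h01 (t : R) : 0 < t <= 2^-1 -> 0 <= t <= 1 by lra.
exists (7 + 2 * s + B + 2 * (B * s) + 4 * G); first by have := s0; lra.
move=> z w [zC zx] [wC wx].
have [ o [[ o1 zo ->] [tt ut vt vu /andP[r1 r2]]]] := formulaC_polar zC zx.
have [q [[q1 wq ->] [tt' ut' vt' vu' /andP[r1' r2']]]] := formulaC_polar wC wx.
set t := tcoord z in zo tt ut vt vu r1 r2 *; set t' := tcoord w in wq tt' ut' vt' vu' r1' r2' *.
set u := enorm (xcoord z) in zo ut vu r1 r2 *; set u' := enorm (xcoord w) in wq ut' vu' r1' r2' *.
set v := t `^ s in vt vu r1 r2 *; set v' := t' `^ s in vt' vu' r1' r2' *.
set r := v - _ in r1 r2 *; set r' := v' - _ in r1' r2' *.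
have tP : v' = t' * P t' by rewrite /v' powRS//; case/andP: tt' => /ltW.
have /andP[u0 _] := ut; have /andP[u0' u1'] := ut'.
have /andP[v0 _] := vt; have /andP[v0' _] := vt'.
have rp : 0 <= r by lra.
have rp' : 0 <= r' by lra.
have [p1 p2 p3] := polar_diff o1 q1 rp rp'; have [p4 p5 p6] := polar_diff o1 q1 u0 u0'.
rewrite -zo -wq in p4 p5 p6.
have vv d : `|t - t'| <= d -> `|v - v'| <= s * d.
  move=> h; apply: le_trans (powR_lip s1 _ _) _; last by rewrite ler_wpM2l// ltW.
    exact: h01.
  exact: h01.
have rr : r - r' = (v - v') - ((bet t * u - bet t' * u') - (bet t * v - bet t' * v')).
  by rewrite /r /r'; ring.
have e0 := enorm_ge0 (o - q).
set F := pt _ _; set H := pt _ _.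
have FH : tcoord (F - H) = t - t' by rewrite tcoordB !tcoord_pt.
have xFH : xcoord (F - H) = r *: o - r' *: q by rewrite xcoordB !xcoord_pt.
split.
  have h1 := normr_tcoord (z - w); rewrite tcoordB -/t -/t' in h1.
  have h2 := enorm_xcoord (z - w); rewrite xcoordB in h2.
  set d := enorm (z - w) in h1 h2 *; have d0 : 0 <= d by exact: enorm_ge0.
  have [k1 _] := cusp_ratio_lip tt tt' ut ut' h1; have [k2 _] := cusp_ratio_lip tt tt' vt vt' h1.
  have k3 := vv _ h1.
  have k4 : `|r - r'| <= s * d + (B * d + G * d) + (B * s * d + G * d).
    rewrite rr; apply: le_trans (ler_normB _ _) _.
    have := ler_normB (bet t * u - bet t' * u') (bet t * v - bet t' * v').
    have : B * `|u - u'| <= B * d by rewrite ler_wpM2l// (le_trans p4 h2).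
    have : B * `|v - v'| <= B * (s * d) by rewrite ler_wpM2l.
    move: k1 k2 k3; clear; lra.
  have k5 : r' * enorm (o - q) <= u' * enorm (o - q).
    by rewrite ler_wpM2r// (le_trans r2' vu').
  have k6 := enorm_tx (F - H); rewrite FH xFH in k6.
  have : 0 <= B * s * d by rewrite mulr_ge0.
  have : 0 <= G * d by rewrite mulr_ge0.
  have : 0 <= s * d by rewrite mulr_ge0// ltW.
  move: k4 k5 k6 d0 h1 h2 p3 p5; clear; lra.
move=> c /andP[c0 c1] ca cb; set d := enorm (F - H); have d0 : 0 <= d by exact: enorm_ge0.
have h1 : `|t - t'| <= d by rewrite -FH normr_tcoord.
have h2 : enorm (r *: o - r' *: q) <= d by rewrite -xFH enorm_xcoord.
have [k1 k1'] := cusp_ratio_lip tt tt' ut ut' h1; have [k2 _] := cusp_ratio_lip tt tt' vt vt' h1.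
have k3 := vv _ h1.
(* [rr] is solved for the term in [u]; the other terms, in the profile heights and the reflected
   radii, are already bounded in terms of [d]. *)
have k4 : `|bet t * u - bet t' * u'| <= d + s * d + (B * s * d + G * d).
  rewrite (_ : _ - _ = (v - v') + (bet t * v - bet t' * v') - (r - r')); last by rewrite rr; ring.
  apply: le_trans (ler_normB _ _) _; have := ler_normD (v - v') (bet t * v - bet t' * v').
  have : B * `|v - v'| <= B * (s * d) by rewrite ler_wpM2l.
  move: k2 k3 p1 h2; clear; lra.
have k5 := k1' c ca cb.
(* From [c <= t' ^ (s - 1)] and [u' <= t'] one gets [c * u' <= t' ^ s <= 2 * r'], so the reflected
   points control the angle. *)
have k6 : c * (u' * enorm (o - q)) <= 4 * d.
  have : c * (u' * enorm (o - q)) <= 2 * (r' * enorm (o - q)).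
    rewrite !mulrA ler_wpM2r//; apply: (@le_trans _ _ (P t' * t')).
      by apply: ler_pM.
    by rewrite mulrC -tP -ler_pdivrMl// mulrC.
  move: p2 h2; clear; lra.
have k7 := ler_wpM2l c0 p6.
have k8 : c * `|t - t'| <= d by apply: le_trans h1; rewrite ler_piMl.
have := ler_wpM2l c0 (enorm_tx (z - w)); rewrite tcoordB xcoordB -/t -/t'.
have : 0 <= B * d by rewrite mulr_ge0.
move: k4 k5 k6 k7 k8 d0; clear; lra.
Qed.

End zone_estimates.

(** * Continuous functions that are Lipschitz on finitely many pieces *)

Section piecewise_lipschitz.
Context {R : realType} {m : nat}.
Local Notation E := 'rV[R]_m.
Implicit Types (z w y p : E).

(** If [p] is adherent to [Q], continuity extends the bound to [p], which need not lie in [Q];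
    otherwise no point of [Q] is near [p]. *)
Lemma lip_adherent (Q : set E) (F : E -> R) (K : R) p : 0 <= K ->
  (forall z w, Q z -> Q w -> `|F z - F w| <= K * enorm (z - w)) -> {for p, continuous F} ->
  exists2 d, 0 < d & forall y, Q y -> enorm (y - p) < d -> `|F y - F p| <= K * enorm (y - p).
Proof.
move=> K0 FQ cF; have [clp|nclp] := pselect (closure Q p); last first.
  have : nbhs p (~` closure Q) by apply: open_nbhs_nbhs; split => //; apply: closed_openC; exact: closed_closure.
  move=> /nbhs_eballP[d d0 hd]; exists d => // y Qy yp; exfalso; apply: (hd y yp).
  exact: subset_closure.
exists 1 => // y Qy _; apply/ler_addgt0Pr => e e0.
have e1 : 0 < e / (K + 1) by rewrite divr_gt0// ltr_wpDl.
have h1 := iffLR (@cvgrPdist_lt _ _ _ (nbhs p) (nbhs_filter p) F (F p)) cF _ e1.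
have [y' [Qy' [/= y'1 y'2]]] := clp _ (filterI h1 (eball_nbhs p e1)).
have := FQ y y' Qy Qy'; have := enorm_triangle y p y'; rewrite (enormB p y').
have := ler_distD (F y') (F y) (F p); rewrite (distrC (F y')).
have ee : e = (K + 1) * (e / (K + 1)) by rewrite mulrC divfK// gt_eqF// ltr_wpDl.
set e' := e / (K + 1) in ee y'1 y'2 e1 *; move: y'2; rewrite /eball/= => y'2 h2 h3 h4.
have : K * enorm (y - y') <= K * (enorm (y - p) + e') by rewrite ler_wpM2l//; lra.
by rewrite ee; lra.
Qed.

(** Each point of the segment is compared only with nearby points, whichever piece these belong to,
    and [local_lip_itv] assembles the bounds. The pieces may be neither closed nor convex, and the
    segment may change piece infinitely often. *)
Lemma piecewise_lip (I : finType) (Q : I -> set E) (N : set E) (F : E -> R) (K : R) : 0 <= K ->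
  (forall z, N z -> exists i, Q i z) ->
  (forall i z w, Q i z -> Q i w -> `|F z - F w| <= K * enorm (z - w)) ->
  (forall z, N z -> {for z, continuous F}) ->
  forall z w, seg_in N z w -> `|F z - F w| <= K * enorm (z - w).
Proof.
move=> K0 NQ FQ cF z w zw.
have := @local_lip_itv R (fun t => F (seg z w t)) (K * enorm (z - w)).
rewrite seg0 seg1 distrC; apply; first by rewrite mulr_ge0// enorm_ge0.
move=> t /zw Nt; have cFt := cF _ Nt.
have /choice[d hd] : forall i, exists d, 0 < d /\ forall y, Q i y -> enorm (y - seg z w t) < d ->
    `|F y - F (seg z w t)| <= K * enorm (y - seg z w t).
  by move=> i; have [d d0 h] := lip_adherent K0 (FQ i) cFt; exists d.
pose D := \big[Num.min/1]_i d i.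
have D0 : 0 < D.
  by apply: (big_ind (fun x : R => 0 < x)) => // [x y x0 y0|i _]; [rewrite lt_min x0 y0|case: (hd i)].
have n0 : 0 < enorm (w - z) + 1 by rewrite ltr_wpDl// enorm_ge0.
exists (D / (enorm (w - z) + 1)); first exact: divr_gt0.
move=> s s01 st; have [i Qi] := NQ _ (zw _ s01); have [_ h] := hd i.
have dst : enorm (seg z w s - seg z w t) = `|s - t| * enorm (w - z) by rewrite segB enormZ.
apply: le_trans (h _ Qi _) _; last by rewrite dst (enormB w) mulrCA mulrA (mulrC `|_|) mulrAC.
apply: lt_le_trans (_ : D <= d i); last exact: bigmin_le_cond.
by rewrite dst; move: st; rewrite ltr_pdivlMr//; apply: le_lt_trans; rewrite ler_wpM2l// lerDl.
Qed.

End piecewise_lipschitz.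

(** * The extension from the cusp induced by its reflection *)

Section inner_extension.
Context {R : realType} {n : nat}.
Local Notation E := 'rV[R]_n.+1.
Local Notation Ehat := (one_point_compactification E).
Variable s : R.
Hypothesis s1 : 1 < s.
Local Notation Om := (cusp_domain n s).
Local Notation ext := (~` closure Om).
Local Notation ptE := (@ptE R n).
Local Notation P a := (a `^ (s - 1)).
Implicit Types (z w y : E) (Z : set E) (f : E -> E).

Let s0 : 0 < s. Proof. exact: lt_trans s1. Qed.
Let s10 : 0 < s - 1. Proof. by rewrite subr_gt0. Qed.

Lemma tame_sub g Z Z' f f' : Z `<=` Z' -> (forall z, Z z -> f z = f' z) ->
  tame s g Z' f' -> tame s g Z f.
Proof.
move=> ZZ ff [K K0 h]; exists K => // z w Zz Zw; rewrite !ff//.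
by have [h1 h2] := h z w (ZZ _ Zz) (ZZ _ Zw).
Qed.

(** Where [g] exceeds [1 / (k + 1)] the inverse Lipschitz constant is finite. It may blow up as [k]
    grows, but countably many null preimages have a null union. *)
Lemma tame_null (g : E -> R) Z f N M : tame s g Z f -> (forall z, Z z -> 0 < g z) ->
  measurable N -> leb N = 0%E -> N `<=` eball 0 M -> leb.-negligible [set z | Z z /\ N (f z)].
Proof.
move=> [K K0 hK] g0 mN N0 NM; pose h (k : nat) : R := k.+1%:R^-1.
have h0 k : 0 < h k by rewrite invr_gt0.
have hneg k : leb.-negligible [set z | (Z z /\ h k < g z) /\ N (f z)].
  pose c := P (h k); have c0 : 0 < c by exact: powR_gt0.
  apply: (@lipschitz_inverse_null _ _ [set z | Z z /\ h k < g z] f (K / c) _ _ N M) => //.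
    by rewrite divr_ge0// ltW.
  move=> z w [Zz gz] [Zw gw]; have [_ /(_ c)] := hK z w Zz Zw.
  rewrite mulrAC ler_pdivlMr// mulrC; apply.
  - rewrite (ltW c0) powR_le1 ?(ltW s10)//; rewrite (ltW (h0 k)) invf_le1//.
    by rewrite ler1n.
  - by rewrite le_powR// ltW.
  - by rewrite le_powR// ltW.
apply: negligibleS (negligible_bigcup hneg) => z [Zz Nz]; have gz := g0 z Zz.
exists (Num.truncn (g z)^-1) => //; split => //; split => //.
by rewrite /h -[ltRHS]invrK ltf_pV2 ?posrE ?invr_gt0//; exact: truncnS_gt.
Qed.

Lemma exterior_neq0 z : ext z -> tcoord z = 0 -> xcoord z = 0 -> False.
Proof.
move=> Ez tz xz; apply: Ez; have -> : z = 0.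
  by rewrite -(pt_tx z) tz xz; apply/rowP => i; rewrite !mxE; case: unliftP => [j|] _ /=; rewrite ?mxE.
by have [] := @origin_boundary R n s s1.
Qed.

Variable r : Ehat -> Ehat.
Hypothesis hr : is_cusp_reflection s r.
Local Notation f := (finpart r).

Let hrefl : is_reflection Om r. Proof. by case: hr. Qed.

Lemma reflection_ext z : ext z -> exists2 y, r (Some z) = Some y & Om y.
Proof.
have [_ rext _ _] := hrefl; move=> Ez.
have : (r @` (~` (Some @` closure Om))) (r (Some z)).
  by exists (Some z) => // -[w cw [wz]]; apply: Ez; rewrite -wz.
by rewrite rext => -[y Oy <-]; exists y.
Qed.

(* [edist] alone is the extended distance of the library. *)
Definition cusp_piece (i : 'I_5) : set E :=
  nth set0 [:: closure Om; ext `&` (cusp_box s `&` zoneA); ext `&` (cusp_box s `&` zoneB);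
    ext `&` (cusp_box s `&` zoneC s); ext `&` ([set z | Defs.edist z Om < 1] `\` cusp_box s)] i.

Lemma cusp_piece_cover z : Defs.edist z Om < 1 -> exists i, cusp_piece i z.
Proof.
move=> z1; have [cz|Ez] := pselect (closure Om z); first by exists (@Ordinal 5 0 isT).
have [bz|bz] := pselect (cusp_box s z); last by exists (@Ordinal 5 4 isT).
have [[t1 t2 x2]|Oz] := bz; last by exfalso; apply: Ez; exact: subset_closure.
have [tx|tx] := leP `|tcoord z| (enorm (xcoord z)).
  by exists (@Ordinal 5 2 isT); split => //; split.
have [t0|t0] := leP (tcoord z) 0.
  by exists (@Ordinal 5 1 isT); split => //; split => //; split => //; exact: ltW.
exists (@Ordinal 5 3 isT); split => //; split => //; split => //.
- exact: ltW.
- rewrite leNgt; apply/negP => xs; apply: Ez; apply: subset_closure; left; split => //; lra.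
- by rewrite ltW// -[ltRHS]gtr0_norm.
Qed.

Lemma cusp_piece_tame (i : 'I_5) : i != ord0 -> exists g : E -> R,
  tame s g (cusp_piece i) f /\ forall z, cusp_piece i z -> 0 < g z.
Proof.
have [_ hz [L L0 hL] _] := hr.
case: i => -[|[|[|[|[|//]]]]] //= i5 _; rewrite /cusp_piece /=.
- exists (fun z => `|tcoord z|); split.
    apply: tame_sub (tame_zoneA s1) => [z [_ []]//|z [Ez [bz Az]]].
    by have [/(_ Az)/finpartE] := hz z (conj bz Ez).
  move=> z [Ez [_ [_ _ xz]]]; rewrite normr_gt0; apply/eqP => t0.
  apply: (exterior_neq0 Ez t0); apply/eqP; rewrite -enorm_eq0 eq_le enorm_ge0 andbT.
  by rewrite (le_trans xz)// t0 normr0.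
- have x0 z : (ext `&` (cusp_box s `&` zoneB)) z -> xcoord z != 0.
    move=> [Ez [_ [_ _ xz _]]]; apply/eqP => x0; apply: (exterior_neq0 Ez _ x0).
    by apply/eqP; rewrite -normr_eq0 eq_le normr_ge0 andbT (le_trans xz)// x0 enorm0.
  exists (fun z => enorm (xcoord z)); split.
    apply: tame_sub (tame_zoneB s1) => [z h|z [Ez [bz Bz]]].
      by split; [case: h => _ []|exact: x0].
    by have [_ /(_ Bz)/finpartE] := hz z (conj bz Ez).
  by move=> z /x0; rewrite -enorm_eq0 lt_neqAle enorm_ge0 andbT eq_sym.
- have x0 z : (ext `&` (cusp_box s `&` zoneC s)) z -> xcoord z != 0.
    move=> [Ez [_ [tz _ xz _]]]; apply/eqP => x0; apply: (exterior_neq0 Ez _ x0).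
    apply/eqP; rewrite eq_le tz andbT leNgt; apply/negP => /(powR_gt0 s).
    by rewrite ltNge (le_trans xz)// x0 enorm0.
  exists (@tcoord R n); split.
    apply: tame_sub (tame_zoneC s1) => [z h|z [Ez [bz Cz]]].
      by split; [case: h => _ []|exact: x0].
    by have [_ _ /(_ Cz)/finpartE] := hz z (conj bz Ez).
  move=> z /[dup] /x0 xz [_ [_ [_ _ _ xt]]]; apply: lt_le_trans xt.
  by rewrite lt_neqAle enorm_ge0 andbT eq_sym enorm_eq0.
- exists (fun=> 1); split; last by move=> *; exact: ltr01.
  exists L; first exact: ltW.
  move=> z w [_ Zz] [_ Zw]; have [h1 h2] := hL z w Zz Zw; split => // c /andP[c0 c1] _ _.
  apply: (@le_trans _ _ (enorm (z - w))); first by rewrite ler_piMl// enorm_ge0.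
  by move: h1; rewrite mulrC ler_pdivrMr// mulrC.
Qed.

(** The induced extension is a Lipschitz extension of [u] composed with this map, which is
    continuous because the reflection fixes the boundary. *)
Definition fold_in z : E := if pselect (closure Om z) then z else f z.

Lemma fold_in_id z : closure Om z -> fold_in z = z.
Proof. by rewrite /fold_in; case: pselect. Qed.

Lemma fold_in_ext z : ext z -> fold_in z = f z.
Proof. by rewrite /fold_in; case: pselect. Qed.

Lemma fold_in_continuous : continuous fold_in.
Proof.
have [[r' [_ _ cr _]] _ _ rb] := hrefl => z A.
have cf : r (Some z) <> None -> {for z, continuous f} by exact: finpart_continuous.
have [cz|Ez] := pselect (closure Om z); last first.
  rewrite fold_in_ext// => Az; have [y ry _] := reflection_ext Ez.
  have nz : nbhs z (f @^-1` A) by apply: cf => //; rewrite ry.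
  have ne : nbhs z ext by apply: open_nbhs_nbhs; split => //; apply: closed_openC; exact: closed_closure.
  by apply: filterS2 nz ne => w Aw Ew; rewrite /= fold_in_ext.
rewrite fold_in_id// => Az.
have [Oz|nOz] := pselect (Om z).
  have nO : nbhs z Om by apply: open_nbhs_nbhs; split => //; exact: cusp_domain_open.
  by apply: filterS2 Az nO => w Aw /subset_closure Ow; rewrite /= fold_in_id.
have rz : r (Some z) = Some z by apply: rb; split => // /interior_subset.
have nz : nbhs z (f @^-1` A) by apply: cf; rewrite ?(finpartE rz)// rz.
apply: filterS2 Az nz => w Aw fAw /=.
by have [cw|Ew] := pselect (closure Om w); [rewrite fold_in_id|rewrite fold_in_ext].
Qed.

Lemma fold_in_lip : exists2 K : R, 0 <= K &
  forall i z w, cusp_piece i z -> cusp_piece i w -> enorm (fold_in z - fold_in w) <= K * enorm (z - w).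
Proof.
have /choice[K hK] : forall i : 'I_5, exists K : R, 0 <= K /\
  forall z w, cusp_piece i z -> cusp_piece i w -> enorm (fold_in z - fold_in w) <= K * enorm (z - w).
  move=> i; have [->|i0] := eqVneq i ord0.
    by exists 1; split => // z w cz cw; rewrite !fold_in_id// mul1r.
  have [g [[K K0 h] _]] := cusp_piece_tame i0; exists K; split => // z w iz iw.
  have ext_i y : cusp_piece i y -> ext y.
    by case: (i) i0 => -[|[|[|[|[|//]]]]] //= i5 _; rewrite /cusp_piece /= => -[].
  by rewrite !fold_in_ext; [case: (h z w iz iw)|exact: ext_i..].
exists (\sum_i K i); first by apply: sumr_ge0 => i _; case: (hK i).
move=> i z w iz iw; case: (hK i) => _ /(_ z w iz iw)/le_trans; apply.
rewrite ler_wpM2r ?enorm_ge0// (bigD1 i)//= lerDl sumr_ge0// => j _; by case: (hK j).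
Qed.

Lemma cusp_domain_bounded : Om `<=` eball 0 10.
Proof.
move=> z Oz; rewrite /eball/= subr0; apply: le_lt_trans (enorm_tx _) _.
move: Oz => /cusp_domainE[[t0 t1 xt]|h].
  have : tcoord z `^ s <= 1 by rewrite powR_le1 ?(ltW s0)// (ltW t0).
  by rewrite gtr0_norm//; lra.
have x2 : enorm (xcoord z) <= 2.
  by rewrite enorm_leP//; have := sqr_ge0 (tcoord z - 2); lra.
have : `|tcoord z| <= 4.
  by rewrite ler_norml; have := dotp_ge0 (xcoord z); nra.
lra.
Qed.

(** A Lipschitz representative agrees with [u] off a null set of the cusp; the composition with the
    reflection agrees almost everywhere only if the preimage of that set is null too. *)
Lemma reflection_null N : leb.-negligible N ->
  leb.-negligible [set z | [/\ Defs.edist z Om < 1, ext z & N (f z)]].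
Proof.
move=> [A [mA A0 NA]]; pose N' := A `&` Om.
have mO : measurable Om by apply: open_measurable_rV; exact: cusp_domain_open.
have mN' : measurable N' by exact: measurableI.
have N'0 : leb N' = 0%E.
  by apply/eqP; rewrite eq_le measure_ge0 andbT -A0 le_measure// ?inE//; exact: subIsetl.
have N'b : N' `<=` eball 0 10 by move=> z [_ /cusp_domain_bounded].
have hneg i : leb.-negligible [set z | (i != ord0 /\ cusp_piece i z) /\ N' (f z)].
  have [->|i0] := eqVneq i ord0.
    by rewrite (_ : [set z | _] = set0)//; [exact: negligible_set0|apply/seteqP; split => // z [[]]].
  have [g [tg g0]] := cusp_piece_tame i0.
  by apply: negligibleS (tame_null tg g0 mN' N'0 N'b) => z [[_ iz] Nz].
have := negligible_bigcup (fun k => hneg (inord k)).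
apply: negligibleS => z [z1 Ez Nz]; have [i iz] := cusp_piece_cover z1.
exists i => //; rewrite /= inord_val; split; last first.
  by split; [exact: NA|have [y ry Oy] := reflection_ext Ez; rewrite (finpartE ry)].
by split => //; apply/eqP => i0; move: iz; rewrite i0 /cusp_piece.
Qed.

Lemma inner_extension : induces_ext_from_inside +oo%E +oo%E Om r.
Proof.
have oO : open Om by exact: cusp_domain_open.
(* From a point of this neighbourhood a segment shorter than 1/2 stays at distance less than 1 from
   the domain, where the pieces cover. As [U] contains the domain, the norm on their intersection is
   the full norm of [u]. *)
pose U : set E := \bigcup_(w in Om) eball w 2^-1.
have UE z : U z -> exists2 w, Om w & enorm (z - w) < 2^-1 by move=> [w Ow zw]; exists w.
have half0 : (0 : R) < 2^-1 by rewrite invr_gt0.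
have OU : Om `<=` U by move=> z Oz; exists z => //; rewrite /eball/= subrr enorm0.
have dU z w : Om w -> enorm (z - w) < 1 -> Defs.edist z Om < 1.
  move=> Ow; apply: le_lt_trans; apply: ge_inf; last by exists w.
  by exists 0 => _ [y _ <-]; exact: enorm_ge0.
have segU z w : U z -> enorm (z - w) < 2^-1 -> seg_in [set y | Defs.edist y Om < 1] z w.
  move=> /UE[y Oy zy] zw l /andP[l0 l1]; apply: (dU _ y Oy).
  have := enorm_triangle (seg z w l) z y; rewrite {2}/seg [in X in _ <= X + _]addrC addKr enormZ ger0_norm//.
  have : l * enorm (w - z) <= enorm (w - z) by rewrite ler_piMl// enorm_ge0.
  by rewrite (enormB w); lra.
have oU : open U by apply: bigcup_open => w _; exact: open_eball.
exists U; split => //.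
  by move=> z [cz _]; have [w [Ow zw]] := cz _ (eball_nbhs z half0); exists w => //; rewrite /eball/= enormB.
have [C C0 hC] := lqc_extend oO (ler0n R 3) ltr01 (@cusp_domain_lqc R n s s1 1).
have [K K0 hK] := fold_in_lip.
(* [C * K] serves pairs at distance less than 1/2; for the others [2 * M] is at most [4 * M] times
   the distance. *)
pose C' := C * K + 4.
have C'0 : 0 <= C' by rewrite addr_ge0// mulr_ge0.
exists (1 + n.+1%:R * C'); first by rewrite ltr_pwDl// mulr_ge0.
move=> u /hC[M [L [V [NE [M0 L0] VK VM uV]]]].
pose F := V \o fold_in.
have ML : 0 <= M + L by rewrite addr_ge0.
have CML : 0 <= C * (M + L) by rewrite mulr_ge0.
have FK z w : U z -> U w -> `|F z - F w| <= C' * (M + L) * enorm (z - w).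
  move=> Uz Uw; have e0 := enorm_ge0 (z - w); have [zw|zw] := ltP (enorm (z - w)) 2^-1.
    apply: (@le_trans _ _ (C * (M + L) * K * enorm (z - w))).
      apply: (@piecewise_lip _ _ _ cusp_piece [set y | Defs.edist y Om < 1] F).
      - by rewrite mulr_ge0.
      - by move=> y; exact: cusp_piece_cover.
      - move=> i x y ix iy; apply: le_trans (VK _ _) _; rewrite -[leRHS]mulrA ler_wpM2l//; exact: hK ix iy.
      - move=> y _; apply: (@continuous_comp _ _ _ fold_in V); first exact: fold_in_continuous.
        exact: elip_continuous VK _.
      - exact: segU.
    rewrite ler_wpM2r// /C' mulrDl mulrAC lerDl mulr_ge0//.
  apply: (@le_trans _ _ (M + M)).
    by apply: le_trans (ler_normB _ _) _; apply: lerD; exact: VM.2.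
  apply: (@le_trans _ _ (4 * (M + L) * 2^-1)); first lra.
  apply: ler_pM => //; [by rewrite mulr_ge0|].
  by rewrite ler_wpM2r// /C' lerDr mulr_ge0.
have [v [vK vM vF]] := mcshane (mulr_ge0 C'0 ML) M0 FK (fun z _ => VM.2 _).
have [v1 v2] := W1p_lip oU (mulr_ge0 C'0 ML) vK vM.
exists v; split => //.
- apply: filterS uV => z h [Oz Uz]; rewrite vF// h// /F/= fold_in_id//; exact: subset_closure.
- apply: negligibleS (reflection_null uV) => z /= hz; apply: contrapT => nz.
  apply: hz => -[Uz Ez]; apply: contrapT => ne; apply: nz; split => //.
    by have [w Ow zw] := UE z Uz; apply: (dU _ w Ow); apply: lt_trans zw _; rewrite invf_lt1// ltr1n.
  by move=> h; apply: ne; rewrite vF// /F/= fold_in_ext// h//; have [y ry Oy] := reflection_ext Ez; rewrite (finpartE ry).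
- apply: (le_trans v2); have -> : U `&` Om = Om by exact: setIidr.
  by rewrite NE -EFinM lee_fin [leRHS]mulrDl mul1r -mulrA lerD ?lerDl.
Qed.

End inner_extension.

(* The ambient space is R^(n+1), so the dimension is n.+1. *)
Theorem theorem1p3 (R : realType) (n : nat) (s : R)
    (n3 : (3 <= n.+1)%N) (s1 : 1 < s) :
  [/\ extension_domain +oo +oo (cusp_domain n s) /\
      extension_domain +oo +oo (~` closure (cusp_domain n s)),
      forall R1 : one_point_compactification 'rV[R]_n.+1 ->
                  one_point_compactification 'rV[R]_n.+1,
        is_cusp_reflection s R1 ->
        induces_ext_from_inside +oo +oo (cusp_domain n s) R1 &
      ~ exists r : one_point_compactification 'rV[R]_n.+1 ->
                   one_point_compactification 'rV[R]_n.+1,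
          is_reflection (cusp_domain n s) r /\
          induces_ext_from_outside +oo +oo (cusp_domain n s) r].
Proof.
split.
- exact: cusp_extension_domains.
- by move=> R1 hR1; exact: inner_extension.
- by move=> [r [hr]]; exact: no_outer_extension.
Qed.
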